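(* Let $\Bbbk$ be an algebraically closed field and let $\Lambda=\Bbbk Q/\mathcal{I}$ be a string category. Let $\mathbf{F}=(F,L)$ be a linear shape and $\mathbf{G}=(G,Z)$ a cyclic shape over $Q$, both compatible with $\mathcal{I}$. Let $\lambda\in\Bbbk\setminus\{0\}$, $s>0$ an integer and $\gamma\in Z_1$. Then the following statements hold. 1. The set $N_\Lambda([S_{\mathbf{F}}])$ consists of the isoclasses of strings whose shapes are subshapes of $\mathbf{F}$. 2. The set $N_\Lambda([B_{\mathbf{G}}(\lambda,s,\gamma)])$ consists of the isoclasses of strings whose (linear) shapes factor through $\mathbf{G}$, together with the isoclasses $[B_{\mathbf{G}}(\mu,t,\gamma)]$, where $\mu\in\Bbbk\setminus\{0\}$ and $t\geq 1$ is such that $[b_{1,t}]\in N_{1,s}$.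
   Context: Quivers and modules. A quiver $Q$ consists of finite sets $Q_0$ (vertices), $Q_1$ (arrows) and maps $t,h:Q_1\to Q_0$ (tail, head); $Q_1(x,y)$ is the set of arrows from $x$ to $y$. The path category $\Bbbk Q$ is the $\Bbbk$-linear category with object set $Q_0$ whose morphism space from $x$ to $y$ has the paths from $x$ to $y$ (including the trivial path $e_x$ if $x=y$) as basis, with composition by concatenation. For a small $\Bbbk$-linear category $\mathcal{A}$, $\mathrm{mod}\,\mathcal{A}$ is the category of $\Bbbk$-linear functors $m$ from $\mathcal{A}$ to vector spaces with all $m(x)$ finite dimensional; for an ideal $\mathcal{I}$ of $\Bbbk Q$, $\mathrm{mod}\,\Bbbk Q/\mathcal{I}$ is identified with the modules in $\mathrm{mod}\,\Bbbk Q$ vanishing on $\mathcal{I}$. The tensor product is $(m\otimes n)(x)=m(x)\otimes n(x)$, $(m\otimes n)(\alpha)=m(\alpha)\otimes n(\alpha)$ for vertices $x$ and arrows $\alpha$. String category. $\Lambda=\Bbbk Q/\mathcal{I}$ is a string category if its morphism spaces are finite dimensional and: (i) $\mathcal{I}$ is generated by a set of paths; (ii) each vertex of $Q$ is the tail of at most two arrows and the head of at most two arrows; (iii) for each arrow $\alpha$ there is at most one arrow $\beta$ such that $\alpha\beta$ is a path not in $\mathcal{I}$ and at most one arrow $\gamma$ such that $\gamma\alpha$ is a path not in $\mathcal{I}$. Wrappings and shapes. A linear functor $F:\Bbbk P\to\Bbbk Q$ is a wrapping if it maps arrows to arrows and induces injective maps $P_1(x,y)\to Q_1(Fx,Fy)$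 for all $x,y\in P_0$ (so it is induced by a quiver morphism). It is strict if for all distinct arrows $\alpha:x\to y$, $\alpha':x'\to y'$ of $P$, $F\alpha=F\alpha'$ implies $x\ne x'$ and $y\ne y'$. A shape over $Q$ is a pair $\mathbf{F}=(F,P)$ with $P$ a quiver and $F:\Bbbk P\to\Bbbk Q$ a strict wrapping. Shapes $(F_1,P^1)$, $(F_2,P^2)$ are isomorphic if there is a quiver isomorphism $\sigma:P^1\to P^2$ with $F_1=F_2\circ\sigma$. The shape is compatible with $\mathcal{I}$ if all elements of $\mathcal{I}$ can be written as linear combinations of paths not of the form $F\gamma$ with $\gamma$ a path in $P$; all shapes over $Q$ are assumed compatible with $\mathcal{I}$. A shape $\mathbf{F'}=(F',P')$ factors through $\mathbf{F}=(F,P)$ if there is a strict wrapping $G:\Bbbk P'\to\Bbbk P$ with $F'=FG$; it is a subshape of $\mathbf{F}$ if such a $G$ can be chosen to be given by a monomorphism of quivers $P'\to P$. Push-down. For a wrapping $F:\Bbbk P\to\Bbbk Q$ and $m\in\mathrm{mod}\,\Bbbk P$, $F_*m$ is given by $(F_*m)(x')=\bigoplus_{Fx=x'}m(x)$, and for an arrow $\alpha':x'\to y'$, $(F_*m)(\alpha')$ is the linear map whose component from $m(x)$ to $m(y)$ is $m(\alpha)$ if there is $\alpha\in P_1(x,y)$ with $F\alpha=\alpha'$, and $0$ otherwise. If $F$ is compatible with $\mathcal{I}$ then $F_*m$ is a $\Lambda$-module. Strings. A quiver is linear if its underlying graph is of Dynkin type $\mathbb{A}_n$ ($n\ge1$ vertices);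 a shape $(F,L)$ is linear if $L$ is. $\chi_L$ is the $\Bbbk L$-module with $\chi_L(x)=\Bbbk$ at every vertex and $\chi_L(\alpha)=1_\Bbbk$ for every arrow. The string of a linear shape is $S_{\mathbf{F}}=F_*\chi_L$. Bands. A quiver is cyclic if its underlying graph is of extended Dynkin type $\tilde{\mathbb{A}}$ (a single cycle; the one-loop quiver is included). A shape $\mathbf{G}=(G,Z)$ is cyclic if $Z$ is cyclic and $\mathbf{G}$ has trivial automorphism group. For $\gamma\in Z_1$, $\lambda\in\Bbbk\setminus\{0\}$, $s>0$, let $B=B(\lambda,s,\gamma)$ be the $\Bbbk Z$-module with $B(x)=\Bbbk^s$ for all $x\in Z_0$, $B(\alpha)=1_{\Bbbk^s}$ for $\alpha\neq\gamma$, and $B(\gamma)=J_\lambda(s)$, the $s\times s$ upper triangular Jordan block with eigenvalue $\lambda$. The band is $B_{\mathbf{G}}(\lambda,s,\gamma)=G_*B(\lambda,s,\gamma)$. (Strings and bands are indecomposable $\Lambda$-modules.) The Laurent algebra. $\Gamma$ is the path category of the quiver with one vertex $x$ and two loops $\alpha,\beta$ modulo the ideal generated by the relations $\alpha\beta=\beta\alpha=e_x$, with the same pointwise and arrow-wise tensor product of modules. $b_{\lambda,s}$ ($\lambda\in\Bbbk\setminus\{0\}$, $s\ge1$) is the indecomposable $\Gamma$-module with $b_{\lambda,s}(x)=\Bbbk^s$, $b_{\lambda,s}(\alpha)=J_\lambda(s)$, $b_{\lambda,s}(\beta)=J_\lambda(s)^{-1}$. Tensor ideals. For $\mathcal{A}=\Lambda$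 or $\mathcal{A}=\Gamma$, a full subcategory $\mathcal{U}\subset\mathrm{mod}\,\mathcal{A}$ is a tensor ideal if it is closed under isomorphisms, direct sums and direct summands and $m\otimes u\in\mathcal{U}$ for all $m\in\mathrm{mod}\,\mathcal{A}$, $u\in\mathcal{U}$. For an isoclass $x$ of an indecomposable $\mathcal{A}$-module, $N_{\mathcal{A}}(x)$ is the set of isoclasses of indecomposable modules in the smallest tensor ideal of $\mathrm{mod}\,\mathcal{A}$ containing $x$. Set $N_{\lambda,s}=N_\Gamma([b_{\lambda,s}])$. *)

(* Defs.v *)
From HB Require Import structures.
From mathcomp Require Import all_boot all_order all_algebra all_character.
From mathcomp Require Import finmap monalg.

Set Implicit Arguments.
Unset Strict Implicit.
Unset Printing Implicit Defensive.

Import GRing.Theory.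
Local Open Scope ring_scope.

Record quiver := Quiver {
  Q0 : finType;
  Q1 : finType;
  qtail : Q1 -> Q0;
  qhead : Q1 -> Q0 }.

(* Q_1(x, y) *)
Definition arr (Q : quiver) (x y : Q0 Q) : Type :=
  {a : Q1 Q | (qtail a == x) && (qhead a == y)}.
HB.instance Definition _ (Q : quiver) (x y : Q0 Q) := Finite.on (arr x y).

(* Paths compose by concatenation: [pcons a p] traverses the arrow [a] first. *)
Inductive qpath (Q : quiver) : Q0 Q -> Q0 Q -> Type :=
| pnil x : qpath x x
| pcons x y z : arr x y -> qpath y z -> qpath x z.

Fixpoint pcat (Q : quiver) (x y z : Q0 Q) (p : qpath x y) :
    qpath y z -> qpath x z :=
  match p in qpath x y return qpath y z -> qpath x z with
  | pnil _ => fun q => q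
  | pcons _ _ _ a p' => fun q => pcons a (pcat p' q)
  end.

Fixpoint path_arrows (Q : quiver) (x y : Q0 Q) (p : qpath x y) : seq (Q1 Q) :=
  match p with
  | pnil _ => [::]
  | pcons _ _ _ a p' => val a :: path_arrows p'
  end.

Fixpoint path_of_arrows (Q : quiver) (s : seq (Q1 Q)) (x y : Q0 Q) :
    option (qpath x y) :=
  match s with
  | [::] => if x =P y is ReflectT e then Some (eq_rect x (qpath x) (pnil x) y e)
            else None
  | a :: s' =>
      if (insub a : option (arr x (qhead a))) is Some a' then
        omap (pcons a') (path_of_arrows s' (qhead a) y)
      else None
  end.

Lemma path_arrowsK (Q : quiver) (x y : Q0 Q) :
  pcancel (@path_arrows Q x y) (fun s => path_of_arrows s x y).
Proof.
elim=> {x y} [x | x y z [a Ha] p IHp] /=.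
  by case: eqP => // e; rewrite (eq_axiomK e).
have /andP[/eqP Ex /eqP Ey] := Ha; case: x / Ex Ha => Ha.
case: y / Ey Ha p IHp => Ha p IHp.
by rewrite insubT IHp.
Qed.

HB.instance Definition _ (Q : quiver) (x y : Q0 Q) :=
  Choice.copy (qpath x y) (pcan_type (@path_arrowsK Q x y)).

(* The morphism space kQ(x, y): the free vector space on the paths. *)
Definition kpath (k : fieldType) (Q : quiver) (x y : Q0 Q) : Type :=
  {malg k[qpath x y]}.
HB.instance Definition _ (k : fieldType) (Q : quiver) (x y : Q0 Q) :=
  GRing.Lmodule.on (kpath k x y).

Definition kpath_of (k : fieldType) (Q : quiver) (x y : Q0 Q) (p : qpath x y) :
  kpath k x y := << p >>.

Definition kcomp (k : fieldType) (Q : quiver) (x y z : Q0 Q)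
    (f : kpath k x y) (g : kpath k y z) : kpath k x z :=
  \sum_(p <- msupp f) \sum_(q <- msupp g) (f@_p * g@_q) *: kpath_of k (pcat p q).

Definition kfamily (k : fieldType) (Q : quiver) : Type :=
  forall x y : Q0 Q, kpath k x y -> Prop.

Definition is_ideal (k : fieldType) (Q : quiver) (I : kfamily k Q) : Prop :=
  [/\ forall x y, I x y 0,
      forall x y (c : k) (f g : kpath k x y),
        I x y f -> I x y g -> I x y (c *: f + g),
      forall x y z (f : kpath k x y) (g : kpath k y z),
        I y z g -> I x z (kcomp f g)
    & forall x y z (f : kpath k x y) (g : kpath k y z),
        I x y f -> I x z (kcomp f g)].

Definition gen_ideal (k : fieldType) (Q : quiver) (S : kfamily k Q) :
    kfamily k Q :=
  fun x y f => forall J : kfamily k Q, is_ideal J ->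
    (forall x' y' g, S x' y' g -> J x' y' g) -> J x y f.

(* A linear functor from kQ to finite dimensional vector spaces is determined by
   its values on vertices and arrows. The space at x is the space k^(mdim x) of
   column vectors, so the matrix of an arrow x -> y has mdim y rows and mdim x
   columns. *)

Record qmod (k : fieldType) (Q : quiver) := QMod {
  mdim : Q0 Q -> nat;
  arr_act : forall x y : Q0 Q, arr x y -> 'M[k]_(mdim y, mdim x) }.

Fixpoint pact (k : fieldType) (Q : quiver) (m : qmod k Q) (x y : Q0 Q)
    (p : qpath x y) : 'M[k]_(mdim m y, mdim m x) :=
  match p in qpath x y return 'M[k]_(mdim m y, mdim m x) with
  | pnil _ => 1%:M
  | pcons _ _ _ a p' => pact m p' *m arr_act m a
  end.

Definition kact (k : fieldType) (Q : quiver) (m : qmod k Q) (x y : Q0 Q)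
    (f : kpath k x y) : 'M[k]_(mdim m y, mdim m x) :=
  \sum_(p <- msupp f) f@_p *: pact m p.

(* mod kQ/I is identified with the kQ-modules vanishing on I. *)
Definition in_mod (k : fieldType) (Q : quiver) (I : kfamily k Q)
    (m : qmod k Q) : Prop :=
  forall x y (f : kpath k x y), I x y f -> kact m f = 0.

Definition is_qhom (k : fieldType) (Q : quiver) (m n : qmod k Q)
    (f : forall x, 'M[k]_(mdim n x, mdim m x)) : Prop :=
  forall x y (a : arr x y), f y *m arr_act m a = arr_act n a *m f x.

Definition qiso (k : fieldType) (Q : quiver) (m n : qmod k Q) : Prop :=
  exists (f : forall x, 'M[k]_(mdim n x, mdim m x))
         (g : forall x, 'M[k]_(mdim m x, mdim n x)),
    [/\ is_qhom f, is_qhom g,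
        forall x, g x *m f x = 1%:M & forall x, f x *m g x = 1%:M].

Definition qsum (k : fieldType) (Q : quiver) (m n : qmod k Q) : qmod k Q :=
  @QMod k Q (fun x => (mdim m x + mdim n x)%N)
    (fun x y a => block_mx (arr_act m a) 0 0 (arr_act n a)).

Definition qtensor (k : fieldType) (Q : quiver) (m n : qmod k Q) : qmod k Q :=
  @QMod k Q (fun x => (mdim m x * mdim n x)%N)
    (fun x y a => tprod (arr_act m a) (arr_act n a)).

Definition qzero (k : fieldType) (Q : quiver) (m : qmod k Q) : Prop :=
  forall x, mdim m x = 0%N.

Definition indecomposable (k : fieldType) (Q : quiver) (m : qmod k Q) : Prop :=
  ~ qzero m /\
  forall u v : qmod k Q, qiso m (qsum u v) -> qzero u \/ qzero v.

Definition tensor_ideal (k : fieldType) (Q : quiver) (I : kfamily k Q)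
    (U : qmod k Q -> Prop) : Prop :=
  [/\ forall m, U m -> in_mod I m,
      forall m n, U m -> qiso m n -> U n,
      forall m n, U m -> U n -> U (qsum m n),
      forall m n, U (qsum m n) -> U m /\ U n
    & forall m u, in_mod I m -> U u -> U (qtensor m u)].

(* A set of isoclasses is given by an isomorphism-invariant predicate: [Nset I x]
   holds of the indecomposable kQ/I-modules in the smallest tensor ideal of
   mod kQ/I containing x. *)
Definition Nset (k : fieldType) (Q : quiver) (I : kfamily k Q)
    (x m : qmod k Q) : Prop :=
  [/\ in_mod I m, indecomposable m
    & forall U : qmod k Q -> Prop, tensor_ideal I U -> U x -> U m].

Definition findim_homs (k : fieldType) (Q : quiver) (I : kfamily k Q) : Prop :=
  forall x y : Q0 Q, exists (n : nat) (b : 'I_n -> kpath k x y),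
    forall f : kpath k x y, exists c : 'I_n -> k,
      I x y (f - \sum_i c i *: b i).

Definition generated_by_paths (k : fieldType) (Q : quiver)
    (I : kfamily k Q) : Prop :=
  exists S : forall x y : Q0 Q, qpath x y -> Prop,
    forall x y (f : kpath k x y),
      I x y f <->
      gen_ideal (fun x' y' g => exists2 p, S x' y' p & g = kpath_of k p) f.

Definition string_category (k : fieldType) (Q : quiver)
    (I : kfamily k Q) : Prop :=
  [/\ is_ideal I,
      findim_homs I,
      generated_by_paths I,
      forall x : Q0 Q, (#|[set a : Q1 Q | qtail a == x]| <= 2)%N /\
                       (#|[set a : Q1 Q | qhead a == x]| <= 2)%N
    & forall (x y : Q0 Q) (a : arr x y),
        (forall z z' (b : arr y z) (b' : arr y z'),
           ~ I x z (kpath_of k (pcons a (pcons b (pnil z)))) ->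
           ~ I x z' (kpath_of k (pcons a (pcons b' (pnil z')))) ->
           val b = val b')
        /\
        (forall w w' (c : arr w x) (c' : arr w' x),
           ~ I w y (kpath_of k (pcons c (pcons a (pnil y)))) ->
           ~ I w' y (kpath_of k (pcons c' (pcons a (pnil y)))) ->
           val c = val c')].

(* A linear functor kP -> kQ sending arrows to arrows is the same thing as a
   morphism of quivers P -> Q. *)

Record qmor (P Q : quiver) := QMor {
  mor0 : Q0 P -> Q0 Q;
  mor1 : Q1 P -> Q1 Q;
  mor_tail : forall a, qtail (mor1 a) = mor0 (qtail a);
  mor_head : forall a, qhead (mor1 a) = mor0 (qhead a) }.

Lemma arr_map_subproof (P Q : quiver) (F : qmor P Q) (x y : Q0 P)
    (a : arr x y) :
  (qtail (mor1 F (val a)) == mor0 F x) && (qhead (mor1 F (val a)) == mor0 F y).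
Proof.
by case: a => a /= /andP[/eqP <- /eqP <-]; rewrite mor_tail mor_head !eqxx.
Qed.

Definition arr_map (P Q : quiver) (F : qmor P Q) (x y : Q0 P) (a : arr x y) :
    arr (mor0 F x) (mor0 F y) :=
  exist _ (mor1 F (val a)) (arr_map_subproof F a).

Fixpoint path_map (P Q : quiver) (F : qmor P Q) (x y : Q0 P) (p : qpath x y) :
    qpath (mor0 F x) (mor0 F y) :=
  match p in qpath x y return qpath (mor0 F x) (mor0 F y) with
  | pnil x => pnil (mor0 F x)
  | pcons _ _ _ a p' => pcons (arr_map F a) (path_map F p')
  end.

Definition wrapping (P Q : quiver) (F : qmor P Q) : Prop :=
  forall x y : Q0 P, injective (@arr_map P Q F x y).

Definition strict (P Q : quiver) (F : qmor P Q) : Prop :=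
  forall a b : Q1 P, a <> b -> mor1 F a = mor1 F b ->
    qtail a <> qtail b /\ qhead a <> qhead b.

Definition strict_wrapping (P Q : quiver) (F : qmor P Q) : Prop :=
  wrapping F /\ strict F.

Record qshape (Q : quiver) := Shape {
  dom : quiver;
  wrap : qmor dom Q;
  wrap_strict : strict_wrapping wrap }.

(* Paths of Q of the form F gamma with gamma a path in P. *)
Inductive path_image (P Q : quiver) (F : qmor P Q) :
    forall x' y' : Q0 Q, qpath x' y' -> Prop :=
| PathImage (x y : Q0 P) (p : qpath x y) : path_image F (path_map F p).

Definition compatible (k : fieldType) (Q : quiver) (I : kfamily k Q)
    (F : qshape Q) : Prop :=
  forall x y (f : kpath k x y), I x y f ->
    exists (n : nat) (c : 'I_n -> k) (p : 'I_n -> qpath x y),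
      (forall i, ~ path_image (wrap F) (p i)) /\
      f = \sum_i c i *: kpath_of k (p i).

Definition is_comp (P' P Q : quiver) (F' : qmor P' Q) (F : qmor P Q)
    (G : qmor P' P) : Prop :=
  (forall x, mor0 F' x = mor0 F (mor0 G x)) /\
  (forall a, mor1 F' a = mor1 F (mor1 G a)).

Definition factors_through (Q : quiver) (F' F : qshape Q) : Prop :=
  exists G : qmor (dom F') (dom F),
    strict_wrapping G /\ is_comp (wrap F') (wrap F) G.

Definition subshape (Q : quiver) (F' F : qshape Q) : Prop :=
  exists G : qmor (dom F') (dom F),
    [/\ strict_wrapping G, is_comp (wrap F') (wrap F) G,
        injective (mor0 G) & injective (mor1 G)].

(* Index set of the standard basis of the direct sum of the m(x), Fx = x'. *)
Definition pd_basis (k : fieldType) (P Q : quiver) (F : qmor P Q)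
    (m : qmod k P) (x' : Q0 Q) : finType :=
  {x : {x : Q0 P | mor0 F x == x'} & 'I_(mdim m (val x))}.

Definition pd_coef (k : fieldType) (P Q : quiver) (F : qmor P Q)
    (m : qmod k P) (x' y' : Q0 Q) (a' : arr x' y')
    (i : pd_basis F m y') (j : pd_basis F m x') : k :=
  if [pick a : arr (val (tag j)) (val (tag i)) | mor1 F (val a) == val a']
    is Some a then arr_act m a (tagged i) (tagged j) else 0.

Definition pushdown (k : fieldType) (P Q : quiver) (F : qmor P Q)
    (m : qmod k P) : qmod k Q :=
  @QMod k Q (fun x' => #|{: pd_basis F m x'}|)
    (fun x' y' a' => \matrix_(i, j) pd_coef a' (enum_val i) (enum_val j)).

Definition joins (Q : quiver) (a : Q1 Q) (x y : Q0 Q) : Prop :=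
  (qtail a = x /\ qhead a = y) \/ (qtail a = y /\ qhead a = x).

Definition linear_quiver (L : quiver) : Prop :=
  exists (n : nat) (v : 'I_n.+1 -> Q0 L) (e : 'I_n -> Q1 L),
    [/\ bijective v, bijective e
      & forall i, joins (e i) (v (widen_ord (leqnSn n) i)) (v (lift ord0 i))].

(* [ordS] is the cyclic successor; n = 0 gives the quiver with one loop and
   n = 1 the quivers with two arrows between two vertices. *)
Definition cyclic_quiver (Z : quiver) : Prop :=
  exists (n : nat) (v : 'I_n.+1 -> Q0 Z) (e : 'I_n.+1 -> Q1 Z),
    [/\ bijective v, bijective e & forall i, joins (e i) (v i) (v (ordS i))].

Definition linear_shape (Q : quiver) (F : qshape Q) : Prop :=
  linear_quiver (dom F).

Definition trivial_aut (Q : quiver) (F : qshape Q) : Prop :=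
  forall sigma : qmor (dom F) (dom F),
    bijective (mor0 sigma) -> bijective (mor1 sigma) ->
    is_comp (wrap F) (wrap F) sigma ->
    (forall x, mor0 sigma x = x) /\ (forall a, mor1 sigma a = a).

Definition cyclic_shape (Q : quiver) (G : qshape Q) : Prop :=
  cyclic_quiver (dom G) /\ trivial_aut G.

Definition chi (k : fieldType) (L : quiver) : qmod k L :=
  @QMod k L (fun _ => 1%N) (fun x y a => 1%:M).

Definition string_mod (k : fieldType) (Q : quiver) (F : qshape Q) : qmod k Q :=
  pushdown (wrap F) (chi k (dom F)).

Definition jordan (k : fieldType) (lam : k) (s : nat) : 'M[k]_s :=
  \matrix_(i, j) (if i == j then lam else if j == i.+1 :> nat then 1 else 0).

Definition cyc_mod (k : fieldType) (Z : quiver) (lam : k) (s : nat)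
    (gam : Q1 Z) : qmod k Z :=
  @QMod k Z (fun _ => s)
    (fun x y a => if val a == gam then jordan lam s else 1%:M).

Definition band_mod (k : fieldType) (Q : quiver) (G : qshape Q) (lam : k)
    (s : nat) (gam : Q1 (dom G)) : qmod k Q :=
  pushdown (wrap G) (cyc_mod lam s gam).

(* The loops alpha and beta are [true] and [false]. *)
Definition laurent_quiver : quiver :=
  @Quiver unit bool (fun _ => tt) (fun _ => tt).

Definition laurent_loop (b : bool) : @arr laurent_quiver tt tt :=
  exist _ b isT.

Definition loop2 (k : fieldType) (b c : bool) : @kpath k laurent_quiver tt tt :=
  kpath_of k (pcons (laurent_loop b) (pcons (laurent_loop c)
    (@pnil laurent_quiver tt))).

Inductive laurent_rel (k : fieldType) : kfamily k laurent_quiver :=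
| RelAB : @laurent_rel k tt tt
    (loop2 k true false - kpath_of k (@pnil laurent_quiver tt))
| RelBA : @laurent_rel k tt tt
    (loop2 k false true - kpath_of k (@pnil laurent_quiver tt)).

Definition laurent_ideal (k : fieldType) : kfamily k laurent_quiver :=
  gen_ideal (@laurent_rel k).

Definition laurent_mod (k : fieldType) (lam : k) (s : nat) :
    qmod k laurent_quiver :=
  @QMod k laurent_quiver (fun _ => s)
    (fun x y a => if val a then jordan lam s else invmx (jordan lam s)).

Definition Nlaurent (k : fieldType) (lam : k) (s : nat) :
    qmod k laurent_quiver -> Prop :=
  Nset (@laurent_ideal k) (laurent_mod lam s).

(* Main.v *)
From mathcomp Require Import all_boot all_order all_algebra all_character.
From mathcomp Require Import finmap monalg zify.
From Stdlib Require Import Classical.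
Require Import Defs.

(* For a strict wrapping G : P -> Q and a kQ-module m, the projection formula
   m (x) G_* n = G_* (G^* m (x) n) moves tensor products to P, where the modules are known:
   over a linear quiver every module is a sum of strings of subintervals, and over a cyclic
   quiver Z every module is a sum of strings of walks in Z and of modules on which all arrows
   act invertibly, i.e. modules B(V) for a Gamma-module V, with B(V) (x) B(W) = B(V (x) W).
   Hence the sums of the modules named in the theorem form a tensor ideal.  Conversely M is a
   summand of G^* G_* M, so G_*(M (x) N) is a summand of G_* M (x) G_* N; this produces the
   strings, and shows that the V with G_* B(V) in a given tensor ideal form a tensor ideal of
   Gamma-modules.

   Strings and bands are indecomposable because an endomorphism of G_* M is block triangular
   with respect to the order in which y lies below x when the fibre product P x_Q P allows a
   graph map at (y, x); this is antisymmetric for linear quivers and for cyclic quivers whose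
   shape has no automorphism.  The same triangularity turns a section and a cosection of a
   kP-module along a walk, dual to each other, into a string summand. *)

Set Implicit Arguments.
Unset Strict Implicit.
Unset Printing Implicit Defensive.

Import GRing.Theory.
Local Open Scope ring_scope.

(** No tensor product of Jordan blocks is decomposed: which b_{1,t} lie in N_{1,s} depends on the
    characteristic. All that is needed is that tensoring with b_{nu,1} multiplies eigenvalues by nu.
    So membership of b_{mu,t} in a tensor ideal depends on t alone, which is why mu is arbitrary in
    the answer.

    The decompositions over L and Z come from splitting off one nonzero summand of a named kind and
    inducting on the dimension. The obstacle lies over Z: a string may wind around the cycle many
    times, and its length is not known beforehand. The search starts just behind an arrow that is
    not invertible, with two nested subspaces, transports both along the walk by images and
    preimages, and stops when they are no longer separated. If it never stopped, comparing the pair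
    with itself one turn later would make a rank rise or fall strictly forever. As the walk may meet
    a vertex repeatedly, the composite of the section and the cosection need not be diagonal; this
    is where triangularity is needed. *)

Lemma factor_idempotent (k : fieldType) n r (C : 'M[k]_(n, r)) (R : 'M_(r, n)) :
  row_full C -> row_free R -> C *m (R *m C) *m R = C *m R -> R *m C = 1%:M.
Proof.
move=> /row_fullP[C' C'C] /row_freeP[R' RR'] /(congr1 (fun X => C' *m X *m R')).
by rewrite !mulmxA C'C !mul1mx -(mulmxA (R *m C)) RR' mulmx1.
Qed.

(** * Homomorphisms, retracts and additive closures *)

Section Homs.
Variables (k : fieldType) (Q : quiver).
Implicit Types m n u v w : qmod k Q.

Definition fam m n : Type := forall x, 'M[k]_(mdim n x, mdim m x).
Definition qhom m n (f : fam m n) : Prop := is_qhom f.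

Lemma hom_id m : qhom (fun x => 1%:M : 'M_(mdim m x)).
Proof. by move=> x y a; rewrite mul1mx mulmx1. Qed.

Lemma hom_comp m n u (f : fam m n) (g : fam n u) :
  qhom f -> qhom g -> qhom (fun x => g x *m f x : 'M_(mdim u x, mdim m x)).
Proof. by move=> hf hg x y a; rewrite -mulmxA hf !mulmxA hg. Qed.

Lemma hom_add m n (f g : fam m n) :
  qhom f -> qhom g -> qhom (fun x => f x + g x : 'M_(mdim n x, mdim m x)).
Proof. by move=> hf hg x y a; rewrite mulmxDl mulmxDr hf hg. Qed.

Lemma hom_sub m n (f g : fam m n) :
  qhom f -> qhom g -> qhom (fun x => f x - g x : 'M_(mdim n x, mdim m x)).
Proof. by move=> hf hg x y a; rewrite mulmxBl mulmxBr hf hg. Qed.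

Lemma hom_zero m n : qhom (fun x => 0 : 'M_(mdim n x, mdim m x)).
Proof. by move=> x y a; rewrite mul0mx mulmx0. Qed.

Lemma hom_inv m n (f : fam m n) (g : fam n m) : qhom f ->
  (forall x, g x *m f x = 1%:M) -> (forall x, f x *m g x = 1%:M) -> qhom g.
Proof.
move=> hf gf fg x y a; rewrite -[LHS]mulmx1 -(fg x) -mulmxA [arr_act n a *m _]mulmxA.
by rewrite -hf !mulmxA gf mul1mx.
Qed.

Lemma hom_ext m n (f g : fam m n) : (forall x, f x = g x) -> qhom f -> qhom g.
Proof. by move=> fg hf x y a; rewrite -!fg. Qed.

(** A direct summand without a chosen complement; [retract_compl] supplies one by splitting the
    idempotent 1 - f g. *)
Definition retract u m : Prop := exists (f : fam u m) (g : fam m u),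
  [/\ qhom f, qhom g & forall x, g x *m f x = 1%:M].

Lemma retract_refl m : retract m m.
Proof.
by do 2!exists (fun x => 1%:M); split; try exact: hom_id; move=> x; rewrite mul1mx.
Qed.

Lemma retract_trans n m u : retract m n -> retract n u -> retract m u.
Proof.
move=> [f [g [hf hg gf]]] [f' [g' [hf' hg' gf']]].
exists (fun x => f' x *m f x), (fun x => g x *m g' x); split.
- exact: (hom_comp hf).
- exact: hom_comp hg' hg.
by move=> x; rewrite mulmxA -[_ *m g' x *m f' x]mulmxA gf' mulmx1 gf.
Qed.

Lemma iso_retract m n : qiso m n -> retract m n.
Proof. by move=> [f [g [hf hg gf _]]]; exists f, g. Qed.

Lemma iso_sym m n : qiso m n -> qiso n m.
Proof. by move=> [f [g [hf hg gf fg]]]; exists g, f. Qed.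

Lemma iso_trans n m u : qiso m n -> qiso n u -> qiso m u.
Proof.
move=> [f [g [hf hg gf fg]]] [f' [g' [hf' hg' gf' fg']]].
exists (fun x => f' x *m f x), (fun x => g x *m g' x); split.
- exact: (hom_comp hf).
- exact: hom_comp hg' hg.
- by move=> x; rewrite mulmxA -[_ *m g' x *m f' x]mulmxA gf' mulmx1 gf.
- by move=> x; rewrite mulmxA -[_ *m f x *m g x]mulmxA fg mulmx1 fg'.
Qed.

(* Rank factorization: E = C R with R C = 1. *)
Lemma split_idempotent m (E : fam m m) : qhom E -> (forall x, E x *m E x = E x) ->
  exists (u : qmod k Q) (f : fam u m) (g : fam m u),
    [/\ qhom f, qhom g, forall x, g x *m f x = 1%:M & forall x, f x *m g x = E x].
Proof.
move=> hE EE.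
have [r [C [R [RC CR]]]] : exists r (C : forall x, 'M[k]_(mdim m x, r x))
    (R : forall x, 'M[k]_(r x, mdim m x)),
    (forall x, R x *m C x = 1%:M) /\ (forall x, C x *m R x = E x).
  exists (fun x => \rank (E x)), (fun x => col_base (E x)), (fun x => row_base (E x)).
  split=> x; last by rewrite mulmx_base.
  apply: (@factor_idempotent _ _ _ (col_base (E x)));
    rewrite ?col_base_full ?row_base_free //.
  by rewrite (mulmxA (col_base _)) !mulmx_base -mulmxA mulmx_base EE.
pose u := @QMod k Q r (fun x y a => R y *m arr_act m a *m C x).
exists u, C, R; split=> //.
- by move=> x y a /=; rewrite !mulmxA CR hE -mulmxA -{1}CR -mulmxA RC mulmx1.
- by move=> x y a /=; rewrite -!mulmxA CR -hE mulmxA -CR mulmxA RC mul1mx.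
Qed.

Definition idem_trivial m : Prop := forall E : fam m m, qhom E ->
  (forall x, E x *m E x = E x) -> (forall x, E x = 0) \/ (forall x, E x = 1%:M).

(** Orthogonality comes for free: multiplying the partition of 1 by g on the left and f' on the
    right gives g f' + g f' = g f'. *)
Lemma qsum_of_idempotents m u v (f : fam u m) (g : fam m u) (f' : fam v m) (g' : fam m v) :
  qhom f -> qhom g -> qhom f' -> qhom g' ->
  (forall x, g x *m f x = 1%:M) -> (forall x, g' x *m f' x = 1%:M) ->
  (forall x, f x *m g x + f' x *m g' x = 1%:M) -> qiso m (qsum u v).
Proof.
move=> hf hg hf' hg' gf gf' s.
have z x : g x *m f' x = 0.
  have := congr1 (fun A => g x *m A *m f' x) (s x).
  rewrite mulmxDr mulmxDl mulmx1 !mulmxA gf mul1mx -!mulmxA gf' mulmx1.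
  by move/eqP; rewrite -subr_eq0 addrK => /eqP.
have z' x : g' x *m f x = 0.
  have := congr1 (fun A => g' x *m A *m f x) (s x).
  rewrite mulmxDr mulmxDl mulmx1 !mulmxA gf' mul1mx -!mulmxA gf mulmx1.
  by move/eqP; rewrite -subr_eq0 addrK => /eqP.
exists (fun x => col_mx (g x) (g' x)), (fun x => row_mx (f x) (f' x)); split.
- move=> x y a /=; rewrite mul_col_mx mul_block_col !mul0mx addr0 add0r.
  by rewrite hg hg'.
- move=> x y a /=; rewrite mul_mx_row mul_row_block !mulmx0 addr0 add0r.
  by rewrite hf hf'.
- by move=> x; rewrite mul_row_col s.
by move=> x; rewrite mul_col_row gf gf' z z' -scalar_mx_block.
Qed.

Lemma qsum_split u v : exists (f : fam u (qsum u v)) g (f' : fam v (qsum u v)) g',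
  [/\ [/\ qhom f, qhom g, qhom f' & qhom g'], forall x, g x *m f x = 1%:M,
      forall x, g' x *m f' x = 1%:M & forall x, f x *m g x + f' x *m g' x = 1%:M].
Proof.
exists (fun x => col_mx 1%:M 0), (fun x => row_mx 1%:M 0),
  (fun x => col_mx 0 1%:M), (fun x => row_mx 0 1%:M); split; [split | | |].
- move=> x y a /=; rewrite mul_col_mx mul_block_col !(mul0mx, mulmx0, mul1mx, mulmx1).
  by rewrite !addr0.
- move=> x y a /=; rewrite mul_mx_row mul_row_block !(mul0mx, mulmx0, mul1mx, mulmx1).
  by rewrite !addr0.
- move=> x y a /=; rewrite mul_col_mx mul_block_col !(mul0mx, mulmx0, mul1mx, mulmx1).
  by rewrite !add0r.
- move=> x y a /=; rewrite mul_mx_row mul_row_block !(mul0mx, mulmx0, mul1mx, mulmx1).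
  by rewrite !add0r.
- by move=> x; rewrite mul_row_col mul1mx mul0mx addr0.
- by move=> x; rewrite mul_row_col mul1mx mul0mx add0r.
move=> x; rewrite !mul_col_row !(mul1mx, mul0mx, mulmx0) add_block_mx.
by rewrite !(addr0, add0r) -scalar_mx_block.
Qed.

Lemma retract_qsuml u v : retract u (qsum u v).
Proof. by have [f [g [_ [_ [[hf hg _ _] e _ _]]]]] := qsum_split u v; exists f, g. Qed.

Lemma retract_qsumr u v : retract v (qsum u v).
Proof. by have [_ [_ [f [g [[_ _ hf hg] _ e _]]]]] := qsum_split u v; exists f, g. Qed.

Lemma retract_compl u m : retract u m -> exists v, qiso m (qsum u v).
Proof.
move=> [f [g [hf hg gf]]].
have [||v [f' [g' [hf' hg' gf' fg']]]] :=
  @split_idempotent m (fun x => 1%:M - f x *m g x).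
- by apply: (hom_sub (@hom_id m)); apply: (hom_comp hg).
- move=> x; rewrite mulmxBl mul1mx mulmxBr mulmx1.
  by rewrite mulmxA -(mulmxA (f x)) gf mulmx1 subrr subr0.
exists v; apply: (qsum_of_idempotents hf hg hf' hg') => // x.
by rewrite fg' addrC subrK.
Qed.

Lemma mx_dim0 p q (A B : 'M[k]_(p, q)) : (p = 0 \/ q = 0)%N -> A = B.
Proof.
by case=> e; move: A B; rewrite e => A B; [rewrite [A]flatmx0 [B]flatmx0 | rewrite [A]thinmx0 [B]thinmx0].
Qed.

Lemma one_dim0 d : (1%:M : 'M[k]_d) = 0 -> d = 0%N.
Proof.
case: d => // d /matrixP/(_ ord0 ord0); rewrite !mxE eqxx => /eqP.
by rewrite oner_eq0.
Qed.

(** An idempotent E decomposes m into the images of E and 1 - E. Conversely, the projection of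
    [qsum u v] onto u, conjugated by the isomorphism, is an idempotent, and its triviality kills u
    or v. *)
Lemma indecomposableP m : indecomposable m <-> ~ qzero m /\ idem_trivial m.
Proof.
split=> -[nz H]; split=> //.
  move=> E hE EE; have [u [f [g [hf hg gf fg]]]] := split_idempotent hE EE.
  have [||v [f' [g' [hf' hg' gf' fg']]]] :=
    @split_idempotent m (fun x => 1%:M - E x).
  - exact: hom_sub (@hom_id m) hE.
  - by move=> x; rewrite mulmxBl mul1mx mulmxBr mulmx1 EE subrr subr0.
  have iso : qiso m (qsum u v).
    apply: (qsum_of_idempotents hf hg hf' hg') => // x.
    by rewrite fg fg' addrC subrK.
  case: (H _ _ iso) => z; [left | right] => x.
    by rewrite -fg (mx_dim0 (f x) 0) ?mul0mx //; right.
  apply/eqP; rewrite eq_sym -subr_eq0; apply/eqP.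
  by rewrite -fg' (mx_dim0 (f' x) 0) ?mul0mx //; right.
move=> u v iso; have [f [g [hf hg gf fg]]] := iso.
have [i [p [hi hp pi]]] := retract_trans (retract_qsuml u v) (iso_retract (iso_sym iso)).
have [j [q [hj hq qj]]] := retract_trans (retract_qsumr u v) (iso_retract (iso_sym iso)).
have {}pi x : row_mx 1%:M 0 *m f x *m (g x *m col_mx 1%:M 0) = 1%:M :> 'M_(mdim u x).
  by rewrite mulmxA -(mulmxA _ (f x)) fg mulmx1 mul_row_col mul1mx mul0mx addr0.
have hE1 : qhom (fun x => g x *m (block_mx 1%:M 0 0 0 : 'M_(mdim u x + mdim v x)) *m f x
    : 'M_(mdim m x)).
  have hB : @qhom (qsum u v) (qsum u v)
      (fun x => (block_mx 1%:M 0 0 0 : 'M_(mdim u x + mdim v x))).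
    move=> x y a /=; rewrite !mulmx_block !(mul0mx, mulmx0, mul1mx, mulmx1).
    by rewrite !(addr0, add0r).
  by apply: (hom_comp hf); apply: (hom_comp hB).
case: (H _ hE1) => [x|z|z].
- rewrite !mulmxA -(mulmxA _ (f x) (g x)) fg mulmx1 -(mulmxA (g x) (block_mx _ _ _ _)).
  by rewrite mulmx_block !(mul0mx, mulmx0, mul1mx, mulmx1) !(addr0, add0r).
- left=> x; apply: one_dim0.
  have := congr1 (fun A => f x *m A *m g x) (z x).
  rewrite !mulmxA fg mul1mx -mulmxA fg mulmx1 mulmx0 mul0mx.
  by move/(congr1 ulsubmx); rewrite block_mxKul => ->; apply/matrixP => i1 j1; rewrite !mxE.
- right=> x; apply: one_dim0.
  have := congr1 (fun A => f x *m A *m g x) (z x).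
  rewrite !mulmxA fg mul1mx -mulmxA fg mulmx1 mulmx1 fg.
  by move/(congr1 drsubmx); rewrite (@scalar_mx_block _ (mdim u x)) !block_mxKdr.
Qed.

Lemma iso_idem_trivial m n : qiso m n -> idem_trivial m -> idem_trivial n.
Proof.
move=> [f [g [hf hg gf fg]]] H E hE EE.
case: (H (fun x => g x *m E x *m f x)) => [|x|z|z].
- by apply: (hom_comp hf); apply: (hom_comp hE).
- by rewrite !mulmxA -(mulmxA _ (f x) (g x)) fg mulmx1 -(mulmxA (g x)) EE.
- left=> x; have := congr1 (fun A => f x *m A *m g x) (z x).
  by rewrite !mulmxA fg mul1mx -mulmxA fg mulmx1 mulmx0 mul0mx.
- right=> x; have := congr1 (fun A => f x *m A *m g x) (z x).
  by rewrite !mulmxA fg mul1mx -mulmxA fg mulmx1 mulmx1 fg.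
Qed.

Lemma iso_qzero m n : qiso m n -> qzero n -> qzero m.
Proof.
move=> [f [g [_ _ gf _]]] z x; apply: one_dim0.
by rewrite -gf (mx_dim0 (g x) 0) ?mul0mx //; right.
Qed.

Lemma iso_indecomposable m n : qiso m n -> indecomposable m -> indecomposable n.
Proof.
move=> iso /indecomposableP[nz H]; apply/indecomposableP; split.
  by move=> z; apply: nz; apply: iso_qzero z.
exact: iso_idem_trivial H.
Qed.

Lemma indecomposable_retract u m :
  indecomposable m -> retract u m -> ~ qzero u -> qiso m u.
Proof.
move=> [_ H] r nzu; have [v iso] := retract_compl r.
case: (H _ _ iso) => // zv; apply: (iso_trans iso).
have z x p (A : 'M[k]_(mdim v x, p)) : A = 0 by apply: mx_dim0; left.
exists (fun x => row_mx 1%:M 0), (fun x => col_mx 1%:M 0); split.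
- move=> x y a /=; rewrite mul_mx_row mul_row_block !(mul0mx, mulmx0, mul1mx, mulmx1).
  by rewrite !addr0.
- move=> x y a /=; rewrite mul_col_mx mul_block_col !(mul0mx, mulmx0, mul1mx, mulmx1).
  by rewrite !addr0.
- move=> x; rewrite mul_col_row scalar_mx_block mul1mx mul0mx mulmx0.
  by rewrite [X in block_mx _ _ _ X]z [X in _ = block_mx _ _ _ X]z.
by move=> x; rewrite mul_row_col mul1mx mul0mx addr0.
Qed.

(** A statement about morphisms, so that an additive functor is applied term by term and no indexed
    direct sum has to be built. *)
Inductive factors_sum (C : qmod k Q -> Prop) m n : fam m n -> Prop :=
| FactorsSum0 h : (forall x, h x = 0) -> factors_sum C h
| FactorsSumS c (f : fam m c) (g : fam c n) h h' :
    C c -> qhom f -> qhom g -> factors_sum C h' ->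
    (forall x, h x = g x *m f x + h' x) -> factors_sum C h.

(* The retracts of finite direct sums of members of C. *)
Definition Add (C : qmod k Q -> Prop) m : Prop :=
  factors_sum C (fun x => 1%:M : 'M_(mdim m x)).

Lemma factors_sum_ext C m n (h h' : fam m n) :
  (forall x, h x = h' x) -> factors_sum C h -> factors_sum C h'.
Proof.
move=> e H; elim: H h' e => {h} [h z | c f g h h1 Cc hf hg H1 IH e1] h' e.
  by apply: FactorsSum0 => x; rewrite -e.
by apply: (FactorsSumS Cc hf hg H1) => x; rewrite -e.
Qed.

Lemma factors_sum_add C m n (h h' : fam m n) :
  factors_sum C h -> factors_sum C h' ->
  factors_sum C (fun x => h x + h' x : 'M_(mdim n x, mdim m x)).
Proof.
move=> H H'; elim: H => {h} [h z | c f g h h1 Cc hf hg H1 IH e1].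
  by apply: factors_sum_ext H' => x; rewrite z add0r.
by apply: (FactorsSumS Cc hf hg IH) => x; rewrite e1 addrA.
Qed.

Lemma factors_sum_comp C m n m' n' (h : fam m n) (f : fam m' m) (g : fam n n') :
  qhom f -> qhom g -> factors_sum C h ->
  factors_sum C (fun x => g x *m h x *m f x : 'M_(mdim n' x, mdim m' x)).
Proof.
move=> hf hg; elim=> {h} [h z | c f1 g1 h h1 Cc hf1 hg1 H1 IH e1].
  by apply: FactorsSum0 => x; rewrite z mulmx0 mul0mx.
apply: (FactorsSumS Cc (hom_comp hf hf1) (hom_comp hg1 hg) IH) => x.
by rewrite e1 mulmxDr mulmxDl !mulmxA.
Qed.

Lemma Add_retract C u m : retract u m -> Add C m -> Add C u.
Proof.
move=> [f [g [hf hg gf]]] H; apply: factors_sum_ext (factors_sum_comp hf hg H).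
by move=> x; rewrite mulmx1 gf.
Qed.

Lemma Add_sum2 C m u v (f : fam u m) (g : fam m u) (f' : fam v m) (g' : fam m v) :
  qhom f -> qhom g -> qhom f' -> qhom g' ->
  (forall x, f x *m g x + f' x *m g' x = 1%:M) -> Add C u -> Add C v -> Add C m.
Proof.
move=> hf hg hf' hg' s Au Av.
apply: factors_sum_ext (factors_sum_add (factors_sum_comp hg hf Au)
  (factors_sum_comp hg' hf' Av)) => x.
by rewrite !mulmx1 s.
Qed.

Lemma Add_qsum C u v : Add C u -> Add C v -> Add C (qsum u v).
Proof.
have [f [g [f' [g' [[hf hg hf' hg'] _ _ s]]]]] := qsum_split u v.
exact: Add_sum2 s.
Qed.

Lemma Add_incl (C : qmod k Q -> Prop) m : C m -> Add C m.
Proof.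
move=> Cm; apply: (FactorsSumS Cm (@hom_id m) (@hom_id m) (@FactorsSum0 C m m _ (fun=> erefl))).
by move=> x; rewrite mul1mx addr0.
Qed.

Lemma Add_zero C m : qzero m -> Add C m.
Proof. by move=> z; apply: FactorsSum0 => x; apply: mx_dim0; left. Qed.

(** Induction on the total dimension: c splits off, and its complement is a retract of m, hence
    again in D, of smaller total dimension. *)
Lemma Add_decompose (D C : qmod k Q -> Prop) :
  (forall m u, D m -> retract u m -> D u) ->
  (forall m, D m -> ~ qzero m -> exists2 c, C c & retract c m /\ ~ qzero c) ->
  forall m, D m -> Add C m.
Proof.
move=> Dr H m; have [N] := ubnP (\sum_x mdim m x)%N; elim: N m => // N IH m ltN Dm.
have [z|nz] := classic (qzero m); first exact: Add_zero.
have [c Cc [r nzc]] := H m Dm nz; have [v iso] := retract_compl r.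
apply: Add_retract (iso_retract iso) _; apply: Add_qsum; first exact: Add_incl.
have rv : retract v m by apply: retract_trans (iso_retract (iso_sym iso)); apply: retract_qsumr.
apply: IH (Dr _ _ Dm rv); rewrite ltnS in ltN; apply: leq_trans ltN.
have dimE x : mdim m x = (mdim c x + mdim v x)%N.
  have [f [g [_ _ gf fg]]] := iso.
  apply/eqP; rewrite eqn_leq; apply/andP; split.
    by have := mulmx_max_rank (g x) (f x); rewrite gf mxrank1.
  by have := mulmx_max_rank (f x) (g x); rewrite fg mxrank1.
rewrite (eq_bigr _ (fun x _ => dimE x)) big_split /= -[X in (X < _)%N]add0n ltn_add2r.
rewrite lt0n; apply/eqP => /eqP; rewrite sum_nat_eq0 => /forallP z; apply: nzc => x.
by apply/eqP; have := z x.
Qed.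

End Homs.

(** * Fitting's lemma and Krull-Schmidt *)

Lemma group_inverse (k : fieldType) n (H : 'M[k]_n) : \rank (H *m H) = \rank H ->
  exists K, H *m K = K *m H /\ H *m K *m H = H.
Proof.
move=> rHH.
have [r [C [R [CR rk]]]] : exists r (C : 'M_(n, r)) (R : 'M_(r, n)), C *m R = H /\ \rank H = r.
  by exists (\rank H), (col_base H), (row_base H); rewrite mulmx_base.
have uD : R *m C \in unitmx.
  rewrite -row_full_unit -col_leq_rank -{1}rk -rHH -CR mulmxA -(mulmxA C).
  exact: leq_trans (mxrankM_maxl _ _) (mxrankM_maxr _ _).
(* In the rank factorization H = C R, equality of the ranks of H and H H makes R C invertible; K = C
   (R C)^-2 R is the group inverse of H. *)
exists (C *m invmx (R *m C) *m invmx (R *m C) *m R); rewrite -{H rHH rk}CR; split.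
  by rewrite !mulmxA -(mulmxA C R C) mulmxK // -(mulmxA _ R C) mulmxKV.
by rewrite !mulmxA -(mulmxA C R C) mulmxK // -(mulmxA _ R C) mulmxKV.
Qed.

Section Fitting.
Variables (k : fieldType) (Q : quiver).
Implicit Types m n u v w : qmod k Q.

Lemma hom_exp m (h : fam m m) N : qhom h -> qhom (fun x => h x ^+ N : 'M_(mdim m x)).
Proof.
move=> hh; elim: N => [|N IH]; first exact: hom_id.
by apply: hom_ext (hom_comp IH hh) => x; rewrite exprS.
Qed.

Lemma hom_invmx m (h : fam m m) : qhom h -> (forall x, h x \in unitmx) ->
  qhom (fun x => invmx (h x) : 'M_(mdim m x)).
Proof. by move=> hh u; apply: (hom_inv hh) => x; rewrite ?mulVmx ?mulmxV. Qed.

(** One exponent has to serve all vertices, so the sum of the ranks is used: while doubling N lowers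
    it, go on; once it does not, no single rank drops. *)
Lemma stable_rank_power m (h : fam m m) : exists2 N, (0 < N)%N &
  forall x, \rank (h x ^+ N *m h x ^+ N) = \rank (h x ^+ N).
Proof.
pose r N := (\sum_x \rank (h x ^+ N))%N.
suff H b : forall N, (0 < N)%N -> (r N <= b)%N -> exists2 N', (0 < N')%N &
   forall x, \rank (h x ^+ N' *m h x ^+ N') = \rank (h x ^+ N') by apply: (H (r 1%N) 1%N).
elim: b => [|b IH] N N0 rN.
  exists N => // x; apply/eqP; rewrite eqn_leq mxrankM_maxl /=.
  by move: rN; rewrite leqn0 sum_nat_eq0 => /forallP/(_ x) /= /eqP ->.
have [lt|ge] := ltnP (r (N + N)%N) (r N).
  by apply: (IH (N + N)%N); rewrite ?addn_gt0 ?N0 // -ltnS (leq_trans lt).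
exists N => // x; apply/eqP; rewrite eqn_leq mxrankM_maxl /= leqNgt; apply/negP => lt.
have : (r (N + N) < r N)%N.
  rewrite /r (bigD1 x) //= [X in (_ < X)%N](bigD1 x) //= -addSn.
  apply: leq_add; first by rewrite exprD.
  by apply: leq_sum => y _; rewrite exprD; apply: mxrankM_maxl.
by rewrite ltnNge ge.
Qed.

(** Take H = h^N with stable rank and K its group inverse. Although K is chosen vertex by vertex,
    the idempotents H K commute with the arrows. H K = 0 forces H = 0; H K = 1 makes h invertible,
    as N > 0 exhibits h as a left factor of 1. *)
Lemma nilpotent_or_invertible m (h : fam m m) : idem_trivial m -> qhom h ->
  (exists N, forall x, h x ^+ N = 0) \/ (forall x, h x \in unitmx).
Proof.
move=> Hm hh; have [N N0 rk] := stable_rank_power h.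
have [K HK] : exists K : fam m m, forall x, h x ^+ N *m K x = K x *m h x ^+ N /\
    h x ^+ N *m K x *m h x ^+ N = h x ^+ N.
  apply: (fin_all_exists (P := fun x K => h x ^+ N *m K = K *m h x ^+ N /\
    h x ^+ N *m K *m h x ^+ N = h x ^+ N)) => x.
  by apply: group_inverse; rewrite rk.
have hN := hom_exp N hh.
pose H x := h x ^+ N; have c x : H x *m K x = K x *m H x by case: (HK x).
have {HK} p x : H x *m K x *m H x = H x by case: (HK x).
have {}hN : qhom H by [].
have p' x : H x *m (H x *m K x) = H x by rewrite c mulmxA.
have hE : qhom (fun x => H x *m K x : 'M_(mdim m x)).
  move=> x y a; transitivity (H y *m K y *m arr_act m a *m (H x *m K x)).
    rewrite c -!mulmxA hN -{1}(p' x) (mulmxA (arr_act m a)) -hN.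
    by rewrite !mulmxA -c -!mulmxA.
  by rewrite -!mulmxA (mulmxA (arr_act m a)) -hN !mulmxA p.
case: (Hm _ hE) => [x|z|z]; first by rewrite mulmxA p.
  by left; exists N => x; rewrite -/(H x) -(p x) z mul0mx.
right=> x; have := z x; rewrite /H -(prednK N0) exprS -mulmxE -mulmxA.
by case/mulmx1_unit.
Qed.

Lemma nilpotent_unit d (A : 'M[k]_d) N : A ^+ N = 0 -> 1%:M - A \in unitmx.
Proof.
move=> z; have := subrX1 A N; rewrite z sub0r => e.
have : (1%:M - A) *m (\sum_(i < N) A ^+ i) = 1%:M.
  by apply/eqP; rewrite -opprB mulNmx mulmxE -e opprK.
by case/mulmx1_unit.
Qed.

Lemma factors_sum_hom C m n (h : fam m n) : factors_sum C h -> qhom h.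
Proof.
elim=> {h} [h z | c f g h h1 Cc hf hg H1 IH e1].
  by apply: hom_ext (@hom_zero _ _ m n) => x; rewrite z.
by apply: hom_ext (hom_add (hom_comp hf hg) IH) => x; rewrite e1.
Qed.

(* Krull-Schmidt: endomorphism rings of indecomposables are local by Fitting's lemma. *)
Lemma indecomposable_Add C m : indecomposable m -> Add C m ->
  exists2 c, C c & retract m c.
Proof.
move=> /indecomposableP[nz Hm] H.
(* The induction needs an arbitrary automorphism h in place of 1: if the term h^-1 g f is nilpotent,
   dropping it leaves h (1 - h^-1 g f), which is again invertible. *)
suff K : forall h : fam m m, factors_sum C h -> (forall x, h x \in unitmx) ->
    exists2 c, C c & retract m c.
  by apply: K H _ => x; apply: unitmx1.
move=> h; elim=> {h H} [h z u | c f g h h' Cc hf hg H1 IH e u].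
  case: nz => x; have := u x; rewrite z.
  case: (mdim m x) => // d; rewrite -row_full_unit /row_full mxrank0.
  by [].
have hh : qhom h by apply: factors_sum_hom (FactorsSumS Cc hf hg H1 e).
have hp : qhom (fun x => invmx (h x) *m (g x *m f x) : 'M_(mdim m x)).
  exact: hom_comp (hom_comp hf hg) (hom_invmx hh u).
case: (nilpotent_or_invertible Hm hp) => [[N nil] | inv].
  apply: IH => x; have -> : h' x = h x *m (1%:M - invmx (h x) *m (g x *m f x)).
    by rewrite mulmxBr mulmx1 mulKVmx // e addrC addKr.
  by rewrite unitmx_mul u (nilpotent_unit (nil x)).
exists c => //; exists f; pose q x := invmx (invmx (h x) *m (g x *m f x)).
exists (fun x => q x *m (invmx (h x) *m g x)); split=> //.
  by apply: hom_comp (hom_invmx hp inv); apply: hom_comp (hom_invmx hh u).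
by move=> x; rewrite -!mulmxA mulVmx.
Qed.

End Fitting.

(** * Path actions and tensor products *)

Section Actions.
Variables (k : fieldType) (Q : quiver).
Implicit Types m n u v w : qmod k Q.

Lemma pact_hom m n (f : fam m n) x y (p : qpath x y) : qhom f ->
  f y *m pact m p = pact n p *m f x.
Proof.
move=> hf; elim: p => {x y} [x | x y z a p IH] /=; first by rewrite mulmx1 mul1mx.
by rewrite mulmxA IH -!mulmxA hf.
Qed.

Lemma kactEw m x y (f : kpath k x y) (d : {fset qpath x y}) : (msupp f `<=` d)%fset ->
  kact m f = \sum_(p <- d) f@_p *: pact m p.
Proof.
move=> sub; rewrite /kact (big_fset_incl _ sub) // => p _ /mcoeff_outdom ->.
by rewrite scale0r.
Qed.

Lemma kact_lin m x y c (f g : kpath k x y) :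
  kact m (c *: f + g) = c *: kact m f + kact m g.
Proof.
pose d := (msupp f `|` msupp g)%fset.
rewrite (@kactEw _ _ _ _ d); last first.
  apply: fsubset_trans (msuppD_le _ _) _; apply: fsetSU; exact: msuppZ_le.
rewrite (@kactEw _ _ _ f d) ?fsubsetUl // (@kactEw _ _ _ g d) ?fsubsetUr //.
rewrite scaler_sumr -big_split /=; apply: eq_bigr => p _.
by rewrite mcoeffD mcoeffZ scalerDl scalerA.
Qed.

Lemma kact0 m x y : kact m (0 : kpath k x y) = 0.
Proof. by rewrite /kact msupp0 big_nil. Qed.

Lemma kact_of m x y (p : qpath x y) : kact m (kpath_of k p) = pact m p.
Proof. by rewrite /kact msuppU oner_eq0 big_seq_fset1 mcoeffUU scale1r. Qed.

Lemma kactZ m x y c (f : kpath k x y) : kact m (c *: f) = c *: kact m f.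
Proof. by rewrite -[c *: f]addr0 kact_lin kact0 addr0. Qed.

Lemma kactD m x y (f g : kpath k x y) : kact m (f + g) = kact m f + kact m g.
Proof. by rewrite -[f]scale1r kact_lin !scale1r. Qed.

Lemma kact_sum m x y (J : Type) (r : seq J) (F : J -> kpath k x y) :
  kact m (\sum_(i <- r) F i) = \sum_(i <- r) kact m (F i).
Proof.
by elim/big_ind2: _ => [|f A g B <- <-|]; rewrite ?kact0 ?kactD.
Qed.

Lemma kact_hom m n (f : fam m n) x y (p : kpath k x y) : qhom f ->
  f y *m kact m p = kact n p *m f x.
Proof.
move=> hf; rewrite /kact mulmx_sumr mulmx_suml; apply: eq_bigr => q _.
by rewrite -scalemxAr -scalemxAl pact_hom.
Qed.

Lemma in_mod_Add (I : kfamily k Q) (C : qmod k Q -> Prop) m :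
  (forall c, C c -> in_mod I c) -> Add C m -> in_mod I m.
Proof.
move=> inC H x y p Ip; rewrite -[LHS]mul1mx.
suff: forall h : fam m m, factors_sum C h -> h y *m kact m p = 0 by move/(_ _ H).
move=> h; elim=> {h H} [h z | c f g h h1 Cc hf hg H1 IH e1]; first by rewrite z mul0mx.
by rewrite e1 mulmxDl IH addr0 -mulmxA kact_hom // inC // mul0mx mulmx0.
Qed.

Lemma in_mod_retract (I : kfamily k Q) u m : retract u m -> in_mod I m -> in_mod I u.
Proof.
move=> r inm; apply: (@in_mod_Add _ (fun n => n = m)) => [_ -> //|].
by apply: Add_retract r _; apply: Add_incl.
Qed.

Lemma pact_pcat m x y z (p : qpath x y) (q : qpath y z) :
  pact m (pcat p q) = pact m q *m pact m p.
Proof.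
by elim: p q => {x y} [x | x y w a p IH] q /=; rewrite ?mulmx1 // IH mulmxA.
Qed.

Lemma kact_comp m x y z (f : kpath k x y) (g : kpath k y z) :
  kact m (kcomp f g) = kact m g *m kact m f.
Proof.
rewrite /kcomp kact_sum {3}/kact mulmx_sumr; apply: eq_bigr => p _.
rewrite kact_sum {2}/kact mulmx_suml; apply: eq_bigr => q _.
by rewrite kactZ kact_of pact_pcat -scalemxAl -scalemxAr scalerA mulrC.
Qed.

(** Lets the minimality of [gen_ideal] reduce [in_mod] to a check on generators. *)
Lemma annihilator_is_ideal m : is_ideal (fun x y (f : kpath k x y) => kact m f = 0).
Proof.
split=> [x y | x y c f g | x y z f g | x y z f g].
- exact: kact0.
- by rewrite kact_lin => -> ->; rewrite scaler0 addr0.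
- by rewrite kact_comp => ->; rewrite mul0mx.
- by rewrite kact_comp => ->; rewrite mulmx0.
Qed.

Lemma trow_lin d1 d2 e2 (A B : 'rV[k]_d1) (C : 'M_(d2, e2)) :
  trow (A + B) C = trow A C + trow B C.
Proof. by rewrite -!trowbE linearD. Qed.

Lemma tprodDl d1 e1 d2 e2 (A B : 'M[k]_(d1, e1)) (C : 'M_(d2, e2)) :
  tprod (A + B) C = tprod A C + tprod B C.
Proof.
elim: d1 e1 A B => [|d1 IH] e1 A B /=; first by rewrite addr0.
by rewrite add_col_mx -IH -trow_lin !linearD.
Qed.

Lemma tprodDr d1 e1 d2 e2 (A : 'M[k]_(d1, e1)) (B C : 'M_(d2, e2)) :
  tprod A (B + C) = tprod A B + tprod A C.
Proof.
elim: d1 e1 A => [|d1 IH] e1 A /=; first by rewrite addr0.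
by rewrite add_col_mx -IH linearD.
Qed.

Lemma tprod0l d1 e1 d2 e2 (C : 'M_(d2, e2)) : tprod (0 : 'M[k]_(d1, e1)) C = 0.
Proof. by apply: (addrI (tprod 0 C)); rewrite -tprodDl !addr0. Qed.

Lemma tprod0r d1 e1 d2 e2 (A : 'M[k]_(d1, e1)) : tprod A (0 : 'M_(d2, e2)) = 0.
Proof. by apply: (addrI (tprod A 0)); rewrite -tprodDr !addr0. Qed.

Lemma tprod_sumr (J : Type) (r : seq J) d1 e1 d2 e2 (A : 'M[k]_(d1, e1)) (F : J -> 'M_(d2, e2)) :
  tprod A (\sum_(i <- r) F i) = \sum_(i <- r) tprod A (F i).
Proof. by elim/big_rec2: _ => [|i B C _ <-]; rewrite ?tprod0r ?tprodDr. Qed.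

Lemma tprod_suml (J : Type) (r : seq J) d1 e1 d2 e2 (A : 'M[k]_(d2, e2)) (F : J -> 'M_(d1, e1)) :
  tprod (\sum_(i <- r) F i) A = \sum_(i <- r) tprod (F i) A.
Proof. by elim/big_rec2: _ => [|i B C _ <-]; rewrite ?tprod0l ?tprodDl. Qed.

Lemma hom_tensor m n m' n' (f : fam m n) (g : fam m' n') : qhom f -> qhom g ->
  @qhom _ _ (qtensor m m') (qtensor n n') (fun x => tprod (f x) (g x)).
Proof. by move=> hf hg x y a /=; rewrite -!tprodE hf hg. Qed.

Lemma retract_tensor m n m' n' : retract m n -> retract m' n' ->
  retract (qtensor m m') (qtensor n n').
Proof.
move=> [f [g [hf hg gf]]] [f' [g' [hf' hg' gf']]].
exists (fun x => tprod (f x) (f' x)), (fun x => tprod (g x) (g' x)); split.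
- exact: hom_tensor.
- exact: hom_tensor.
by move=> x; rewrite -tprodE gf gf' tprod1.
Qed.

Lemma Add_tensorr (C D : qmod k Q -> Prop) w m :
  (forall c, C c -> Add D (qtensor w c)) -> Add C m -> Add D (qtensor w m).
Proof.
move=> CD H.
suff: forall h : fam m m, factors_sum C h ->
    @factors_sum _ _ D (qtensor w m) (qtensor w m) (fun x => tprod 1%:M (h x)).
  by move/(_ _ H); apply: factors_sum_ext => x; rewrite tprod1.
move=> h; elim=> {h H} [h z | c f g h h1 Cc hf hg H1 IH e1].
  by apply: FactorsSum0 => x; rewrite z tprod0r.
have F := factors_sum_comp (hom_tensor (@hom_id _ _ w) hf) (hom_tensor (@hom_id _ _ w) hg)
  (CD c Cc).
apply: factors_sum_ext (factors_sum_add F IH) => x.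
by rewrite mulmx1 -tprodE mul1mx -tprodDr e1.
Qed.

Lemma Add_tensorl (C D : qmod k Q -> Prop) w m :
  (forall c, C c -> Add D (qtensor c w)) -> Add C m -> Add D (qtensor m w).
Proof.
move=> CD H.
suff: forall h : fam m m, factors_sum C h ->
    @factors_sum _ _ D (qtensor m w) (qtensor m w) (fun x => tprod (h x) 1%:M).
  by move/(_ _ H); apply: factors_sum_ext => x; rewrite tprod1.
move=> h; elim=> {h H} [h z | c f g h h1 Cc hf hg H1 IH e1].
  by apply: FactorsSum0 => x; rewrite z tprod0l.
have F := factors_sum_comp (hom_tensor hf (@hom_id _ _ w)) (hom_tensor hg (@hom_id _ _ w))
  (CD c Cc).
apply: factors_sum_ext (factors_sum_add F IH) => x.
by rewrite mulmx1 -tprodE mul1mx -tprodDl e1.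
Qed.

Lemma tensor_ideal_retract (I : kfamily k Q) U u m :
  tensor_ideal I U -> retract u m -> U m -> U u.
Proof.
move=> [_ Ui _ Us _] r Um; have [v iso] := retract_compl r.
by have [] := Us _ _ (Ui _ _ Um iso).
Qed.

Lemma tensor_ideal_Add (I : kfamily k Q) (C : qmod k Q -> Prop) :
  (forall c, C c -> in_mod I c) ->
  (forall w c, C c -> Add C (qtensor w c)) -> tensor_ideal I (Add C).
Proof.
move=> Ci Ct; split=> [m | m n Am iso | m n | m n A | w m _].
- exact: in_mod_Add.
- exact: Add_retract (iso_retract (iso_sym iso)) Am.
- exact: Add_qsum.
- by split; apply: Add_retract A; [apply: retract_qsuml | apply: retract_qsumr].
- exact: Add_tensorr (Ct w).
Qed.

Lemma retract_sum2 m u v (f : fam u m) (g : fam m u) (f' : fam v m) (g' : fam m v) :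
  qhom f -> qhom g -> qhom f' -> qhom g' ->
  (forall x, f x *m g x + f' x *m g' x = 1%:M) -> retract m (qsum u v).
Proof.
move=> hf hg hf' hg' s.
exists (fun x => col_mx (g x) (g' x)), (fun x => row_mx (f x) (f' x)); split.
- move=> x y a /=; rewrite mul_col_mx mul_block_col !mul0mx addr0 add0r.
  by rewrite hg hg'.
- move=> x y a /=; rewrite mul_mx_row mul_row_block !mulmx0 addr0 add0r.
  by rewrite hf hf'.
- by move=> x; rewrite mul_row_col s.
Qed.

End Actions.

(** * Push-downs *)

Definition mkarr (P : quiver) (a : Q1 P) : arr (qtail a) (qhead a) :=
  exist _ a (introT andP (conj (eqxx _) (eqxx _))).

(** Replaces an arrow by its canonical form, whose endpoints are literally [qtail a] and [qhead a],
    so that no casts arise. *)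
Lemma arr_ind (P : quiver) (T : forall x y : Q0 P, arr x y -> Prop) :
  (forall a, T _ _ (mkarr a)) -> forall x y (a : arr x y), T x y a.
Proof.
move=> H x y [a e]; have /andP[/eqP ex /eqP ey] := e.
move: e; rewrite -ex -ey => e; suff -> : e = introT andP (conj (eqxx _) (eqxx _)) by apply: H.
exact: bool_irrelevance.
Qed.

Lemma qhomP (k : fieldType) (Q : quiver) (m n : qmod k Q) (f : fam m n) :
  (forall a, f (qhead a) *m arr_act m (mkarr a) = arr_act n (mkarr a) *m f (qtail a)) ->
  qhom f.
Proof. by move=> H x y; elim/arr_ind: y /. Qed.

Section Lifts.
Variables (P Q : quiver) (G : qmor P Q).

(** Case distinction: an arrow out of the image of x lifts to an arrow out of x, and then it is
    literally an [arr_map], or it has no such lift. *)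
Lemma lift_tail_ind (T : forall (x : Q0 P) y', arr (mor0 G x) y' -> Prop) :
  (forall a, T _ _ (arr_map G (mkarr a))) ->
  (forall x y' (a' : arr (mor0 G x) y'),
     (forall a, mor1 G a = val a' -> qtail a <> x) -> T x y' a') ->
  forall x y' a', T x y' a'.
Proof.
move=> H1 H0 x y' a'.
have [/existsP[a /andP[/eqP Ga /eqP ta]]|no] :=
  boolP [exists a : Q1 P, (mor1 G a == val a') && (qtail a == x)]; last first.
  by apply: H0 => a Ga ta; case/existsP: no; exists a; rewrite Ga ta !eqxx.
case: x / ta a' Ga => a' Ga.
have := valP a'; rewrite -Ga mor_head => /andP[_ /eqP e].
case: y' / e a' Ga => a' Ga.
by have -> : a' = arr_map G (mkarr a) by apply: val_inj.
Qed.

Lemma lift_head_ind (T : forall (y : Q0 P) x', arr x' (mor0 G y) -> Prop) :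
  (forall a, T _ _ (arr_map G (mkarr a))) ->
  (forall y x' (a' : arr x' (mor0 G y)),
     (forall a, mor1 G a = val a' -> qhead a <> y) -> T y x' a') ->
  forall y x' a', T y x' a'.
Proof.
move=> H1 H0 y x' a'.
have [/existsP[a /andP[/eqP Ga /eqP ta]]|no] :=
  boolP [exists a : Q1 P, (mor1 G a == val a') && (qhead a == y)]; last first.
  by apply: H0 => a Ga ta; case/existsP: no; exists a; rewrite Ga ta !eqxx.
case: y / ta a' Ga => a' Ga.
have := valP a'; rewrite -Ga mor_tail => /andP[/eqP e _].
case: x' / e a' Ga => a' Ga.
by have -> : a' = arr_map G (mkarr a) by apply: val_inj.
Qed.

End Lifts.

Lemma strict_wrappingP (P Q : quiver) (G : qmor P Q) : strict G -> strict_wrapping G.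
Proof.
move=> sG; split=> // x y a b /(congr1 val) /= Gab; apply: val_inj.
have [//|ne] := eqVneq (val a) (val b).
have [] := sG _ _ (elimN eqP ne) Gab.
have /andP[/eqP -> _] := valP a; have /andP[/eqP -> _] := valP b.
by [].
Qed.

Section Pushdown.
Variables (k : fieldType) (P Q : quiver) (G : qmor P Q) (sG : strict_wrapping G).
Implicit Types M N : qmod k P.

(** Compares underlying numbers, because the two ordinal types agree only once the vertices are
    known to be equal. *)
Definition pd_at M x' (c : pd_basis G M x') (x : Q0 P) (j : 'I_(mdim M x)) : bool :=
  (val (tag c) == x) && (val (tagged c) == val j).

(* The inclusion of the summand M(x) of (G_*M)(x') and the projection onto it; both are
   the zero matrix when G x <> x'. *)
Definition pdin M x x' : 'M[k]_(mdim (pushdown G M) x', mdim M x) :=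
  \matrix_(i, j) (pd_at (enum_val i : pd_basis G M x') j)%:R.
Definition pdout M x x' : 'M[k]_(mdim M x, mdim (pushdown G M) x') := (pdin M x x')^T.

Lemma pd_atE M x' x (e : mor0 G x == x') (c : pd_basis G M x') (j : 'I_(mdim M x)) :
  pd_at c j = (c == Tagged (fun x : {x | mor0 G x == x'} => 'I_(mdim M (val x)))
                      (j : 'I_(mdim M (val (exist (fun x => mor0 G x == x') x e))))).
Proof.
apply/idP/eqP => [|->]; last by rewrite /pd_at /= !eqxx.
case: c => [[y ey] i]; rewrite /pd_at /= => /andP[/eqP ex /eqP ei].
move: ei; rewrite /tagged /=; case: x / ex j e => j e ei.
have -> : e = ey by apply: bool_irrelevance.
by have -> : i = j by apply: val_inj.
Qed.

Lemma pdin0 M x x' : mor0 G x <> x' -> pdin M x x' = 0.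
Proof.
move=> ne; apply/matrixP => i j; rewrite !mxE /pd_at.
by case: eqP => // e; case: ne; rewrite -e; apply/eqP/(valP (tag (enum_val i))).
Qed.

Lemma pdout0 M x x' : mor0 G x <> x' -> pdout M x x' = 0.
Proof. by move=> ne; rewrite /pdout pdin0 ?trmx0. Qed.

Lemma pdoutK M x x' : mor0 G x = x' -> pdout M x x' *m pdin M x x' = 1%:M.
Proof.
move/eqP=> e; apply/matrixP => i j; rewrite !mxE.
rewrite (reindex_onto (enum_rank : pd_basis G M x' -> _) enum_val) /=; last first.
  by move=> l _; rewrite enum_valK.
rewrite (eq_bigl predT) => [|c]; last by rewrite enum_rankK eqxx.
rewrite (eq_bigr (fun c => (pd_at c i && pd_at c j)%:R)) => [|c _]; last first.
  by rewrite !mxE enum_rankK -natrM mulnb.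
rewrite (bigD1 (Tagged (fun x : {x | mor0 G x == x'} => 'I_(mdim M (val x)))
  (i : 'I_(mdim M (val (exist (fun x => mor0 G x == x') x e)))))) //=.
rewrite big1 ?addr0 => [|c /negPf ne]; last by rewrite pd_atE ne.
by rewrite /pd_at /= !eqxx.
Qed.

Lemma pdout_in M x y x' : x <> y -> pdout M y x' *m pdin M x x' = 0.
Proof.
move=> ne; apply/matrixP => i j; rewrite !mxE big1 // => l _; rewrite !mxE /pd_at.
have [e|] := boolP (val (tag (enum_val l)) == y); last by rewrite mul0r.
have [e'|] := boolP (val (tag (enum_val l)) == x); last by rewrite mulr0.
by case: ne; rewrite -(eqP e) -(eqP e').
Qed.

Lemma pd_partition M x' : \sum_x pdin M x x' *m pdout M x x' = 1%:M.
Proof.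
apply/matrixP => i j; rewrite summxE mxE.
pose x := val (tag (enum_val i)); rewrite (bigD1 x) //= big1 ?addr0 => [|y ne]; last first.
  rewrite !mxE big1 // => l _; rewrite !mxE /pd_at -/x.
  by rewrite eq_sym (negPf ne) mul0r.
rewrite mxE (bigD1 (tagged (enum_val i))) //= big1 ?addr0 => [|l ne]; last first.
  have {}ne : (val (tagged (enum_val i)) == val l) = false.
    by rewrite val_eqE eq_sym; apply: negbTE.
  by rewrite !mxE /pd_at ne andbF mul0r.
rewrite !mxE /pd_at -/x !eqxx /= mul1r -/(pd_at (enum_val j) (tagged (enum_val i))).
rewrite (pd_atE (valP (tag (enum_val i)))) -(inj_eq enum_val_inj) eq_sym.
congr (nat_of_bool (_ == _))%:R.
case: (enum_val i) => -[y ey] l; rewrite /=.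
by move: (valP _) => ey2; rewrite (bool_irrelevance ey2 ey).
Qed.

(** The choice in [pd_coef] becomes a sum over all lifts; injectivity on parallel arrows leaves at
    most one lift between two given vertices. *)
Lemma pd_act M x' y' (a' : arr x' y') : arr_act (pushdown G M) a' =
  \sum_(a | mor1 G a == val a') pdin M (qhead a) y' *m arr_act M (mkarr a) *m pdout M (qtail a) x'.
Proof.
apply/matrixP => i j; rewrite !mxE summxE /pd_coef.
set ci := enum_val i; set cj := enum_val j.
pose T (a : Q1 P) : k := if insub a is Some a1 then
   arr_act M (a1 : arr (val (tag cj)) (val (tag ci))) (tagged ci) (tagged cj) else 0.
rewrite (eq_bigr T) => [|a _].
  case: pickP => [a /eqP Ga | no].
    rewrite (bigD1 (val a)) ?Ga //= big1 ?addr0 => [|b /andP[/eqP Gb ne]].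
      by rewrite /T valK.
    rewrite /T; case: insubP => // b1 _ eb; case/eqP: ne; rewrite -eb.
    by congr val; apply: sG.1; apply: val_inj; rewrite /= eb Gb -Ga.
  rewrite big1 // => b /eqP Gb; rewrite /T; case: insubP => // b1 _ eb.
  by have := no b1; rewrite eb Gb eqxx.
rewrite mxE /T.
have E l : (pdin M (qhead a) y' *m arr_act M (mkarr a)) i l =
    \sum_p (pd_at ci p)%:R * arr_act M (mkarr a) p l.
  by rewrite mxE; apply: eq_bigr => p _; rewrite mxE.
rewrite (eq_bigr (fun l => \sum_p (pd_at ci p)%:R * arr_act M (mkarr a) p l * (pd_at cj l)%:R));
  last by move=> l _; rewrite E mulr_suml; apply: eq_bigr => p _; rewrite !mxE.
case: insubP => [a1 _ ea | ne].
  have := valP a1; rewrite /= ea => /andP[/eqP et /eqP eh].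
  clearbody ci cj; clear E T i j.
  move: a1 ea; rewrite /pd_at.
  case: ci cj eh et => -[y ey] p0 [[x ex] q0] /=; rewrite /tagged /= => eh et.
  case: y / eh ey p0 => ey p0; case: x / et ex q0 => ex q0 a1 ea.
  have {a1 ea}-> : a1 = mkarr a by apply: val_inj.
  rewrite (bigD1 q0) //= (bigD1 p0) //= !eqxx mul1r mulr1.
  rewrite big1 ?addr0 => [|p /negPf ne]; last by rewrite val_eqE eq_sym ne mul0r mul0r.
  rewrite big1 ?addr0 // => q /negPf ne; rewrite big1 // => p _.
  by rewrite !val_eqE [q0 == q]eq_sym ne mulr0.
rewrite big1 // => l _; rewrite big1 // => p _; rewrite /pd_at.
by move: ne; rewrite negb_and ![_ == val (tag _)]eq_sym => /orP[] /negPf -> /=; rewrite ?mulr0 ?mul0r.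
Qed.

Lemma arr_tail (R : quiver) (x y : Q0 R) (a : arr x y) : qtail (val a) = x.
Proof. by have /andP[/eqP] := valP a. Qed.

Lemma arr_head (R : quiver) (x y : Q0 R) (a : arr x y) : qhead (val a) = y.
Proof. by have /andP[_ /eqP] := valP a. Qed.

Lemma strict_tail_inj (a b : Q1 P) : mor1 G a = mor1 G b -> qtail a = qtail b -> a = b.
Proof.
by move=> Gab t; have [//|/eqP ne] := eqVneq a b; case: (sG.2 _ _ ne Gab).
Qed.

Lemma strict_head_inj (a b : Q1 P) : mor1 G a = mor1 G b -> qhead a = qhead b -> a = b.
Proof.
by move=> Gab t; have [//|/eqP ne] := eqVneq a b; case: (sG.2 _ _ ne Gab).
Qed.

(** By strictness a is the only lift of a' with tail x, so no other summand of the target is reached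
    from M(x). *)
Lemma pd_act_in M x y (a : arr x y) x' y' (a' : arr x' y') : mor1 G (val a) = val a' ->
  arr_act (pushdown G M) a' *m pdin M x x' = pdin M y y' *m arr_act M a.
Proof.
elim/arr_ind: y / a => a; rewrite -[val (mkarr a)]/a => Ga; rewrite pd_act mulmx_suml (bigD1 a) ?Ga //=.
rewrite -mulmxA pdoutK ?mulmx1; last by rewrite -mor_tail Ga arr_tail.
rewrite big1 ?addr0 // => b /andP[/eqP Gb /eqP ne].
by rewrite -mulmxA pdout_in ?mulmx0 // => t; apply: ne; apply: strict_tail_inj; rewrite ?Gb.
Qed.

Lemma pd_act_in0 M x x' y' (a' : arr x' y') :
  (forall a, mor1 G a = val a' -> qtail a <> x) ->
  arr_act (pushdown G M) a' *m pdin M x x' = 0.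
Proof.
move=> H; rewrite pd_act mulmx_suml big1 // => b /eqP Gb.
by rewrite -mulmxA pdout_in ?mulmx0 // => t; apply: H Gb _.
Qed.

Lemma pd_out_act M x y (a : arr x y) x' y' (a' : arr x' y') : mor1 G (val a) = val a' ->
  pdout M y y' *m arr_act (pushdown G M) a' = arr_act M a *m pdout M x x'.
Proof.
elim/arr_ind: y / a => a; rewrite -[val (mkarr a)]/a => Ga; rewrite pd_act mulmx_sumr (bigD1 a) ?Ga //=.
rewrite !mulmxA pdoutK ?mul1mx; last by rewrite -mor_head Ga arr_head.
rewrite big1 ?addr0 // => b /andP[/eqP Gb /eqP ne].
rewrite !mulmxA pdout_in ?mul0mx // => t; apply: ne; apply: strict_head_inj; rewrite ?Gb //.
Qed.

Lemma pd_out_act0 M y x' y' (a' : arr x' y') :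
  (forall a, mor1 G a = val a' -> qhead a <> y) ->
  pdout M y y' *m arr_act (pushdown G M) a' = 0.
Proof.
move=> H; rewrite pd_act mulmx_sumr big1 // => b /eqP Gb.
by rewrite !mulmxA pdout_in ?mul0mx // => t; apply: H Gb _.
Qed.

Lemma pd_extr M x' p (A B : 'M[k]_(p, mdim (pushdown G M) x')) :
  (forall x, mor0 G x = x' -> A *m pdin M x x' = B *m pdin M x x') -> A = B.
Proof.
move=> H; rewrite -[A]mulmx1 -[B]mulmx1 -pd_partition !mulmx_sumr.
apply: eq_bigr => x _; rewrite !mulmxA.
by have [/H -> //|/eqP ne] := eqVneq (mor0 G x) x'; rewrite pdout0 // !mulmx0.
Qed.

Lemma pd_extl M x' p (A B : 'M[k]_(mdim (pushdown G M) x', p)) :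
  (forall x, mor0 G x = x' -> pdout M x x' *m A = pdout M x x' *m B) -> A = B.
Proof.
move=> H; rewrite -[A]mul1mx -[B]mul1mx -pd_partition !mulmx_suml.
apply: eq_bigr => x _; rewrite -!mulmxA.
by have [/H -> //|/eqP ne] := eqVneq (mor0 G x) x'; rewrite pdin0 // !mul0mx.
Qed.

(* The identity when x = y; a junk value otherwise. *)
Definition transport (R : quiver) (m : qmod k R) (x y : Q0 R) : 'M[k]_(mdim m y, mdim m x) :=
  \matrix_(i, j) (val i == val j)%:R.

Lemma transport_id (R : quiver) (m : qmod k R) x : transport m x x = 1%:M.
Proof. by apply/matrixP => i j; rewrite !mxE. Qed.

Definition pd_desc M (m : qmod k Q) (f : forall x, 'M[k]_(mdim m (mor0 G x), mdim M x)) :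
    fam (pushdown G M) m :=
  fun x' => \sum_x transport m (mor0 G x) x' *m f x *m pdout M x x'.

Definition pd_asc M (m : qmod k Q) (g : forall x, 'M[k]_(mdim M x, mdim m (mor0 G x))) :
    fam m (pushdown G M) :=
  fun x' => \sum_x pdin M x x' *m g x *m transport m x' (mor0 G x).

Lemma pd_desc_in M m f x : @pd_desc M m f (mor0 G x) *m pdin M x (mor0 G x) = f x.
Proof.
rewrite /pd_desc mulmx_suml (bigD1 x) //= big1 ?addr0 => [|y /eqP ne].
  by rewrite -mulmxA pdoutK // mulmx1 transport_id mul1mx.
by rewrite -mulmxA pdout_in ?mulmx0 // => e; case: ne.
Qed.

Lemma pd_out_asc M m g x : pdout M x (mor0 G x) *m @pd_asc M m g (mor0 G x) = g x.
Proof.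
rewrite /pd_asc mulmx_sumr (bigD1 x) //= big1 ?addr0 => [|y /eqP ne].
  by rewrite !mulmxA pdoutK // mul1mx transport_id mulmx1.
by rewrite !mulmxA pdout_in ?mul0mx // => e; case: ne.
Qed.

(** A morphism M -> G^* m is in general not enough: arrows of Q without a lift at x act as zero on
    the summand M(x), so they must also kill the image of f x. This is the second hypothesis. *)
Lemma pd_desc_hom M m f :
  (forall a, f (qhead a) *m arr_act M (mkarr a) = arr_act m (arr_map G (mkarr a)) *m f (qtail a)) ->
  (forall x y' (a' : arr (mor0 G x) y'),
    (forall a, mor1 G a = val a' -> qtail a <> x) -> arr_act m a' *m f x = 0) ->
  qhom (@pd_desc M m f).
Proof.
move=> h1 h0 x' y' a'; apply: pd_extr => x e; case: x' / e a' => a'.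
rewrite -!mulmxA pd_desc_in; elim/lift_tail_ind: y' / a' => [a | {}x y' a' no].
  by rewrite (@pd_act_in _ _ _ (mkarr a)) // mulmxA pd_desc_in h1.
by rewrite pd_act_in0 // mulmx0 h0.
Qed.

Lemma pd_asc_hom M m g :
  (forall a, g (qhead a) *m arr_act m (arr_map G (mkarr a)) = arr_act M (mkarr a) *m g (qtail a)) ->
  (forall y x' (a' : arr x' (mor0 G y)),
    (forall a, mor1 G a = val a' -> qhead a <> y) -> g y *m arr_act m a' = 0) ->
  qhom (@pd_asc M m g).
Proof.
move=> h1 h0 x' y' a'; apply: pd_extl => y e; case: y' / e a' => a'.
rewrite !mulmxA pd_out_asc; elim/lift_head_ind: x' / a' => [a | {}y x' a' no].
  by rewrite (@pd_out_act _ _ _ (mkarr a)) // -mulmxA pd_out_asc h1.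
by rewrite pd_out_act0 // mul0mx h0.
Qed.

Definition pd_map M N (f : fam M N) : fam (pushdown G M) (pushdown G N) :=
  fun x' => \sum_x pdin N x x' *m f x *m pdout M x x'.

Lemma pd_map_in M N (f : fam M N) x x' :
  pd_map f x' *m pdin M x x' = pdin N x x' *m f x.
Proof.
rewrite /pd_map mulmx_suml (bigD1 x) //= big1 ?addr0 => [|y /eqP ne].
  have [e|/eqP ne] := eqVneq (mor0 G x) x'; first by rewrite -mulmxA pdoutK // mulmx1.
  by rewrite !pdin0 // !mul0mx.
by rewrite -mulmxA pdout_in ?mulmx0 // => e; case: ne.
Qed.

Lemma pd_map_hom M N (f : fam M N) : qhom f -> qhom (pd_map f).
Proof.
move=> hf x' y' a'; apply: pd_extr => x e; case: x' / e a' => a'.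
rewrite -!mulmxA pd_map_in; elim/lift_tail_ind: y' / a' => [a | {}x y' a' no].
  rewrite (@pd_act_in _ _ _ (mkarr a)) // mulmxA pd_map_in mulmxA (@pd_act_in _ _ _ (mkarr a)) //.
  by rewrite -!mulmxA hf.
by rewrite pd_act_in0 // mulmx0 mulmxA pd_act_in0 // mul0mx.
Qed.

Lemma pd_map_comp M N L (f : fam M N) (g : fam N L) x' :
  pd_map g x' *m pd_map f x' = pd_map (fun x => g x *m f x : 'M_(mdim L x, mdim M x)) x'.
Proof.
by apply: pd_extr => x _; rewrite -mulmxA !pd_map_in mulmxA pd_map_in !mulmxA.
Qed.

Lemma pd_map_id M (f : fam M M) x' : (forall x, f x = 1%:M) -> pd_map f x' = 1%:M.
Proof. by move=> f1; apply: pd_extr => x _; rewrite pd_map_in f1 mulmx1 mul1mx. Qed.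

Lemma pd_map_add M N (f g : fam M N) x' :
  pd_map (fun x => f x + g x : 'M_(mdim N x, mdim M x)) x' = pd_map f x' + pd_map g x'.
Proof. by apply: pd_extr => x _; rewrite mulmxDl !pd_map_in mulmxDr. Qed.

Lemma pd_retract M N : retract M N -> retract (pushdown G M) (pushdown G N).
Proof.
move=> [f [g [hf hg gf]]]; exists (pd_map f), (pd_map g); split; try exact: pd_map_hom.
by move=> x'; rewrite pd_map_comp pd_map_id.
Qed.

Lemma Add_pushdown (C : qmod k P -> Prop) (D : qmod k Q -> Prop) M :
  (forall c, C c -> Add D (pushdown G c)) -> Add C M -> Add D (pushdown G M).
Proof.
move=> CD H.
suff: forall h : fam M M, factors_sum C h -> factors_sum D (pd_map h).
  by move/(_ _ H); apply: factors_sum_ext => x; rewrite pd_map_id.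
move=> h; elim=> {h H} [h z | c f g h h1 Cc hf hg H1 IH e1].
  apply: FactorsSum0 => x; rewrite /pd_map big1 // => y _.
  by rewrite z mulmx0 mul0mx.
have F := factors_sum_comp (pd_map_hom hf) (pd_map_hom hg) (CD c Cc).
apply: factors_sum_ext (factors_sum_add F IH) => x.
rewrite mulmx1 pd_map_comp -pd_map_add; apply: eq_bigr => y _.
by rewrite e1.
Qed.

Definition pullback (m : qmod k Q) : qmod k P :=
  @QMod k P (fun x => mdim m (mor0 G x)) (fun x y a => arr_act m (arr_map G a)).

(** At x' both sides are the sum of m(x') (x) N(x) over the fibre of x', and an arrow without a lift
    at x is zero on the corresponding summand of both. *)
Lemma projection_formula m N :
  qiso (qtensor m (pushdown G N)) (pushdown G (qtensor (pullback m) N)).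
Proof.
set T := qtensor (pullback m) N; set m' := qtensor m (pushdown G N).
pose f x : 'M_(mdim m' (mor0 G x), mdim T x) := tprod 1%:M (pdin N x (mor0 G x)).
pose phi : fam m' (pushdown G T) := fun x' =>
  \sum_x pdin T x x' *m tprod (transport m x' (mor0 G x)) (pdout N x x').
have phi_f x : phi (mor0 G x) *m f x = pdin T x (mor0 G x).
  rewrite /phi mulmx_suml (bigD1 x) //= big1 ?addr0 => [|y /eqP ne].
    by rewrite -mulmxA -tprodE transport_id mulmx1 pdoutK // tprod1 mulmx1.
  rewrite -mulmxA -tprodE pdout_in ?tprod0r ?mulmx0 // => e; by case: ne.
have hpsi : qhom (pd_desc f).
  apply: pd_desc_hom => [a | x y' a' no].
    rewrite /= -!tprodE mul1mx mulmx1 (@pd_act_in _ _ _ (mkarr a)) //.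
  by rewrite /= -tprodE mulmx1 pd_act_in0 // tprod0r.
have fp x' : phi x' *m pd_desc f x' = 1%:M.
  apply: pd_extr => x e; case: x' / e.
  by rewrite -mulmxA pd_desc_in phi_f mul1mx.
have pf x' : pd_desc f x' *m phi x' = 1%:M.
  rewrite -[LHS]mulmx1 -tprod1 -(pd_partition N) tprod_sumr mulmx_sumr.
  apply: eq_bigr => x _.
  have [e|/eqP ne] := eqVneq (mor0 G x) x'; last by rewrite pdin0 // mul0mx tprod0r mulmx0.
  case: x' / e.
  have -> : tprod 1%:M (pdin N x (mor0 G x) *m pdout N x (mor0 G x)) =
      f x *m tprod 1%:M (pdout N x (mor0 G x)) by rewrite -tprodE mulmx1.
  rewrite !mulmxA.
  by congr (_ *m _); rewrite -mulmxA phi_f pd_desc_in.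
exists phi, (pd_desc f); split=> //; exact: hom_inv hpsi fp pf.
Qed.

(** The matrix [tprod] is symmetric only up to a permutation of bases, so the mirror image is proved
    directly. *)
Lemma projection_formula_left m N :
  qiso (qtensor (pushdown G N) m) (pushdown G (qtensor N (pullback m))).
Proof.
set T := qtensor N (pullback m); set m' := qtensor (pushdown G N) m.
pose f x : 'M_(mdim m' (mor0 G x), mdim T x) := tprod (pdin N x (mor0 G x)) 1%:M.
pose phi : fam m' (pushdown G T) := fun x' =>
  \sum_x pdin T x x' *m tprod (pdout N x x') (transport m x' (mor0 G x)).
have phi_f x : phi (mor0 G x) *m f x = pdin T x (mor0 G x).
  rewrite /phi mulmx_suml (bigD1 x) //= big1 ?addr0 => [|y /eqP ne].
    by rewrite -mulmxA -tprodE transport_id mulmx1 pdoutK // tprod1 mulmx1.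
  rewrite -mulmxA -tprodE pdout_in ?tprod0l ?mulmx0 // => e; by case: ne.
have hpsi : qhom (pd_desc f).
  apply: pd_desc_hom => [a | x y' a' no].
    rewrite /= -!tprodE mul1mx mulmx1 (@pd_act_in _ _ _ (mkarr a)) //.
  by rewrite /= -tprodE mulmx1 pd_act_in0 // tprod0l.
have fp x' : phi x' *m pd_desc f x' = 1%:M.
  apply: pd_extr => x e; case: x' / e.
  by rewrite -mulmxA pd_desc_in phi_f mul1mx.
have pf x' : pd_desc f x' *m phi x' = 1%:M.
  rewrite -[LHS]mulmx1 -tprod1 -(pd_partition N) tprod_suml mulmx_sumr.
  apply: eq_bigr => x _.
  have [e|/eqP ne] := eqVneq (mor0 G x) x'; last by rewrite pdin0 // mul0mx tprod0l mulmx0.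
  case: x' / e.
  have -> : tprod (pdin N x (mor0 G x) *m pdout N x (mor0 G x)) 1%:M =
      f x *m tprod (pdout N x (mor0 G x)) 1%:M by rewrite -tprodE mulmx1.
  rewrite !mulmxA.
  by congr (_ *m _); rewrite -mulmxA phi_f pd_desc_in.
exists phi, (pd_desc f); split=> //; exact: hom_inv hpsi fp pf.
Qed.

Lemma retract_pullback_pushdown M : retract M (pullback (pushdown G M)).
Proof.
exists (fun x => pdin M x (mor0 G x)), (fun x => pdout M x (mor0 G x)); split.
- by move=> x y a /=; rewrite (@pd_act_in _ _ _ a).
- by move=> x y a /=; rewrite (@pd_out_act _ _ _ a).
by move=> x; rewrite pdoutK.
Qed.

Lemma pushdown_tensor M N :
  retract (pushdown G (qtensor M N)) (qtensor (pushdown G M) (pushdown G N)).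
Proof.
apply: retract_trans (iso_retract (iso_sym (projection_formula (pushdown G M) N))).
exact/pd_retract/retract_tensor/retract_refl/retract_pullback_pushdown.
Qed.

End Pushdown.

Arguments pullback {k P Q} G m.

(** * Push-down along composites and compatibility with the ideal *)

Section Composition.
Variables (k : fieldType) (P' P Q : quiver) (H : qmor P' P) (G : qmor P Q) (F : qmor P' Q).
Hypotheses (sH : strict_wrapping H) (sG : strict_wrapping G) (sF : strict_wrapping F).
Hypothesis FGH : is_comp F G H.

Lemma pushdown_comp (M : qmod k P') : qiso (pushdown F M) (pushdown G (pushdown H M)).
Proof.
pose f x x' := pdin G (pushdown H M) (mor0 H x) x' *m pdin H M x (mor0 H x).
pose g x x' := pdout H M x (mor0 H x) *m pdout G (pushdown H M) (mor0 H x) x'.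
have F0 x x' : mor0 F x = x' -> mor0 G (mor0 H x) = x' by rewrite FGH.1.
have gf x y x' : x <> y -> g y x' *m f x x' = 0.
  move=> ne; rewrite /g /f -mulmxA (mulmxA (pdout G _ _ _)).
  have [e|/eqP ne'] := eqVneq (mor0 H x) (mor0 H y); last first.
    by rewrite pdout_in // mul0mx mulmx0.
  have [e'|/eqP ne'] := eqVneq (mor0 G (mor0 H x)) x'; last first.
    by rewrite (pdin0 _ ne') mulmx0 mul0mx mulmx0.
  by rewrite e pdoutK -?e // mul1mx pdout_in.
have gf1 x x' : mor0 F x = x' -> g x x' *m f x x' = 1%:M.
  move=> e; rewrite /g /f -mulmxA (mulmxA (pdout G _ _ _)) pdoutK; last exact: F0.
  by rewrite mul1mx pdoutK.
pose i : fam (pushdown F M) (pushdown G (pushdown H M)) :=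
  fun x' => \sum_x f x x' *m pdout F M x x'.
pose j : fam (pushdown G (pushdown H M)) (pushdown F M) :=
  fun x' => \sum_x pdin F M x x' *m g x x'.
have i_in x x' : mor0 F x = x' -> i x' *m pdin F M x x' = f x x'.
  move=> e; rewrite /i mulmx_suml (bigD1 x) //= big1 ?addr0 => [|y /eqP ne].
    by rewrite -mulmxA pdoutK // mulmx1.
  by rewrite -mulmxA pdout_in ?mulmx0 // => e'; case: ne.
have j_f x x' : mor0 F x = x' -> j x' *m f x x' = pdin F M x x'.
  move=> e; rewrite /j mulmx_suml (bigD1 x) //= big1 ?addr0 => [|y /eqP ne].
    by rewrite -mulmxA gf1 // mulmx1.
  by rewrite -mulmxA gf ?mulmx0 // => e'; case: ne.
have ji x' : j x' *m i x' = 1%:M.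
  by apply: pd_extr => x e; rewrite -mulmxA i_in // j_f // mul1mx.
have ij x' : i x' *m j x' = 1%:M.
  apply: pd_extr => z ez; rewrite mul1mx; apply: pd_extr => x ex.
  case: z / ex ez => ez; have e : mor0 F x = x' by rewrite FGH.1.
  by rewrite -[LHS]mulmxA -/(f x x') -mulmxA j_f // i_in.
have hi : qhom i.
  move=> x' y' a'; apply: pd_extr => x e; case: x' / e a' => a'.
  rewrite -!mulmxA i_in //; elim/lift_tail_ind: y' / a' => [a | {}x y' a' no].
    rewrite (@pd_act_in _ _ _ _ sF _ _ _ (mkarr a)) // mulmxA i_in //.
    rewrite /f mulmxA (@pd_act_in _ _ _ _ sG _ _ _ (arr_map H (mkarr a))) /= ?FGH.2 //.
    by rewrite -!mulmxA (@pd_act_in _ _ _ _ sH _ _ _ (mkarr a)).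
  rewrite pd_act_in0 // mulmx0 /f mulmxA.
  (* As a' has no lift along F at x, either it has none along G at H x, or its lift b there has none
     along H at x. *)
  have [/existsP[b /andP[/eqP Gb /eqP tb]]|no'] :=
    boolP [exists b : Q1 P, (mor1 G b == val a') && (qtail b == mor0 H x)]; last first.
    rewrite pd_act_in0 ?mul0mx // => b Gb tb.
    by case/existsP: no'; exists b; rewrite Gb tb !eqxx.
  rewrite -tb (@pd_act_in _ _ _ _ sG _ _ _ (mkarr b)) // -mulmxA pd_act_in0 ?mulmx0 // => a Ha.
  by apply: no; rewrite FGH.2 Ha.
exists i, j; split=> //; exact: hom_inv hi ji ij.
Qed.

End Composition.

Section Compatibility.
Variables (k : fieldType) (Q : quiver) (I : kfamily k Q).

(** A path that does not kill M(x) is lifted arrow by arrow. Lists of arrows are compared because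
    the endpoints in Q agree only propositionally. *)
Lemma pact_pushdown_in (P : quiver) (G : qmor P Q) (sG : strict_wrapping G) (M : qmod k P)
    x' y' (p : qpath x' y') x : mor0 G x = x' ->
  pact (pushdown G M) p *m pdin G M x x' <> 0 ->
  exists y (q : qpath x y), path_arrows (path_map G q) = path_arrows p.
Proof.
elim: p x => {x' y'} [x' | x' z' y' a' p IH] x e /=; first by exists x, (pnil x).
case: x' / e a' => a'; elim/lift_tail_ind: z' / a' p IH => [a | {}x z' a' no] p IH.
  rewrite -mulmxA (@pd_act_in _ _ _ _ sG _ _ _ (mkarr a)) // mulmxA => ne.
  have [|y [q eq]] := IH (qhead a) erefl; first by move=> z; apply: ne; rewrite z mul0mx.
  by exists y, (pcons (mkarr a) q); rewrite /= eq.
by rewrite -mulmxA pd_act_in0 ?mulmx0.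
Qed.

(** Compatibility writes an element of I through paths that are not images from the shape, and those
    act as zero since a path acting nontrivially lifts. *)
Lemma in_mod_pushdown (F : qshape Q) (M : qmod k (dom F)) :
  compatible I F -> in_mod I (pushdown (wrap F) M).
Proof.
move=> cF x' y' f /cF[n [c [p [im ->]]]]; rewrite kact_sum big1 // => i _.
rewrite kactZ kact_of; suff -> : pact (pushdown (wrap F) M) (p i) = 0 by rewrite scaler0.
apply: pd_extr => x e; rewrite mul0mx; apply/eqP/negP => /negP/eqP ne.
have [y [q eq]] := pact_pushdown_in (wrap_strict F) e ne.
case: x' / e f p im ne eq => f p im ne eq.
case: (im i).
(* The endpoint is read off the list of arrows, the only data that q and the path of Q are known to
   share. *)
have ey : mor0 (wrap F) y = y'.
  have E : forall x1 y1 (r : qpath x1 y1), last x1 [seq qhead a | a <- path_arrows r] = y1.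
    move=> Q' x1 y1 r; elim: r => //= {x1 y1} x1 y1 z1 a r IH.
    by rewrite arr_head.
  by rewrite -(E _ _ _ (path_map (wrap F) q)) eq E.
case: y' / ey f p im ne eq => f p im ne eq.
have -> : p i = path_map (wrap F) q.
  by apply: (pcan_inj (@path_arrowsK Q _ _)).
exact: PathImage.
Qed.

Lemma compatible_comp (F' F : qshape Q) (H : qmor (dom F') (dom F)) :
  is_comp (wrap F') (wrap F) H -> compatible I F -> compatible I F'.
Proof.
move=> [c0 c1] cF x y f /cF[n [c [p [im ->]]]]; exists n, c, p; split=> // i pim.
apply: (im i); case: pim => {x y f c p im i} x y q.
have E : path_arrows (path_map (wrap F') q) = path_arrows (path_map (wrap F) (path_map H q)).
  by elim: q => //= {x y} x y z a q ->; rewrite c1.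
move: (path_map (wrap F') q) E; rewrite !c0 => r E.
have -> : r = path_map (wrap F) (path_map H q) by apply: (pcan_inj (@path_arrowsK Q _ _)).
exact: PathImage.
Qed.

End Compatibility.

(** * Rigid wrappings *)

Section Rigid.
Variables (P Q : quiver) (G : qmor P Q).

(** How nonzero blocks of an endomorphism spread when arrows act invertibly: from (y, x) to the
    tails along each arrow into x and to the heads along each arrow out of y, where the other copy
    must have a matching arrow. *)
Definition simulation (E : Q0 P -> Q0 P -> Prop) : Prop := forall y x, E y x ->
  [/\ mor0 G y = mor0 G x,
      forall a, qhead a = x -> exists b,
        [/\ mor1 G b = mor1 G a, qhead b = y & E (qtail b) (qtail a)]
    & forall b, qtail b = y -> exists a,
        [/\ mor1 G a = mor1 G b, qtail a = x & E (qhead b) (qhead a)]].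

(* A nonzero block at (y, x) of an endomorphism of a push-down forces
   [simulates y x], see [block_simulates]. *)
Definition simulates (y x : Q0 P) : Prop := exists2 E, simulation E & E y x.

Definition rigid : Prop := forall y x, simulates y x -> simulates x y -> y = x.

Lemma simulatesP : simulation simulates.
Proof.
move=> y x [E sE Eyx]; have [e h t] := sE _ _ Eyx; split=> // a ea.
  by have [b [Gb hb Eb]] := h _ ea; exists b; split=> //; exists E.
by have [b [Gb hb Eb]] := t _ ea; exists b; split=> //; exists E.
Qed.

Lemma simulates_refl x : simulates x x.
Proof.
exists (fun y x => y = x) => // {}x _ <-.
by split=> // a e; exists a.
Qed.

Lemma simulates_trans y x z : simulates x y -> simulates y z -> simulates x z.
Proof.
move=> sxy syz; exists (fun x z => exists2 y, simulates x y & simulates y z); last by exists y.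
move=> {sxy syz y}x {}z [y /simulatesP[e h t] /simulatesP[e' h' t']].
split=> [|a ea|b eb]; first by rewrite e.
  have [b [Gb hb Eb]] := h' _ ea; have [c [Gc hc Ec]] := h _ hb.
  by exists c; split=> //; [rewrite Gc | exists (qtail b)].
have [a [Ga ha Ea]] := t _ eb; have [c [Gc hc Ec]] := t' _ ha.
by exists c; split=> //; [rewrite Gc | exists (qhead a)].
Qed.

End Rigid.

(** * Block triangularity of endomorphisms of push-downs *)

Section Triangular.
Variables (k : fieldType) (P Q : quiver) (G : qmor P Q) (sG : strict_wrapping G).
Implicit Types M : qmod k P.

Definition arrows_invertible (R : quiver) (M : qmod k R) : Prop := forall a,
  exists B, arr_act M (mkarr a) *m B = 1%:M /\ B *m arr_act M (mkarr a) = 1%:M.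

Definition block M x' (A : 'M[k]_(mdim (pushdown G M) x')) y x : 'M[k]_(mdim M y, mdim M x) :=
  pdout G M y x' *m A *m pdin G M x x'.

Lemma block_mul M x' (A B : 'M[k]_(mdim (pushdown G M) x')) y x :
  block (A *m B) y x = \sum_z block A y z *m block B z x.
Proof.
rewrite /block -{1}[A]mulmx1 -(pd_partition G M) mulmx_sumr mulmx_suml mulmx_sumr mulmx_suml.
by apply: eq_bigr => z _; rewrite !mulmxA.
Qed.

Section Endo.
Variables (M : qmod k P) (f : fam (pushdown G M) (pushdown G M)).
Hypothesis hf : qhom f.

Lemma block_arrow a b : mor1 G b = mor1 G a ->
  block (f (mor0 G (qhead a))) (qhead b) (qhead a) *m arr_act M (mkarr a) =
  arr_act M (mkarr b) *m block (f (mor0 G (qtail a))) (qtail b) (qtail a).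
Proof.
move=> Gba; rewrite /block -mulmxA -(@pd_act_in _ _ _ _ sG _ _ _ (mkarr a) _ _ (arr_map G (mkarr a))) //.
rewrite mulmxA -(mulmxA (pdout _ _ _ _)) hf !mulmxA.
by rewrite (@pd_out_act _ _ _ _ sG _ _ _ (mkarr b)).
Qed.

Lemma block_head0 a y : (forall b, mor1 G b = mor1 G a -> qhead b <> y) ->
  block (f (mor0 G (qhead a))) y (qhead a) *m arr_act M (mkarr a) = 0.
Proof.
move=> no; rewrite /block -mulmxA -(@pd_act_in _ _ _ _ sG _ _ _ (mkarr a) _ _ (arr_map G (mkarr a))) //.
by rewrite mulmxA -(mulmxA (pdout _ _ _ _)) hf !mulmxA pd_out_act0 ?mul0mx.
Qed.

Lemma block_tail0 b x : (forall a, mor1 G a = mor1 G b -> qtail a <> x) ->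
  arr_act M (mkarr b) *m block (f (mor0 G (qtail b))) (qtail b) x = 0.
Proof.
move=> no; rewrite /block !mulmxA.
rewrite -(@pd_out_act _ _ _ _ sG _ _ _ (mkarr b) _ _ (arr_map G (mkarr b))) //.
by rewrite -(mulmxA (pdout _ _ _ _)) -hf -!mulmxA pd_act_in0 ?mulmx0.
Qed.

Hypothesis iM : arrows_invertible M.

(** If the required matching arrow were missing, or the neighbouring block zero, then commutation
    with the arrow would make the block times an invertible matrix vanish. *)
Lemma block_simulates y x : mor0 G y = mor0 G x -> block (f (mor0 G x)) y x <> 0 ->
  simulates G y x.
Proof.
move=> e nz; exists (fun y x => mor0 G y = mor0 G x /\ block (f (mor0 G x)) y x <> 0) => //.
move=> {}y {}x {e nz} [e nz]; split=> // [a ea | b eb].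
  case: x / ea e nz => e nz; apply: NNPP => no; apply: nz.
  have [B [aB Ba]] := iM a.
  suff z : block (f (mor0 G (qhead a))) y (qhead a) *m arr_act M (mkarr a) = 0.
    by rewrite -[LHS]mulmx1 -aB mulmxA z mul0mx.
  have [[b [Gb hb]]|nob] := classic (exists b, mor1 G b = mor1 G a /\ qhead b = y); last first.
    by apply: block_head0 => b Gb hb; apply: nob; exists b.
  case: y / hb e no => e no; rewrite block_arrow //.
  have -> : block (f (mor0 G (qtail a))) (qtail b) (qtail a) = 0; last by rewrite mulmx0.
  apply: NNPP => nz; apply: no; exists b; split=> //; split=> //.
  by rewrite -!mor_tail Gb.
case: y / eb e nz => e nz; apply: NNPP => no; apply: nz.
have [B [bB Bb]] := iM b; rewrite -e.
suff z : arr_act M (mkarr b) *m block (f (mor0 G (qtail b))) (qtail b) x = 0.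
  by rewrite -[LHS]mul1mx -Bb -mulmxA z mulmx0.
have [[a [Ga ta]]|noa] := classic (exists a, mor1 G a = mor1 G b /\ qtail a = x); last first.
  by apply: block_tail0 => a Ga ta; apply: noa; exists a.
case: x / ta e no => e no; rewrite e -block_arrow //.
have -> : block (f (mor0 G (qhead a))) (qhead b) (qhead a) = 0; last by rewrite mul0mx.
apply: NNPP => nz; apply: no; exists a; split=> //; split=> //.
by rewrite -!mor_head Ga.
Qed.

Hypothesis rG : rigid G.

(* Since f is triangular for the order [simulates], it is nilpotent when its diagonal
   blocks vanish. *)
Lemma zero_diagonal_fixed x' p (W : 'M[k]_(_, p)) :
  (forall x, block (f (mor0 G x)) x x = 0) -> f x' *m W = W -> W = 0.
Proof.
move=> d0 fW; pose r : rel (Q0 P) := fun y x =>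
  (mor0 G y == mor0 G x) && (block (f (mor0 G x)) y x != 0).
have rs y x : r y x -> simulates G y x.
  by move=> /andP[/eqP e /eqP nz]; apply: block_simulates.
have cs y x : connect r y x -> simulates G y x.
  move=> /connectP[s]; elim: s y => [|z s IH] y /=; first by move=> _ ->; apply: simulates_refl.
  by move=> /andP[/rs s1 ps] el; apply: simulates_trans s1 (IH _ ps el).
apply: pd_extl => y ey; rewrite mulmx0.
(* Induction on the number of vertices reachable from y through nonzero blocks. A z with nonzero
   block (y, z) reaches fewer: if it reached y again, rigidity would give z = y, where the block is
   zero. *)
have [N] := ubnP #|connect r y|; elim: N y ey => // N IH y ey; rewrite ltnS => leN.
rewrite -fW -[f x']mulmx1 -(pd_partition G M) !mulmx_sumr mulmx_suml mulmx_sumr.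
apply: big1 => z _; have [ez|/eqP ne] := eqVneq (mor0 G z) x'; last first.
  by rewrite pdin0 // mul0mx mulmx0 mul0mx mulmx0.
transitivity (block (f x') y z *m (pdout G M z x' *m W)); first by rewrite /block !mulmxA.
case: (eqVneq (block (f x') y z) 0) => [-> | nz]; first by rewrite mul0mx.
have ryz : r y z by rewrite /r ez ey eqxx.
rewrite (IH z ez) ?mulmx0 //; apply: leq_trans leN; apply: proper_card.
apply/properP; split.
  apply/subsetP => w; exact: connect_trans (connect1 ryz).
exists y; first exact: connect0.
apply/negP => czy; have szy := cs _ _ czy.
have e := rG (rs _ _ ryz) szy; move: nz; rewrite -e -ey d0 eqxx //.
Qed.

End Endo.

Lemma block_id M x x' : mor0 G x = x' -> block (1%:M : 'M_(mdim (pushdown G M) x')) x x = 1%:M.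
Proof. by move=> e; rewrite /block mulmx1 pdoutK. Qed.

(** 1 - g f has zero diagonal blocks and fixes every vector killed by g f; hence g f is injective,
    so invertible, and can be divided out. *)
Lemma rigid_retract M (N : qmod k Q) (f : fam (pushdown G M) N) (g : fam N (pushdown G M)) :
  arrows_invertible M -> rigid G -> qhom f -> qhom g ->
  (forall x, block (g (mor0 G x) *m f (mor0 G x)) x x = 1%:M) -> retract (pushdown G M) N.
Proof.
move=> iM rG hf hg d1; have hh := hom_comp hf hg.
have hn := hom_sub (@hom_id _ _ (pushdown G M)) hh.
have u x' : g x' *m f x' \in unitmx.
  (* [kermx] is a left kernel, whereas vectors are columns here; hence the transposes. *)
  rewrite -unitmx_tr -row_free_unit -kermx_eq0; apply/eqP/trmx_inj; rewrite trmx0.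
  apply: (zero_diagonal_fixed hn) => // [x|].
    by rewrite /block mulmxBr mulmxBl -!/(block _ _ _) block_id // d1 subrr.
  rewrite mulmxBl mul1mx; apply/eqP; rewrite subr_eq addrC -subr_eq subrr eq_sym; apply/eqP.
  by apply: trmx_inj; rewrite trmx_mul trmxK mulmx_ker trmx0.
exists f, (fun x => invmx (g x *m f x) *m g x); split=> //.
  exact: hom_comp hg (hom_invmx hh u).
by move=> x; rewrite -mulmxA mulVmx.
Qed.

(** For z different from x, rigidity makes one of the blocks (x, z) and (z, x) vanish, so the
    diagonal blocks of E form an idempotent endomorphism of M. It is 0 or 1, and then E or 1 - E has
    zero diagonal and fixes its own columns. *)
Lemma rigid_idem_trivial M : arrows_invertible M -> rigid G -> idem_trivial M ->
  idem_trivial (pushdown G M).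
Proof.
move=> iM rG HM E hE EE.
pose D x := block (E (mor0 G x)) x x.
have hD : @qhom _ _ M M D by apply: qhomP => a; apply: block_arrow.
case: (HM D hD) => [x|z|z].
- rewrite /D -[in RHS](EE (mor0 G x)) block_mul (bigD1 x) //= big1 ?addr0 // => z /eqP ne.
  have [e|/eqP ne'] := eqVneq (mor0 G z) (mor0 G x); last first.
    by rewrite /block pdin0 // mulmx0 mul0mx.
  have [->|/eqP n1] := eqVneq (block (E (mor0 G x)) x z) 0; first by rewrite mul0mx.
  have [->|/eqP n2] := eqVneq (block (E (mor0 G x)) z x) 0; first by rewrite mulmx0.
  case: ne; apply: rG; first exact: block_simulates hE _ _ _ _ _.
  by apply: (block_simulates hE) => //; rewrite e.
- by left=> x'; apply: (zero_diagonal_fixed hE).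
right=> x'; apply/eqP; rewrite eq_sym -subr_eq0; apply/eqP.
apply: (zero_diagonal_fixed (hom_sub (@hom_id _ _ (pushdown G M)) hE)) => // [x|].
  by rewrite /block mulmxBr mulmxBl -!/(block _ _ _) block_id // -/(D x) z subrr.
by rewrite mulmxBl mul1mx mulmxBr mulmx1 EE subrr subr0.
Qed.

Lemma pushdown_nonzero M : ~ qzero M -> ~ qzero (pushdown G M).
Proof.
move=> nz z; apply: nz => x; apply: (@one_dim0 k).
by rewrite -(pdoutK M (erefl (mor0 G x))) (mx_dim0 (pdin _ _ _ _) 0) ?mulmx0 //; left.
Qed.

Lemma rigid_indecomposable M : arrows_invertible M -> rigid G -> indecomposable M ->
  indecomposable (pushdown G M).
Proof.
move=> iM rG /indecomposableP[nz H]; apply/indecomposableP; split.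
  exact: pushdown_nonzero.
exact: rigid_idem_trivial.
Qed.

End Triangular.

(** * Rigidity of linear shapes and of cyclic shapes without automorphisms *)

Section RigidShapes.
Variables (P Q : quiver) (G : qmor P Q) (sG : strict_wrapping G).

Definition qend (R : quiver) (d : bool) (a : Q1 R) := if d then qtail a else qhead a.

Lemma joinsP (R : quiver) (a : Q1 R) x y : joins a x y ->
  exists2 d, qend d a = x & qend (~~ d) a = y.
Proof. by case=> -[<- <-]; [exists true | exists false]. Qed.

Definition bisimilar y x : Prop := simulates G y x /\ simulates G x y.

(** The matching arrows given by the two simulations coincide by strictness, so the far ends are
    bisimilar again. Distinct ends stay distinct, since two lifts of one arrow that share an end are
    equal. *)
Lemma bisimilar_step y x d a : bisimilar y x -> qend d a = x -> exists b,
  [/\ mor1 G b = mor1 G a, qend d b = y, bisimilar (qend (~~ d) b) (qend (~~ d) a)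
    & y <> x -> qend (~~ d) b <> qend (~~ d) a].
Proof.
move=> [/simulatesP[_ h t] /simulatesP[_ h' t']]; case: d => /= e.
  have [b [Gb tb s]] := t' _ e; exists b; split=> //.
    split=> //; have [c [Gc tc s']] := t _ tb.
    by rewrite -(strict_tail_inj sG (etrans Gc Gb) (etrans tc (esym e))).
  move=> ne hba; apply: ne; rewrite -tb -e; congr qtail.
  exact: (strict_head_inj sG).
have [b [Gb hb s]] := h _ e; exists b; split=> //.
  split=> //; have [c [Gc hc s']] := h' _ hb.
  by rewrite -(strict_head_inj sG (etrans Gc Gb) (etrans hc (esym e))).
move=> ne hba; apply: ne; rewrite -hb -e; congr qhead.
exact: (strict_tail_inj sG).
Qed.

(** Match the edge from i to i + 1 with an edge at j > i. It leads to j + 1, or back to j - 1; in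
    both cases i has grown and the induction applies, unless the pair has closed up. Then the far
    ends agree, or the edge is matched with itself reversed, and both are impossible. *)
Lemma linear_rigid : linear_quiver P -> rigid G.
Proof.
move=> [n [v [e [bv be je]]]].
have vI : injective v by apply: bij_inj.
suff H (i j : 'I_n.+1) : (i < j)%N -> bisimilar (v j) (v i) -> False.
  move=> y x sy sx; have [w vw wv] := bv; rewrite -(wv y) -(wv x); congr v.
  apply/val_inj; have [lt|lt|//] := ltngtP (val (w y)) (val (w x)).
    by case: (H _ _ lt); rewrite !wv.
  by case: (H _ _ lt); rewrite !wv.
have [N] := ubnP (n - i)%N; elim: N i j => // N IH i j leN ltij bij.
have lti : (i < n)%N by apply: leq_trans ltij _; rewrite -ltnS.
have [d d1 d2] := joinsP (je (Ordinal lti)).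
have vi : v i = qend d (e (Ordinal lti)) by rewrite d1; congr v; apply: val_inj.
rewrite vi in bij; have [b [Gb eb sb nb]] := bisimilar_step bij erefl.
have {nb} nb : qend (~~ d) b <> qend (~~ d) (e (Ordinal lti)).
  by apply: nb; rewrite -vi => /vI ji; rewrite ji ltnn in ltij.
rewrite d2 in sb nb; have [e' ee' e'e] := be; rewrite -(e'e b) in Gb eb sb nb.
move: (e' b) Gb eb sb nb => q Gb eb sb nb.
have [dq q1 q2] := joinsP (je q).
have ltN : (n - i.+1 < N)%N by move: leN; rewrite ltnS; apply: leq_trans; rewrite ltn_sub2l.
have [edq|ndq] := eqVneq dq d.
  rewrite edq in q1 q2; rewrite q2 in sb.
  have jq : val j = q by move: q1; rewrite eb => /vI ->.
  by apply: (IH _ _ _ _ sb); rewrite /= /bump //= ?add1n // ltnS -jq.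
have {ndq} edq : dq = ~~ d by case: (dq) (d) ndq => [] [].
rewrite edq ?negbK in q1 q2; rewrite q1 in sb nb.
have jq : val j = q.+1 by move: q2; rewrite eb => /vI ->; rewrite /= /bump add1n.
have [lt|lt|eq] := ltngtP i.+1 (val q).
- by apply: (IH _ _ _ _ sb).
- have qi : q = Ordinal lti.
    by apply: val_inj; apply/eqP; rewrite eqn_leq -ltnS lt -ltnS -jq.
  by move: ltij eb; rewrite qi d1 => lt' /vI /(congr1 val) /= E; rewrite -E ltnn in lt'.
- by apply: nb; congr v; apply: val_inj.
Qed.

End RigidShapes.

Section CyclicQuivers.

(** The cycle unrolled to a periodic walk indexed by nat, so that rotations are additions and laps
    around the cycle need no wrapping. *)
Record cyclic_walk (Z : quiver) (n : nat) := CyclicWalk {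
  cw_vertex : nat -> Q0 Z;
  cw_edge : nat -> Q1 Z;
  cw_joins : forall i, joins (cw_edge i) (cw_vertex i) (cw_vertex i.+1);
  cw_vertexE : forall i j, cw_vertex i = cw_vertex j <-> i = j %[mod n.+1];
  cw_edgeE : forall i j, cw_edge i = cw_edge j <-> i = j %[mod n.+1];
  cw_vertex_onto : forall x, exists2 i, (i < n.+1)%N & x = cw_vertex i;
  cw_edge_onto : forall a, exists2 i, (i < n.+1)%N & a = cw_edge i }.

Lemma cyclic_quiver_walk Z : cyclic_quiver Z -> exists n, inhabited (cyclic_walk Z n).
Proof.
move=> [n [v [e [bv be je]]]]; exists n.
have E i j : inZp i = inZp j :> 'I_n.+1 <-> i = j %[mod n.+1].
  split=> [/(congr1 val) //|ij]; exact: val_inj.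
split; refine (@CyclicWalk Z n (fun i => v (inZp i)) (fun i => e (inZp i)) _ _ _ _ _).
- move=> i; have := je (inZp i); suff -> : ordS (inZp i) = inZp i.+1 :> 'I_n.+1 by [].
  by apply: val_inj; rewrite /= -addn1 modnDml addn1.
- by move=> i j; rewrite -E; split=> [/(bij_inj bv)|->].
- by move=> i j; rewrite -E; split=> [/(bij_inj be)|->].
- move=> x; have [w vw wv] := bv; exists (w x) => //.
  by rewrite -[LHS]wv; congr v; apply: val_inj; rewrite /= modn_small.
- move=> x; have [w vw wv] := be; exists (w x) => //.
  by rewrite -[LHS]wv; congr e; apply: val_inj; rewrite /= modn_small.
Qed.

Lemma modn_addn_cancel n i j d : i + d = j + d %[mod n] -> i = j %[mod n].
Proof. by move/eqP; rewrite eqn_modDr => /eqP. Qed.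

(** Induction on the shift d between two distinct bisimilar vertices. A matched edge that runs
    backwards reduces d to d - 2, or gives an immediate contradiction for d at most 2. Otherwise
    rotation by d is an automorphism of the shape that moves V i. *)
Lemma cyclic_rigid Q (G : qshape Q) : cyclic_shape G -> rigid (wrap G).
Proof.
case: G => Z G sG [cZ] /=; rewrite /trivial_aut /= => aut.
have [n [[V Ed Jo VE EE Vs Es]]] := cyclic_quiver_walk cZ.
have modS i j : i = j %[mod n.+1] -> i.+1 = j.+1 %[mod n.+1].
  by move=> e; rewrite -[i.+1]addn1 -[j.+1]addn1 -modnDml e modnDml.
suff H d i : bisimilar G (V (i + d)%N) (V i) -> V (i + d)%N <> V i -> False.
  move=> y x sy sx; have [i _ ex] := Vs x; have [j _ ey] := Vs y; apply: NNPP => ne.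
  move: sy sx ne; rewrite {}ex {}ey => sy sx ne.
  have [le|lt] := leqP i j.
    by apply: (H (j - i)%N i); rewrite subnKC.
  by apply: (H (i - j)%N j); rewrite subnKC 1?ltnW // => e; apply: ne.
have [N] := ubnP d; elim: N d i => // N IH d i; rewrite ltnS => leN.
(* A minimal shift between bisimilar vertices propagates around the cycle. *)
have step i1 : bisimilar G (V (i1 + d)%N) (V i1) -> V (i1 + d)%N <> V i1 ->
    [/\ bisimilar G (V (i1.+1 + d)%N) (V i1.+1), V (i1.+1 + d)%N <> V i1.+1,
        mor1 G (Ed (i1 + d)%N) = mor1 G (Ed i1)
      & exists dir, [/\ qend dir (Ed i1) = V i1, qend (~~ dir) (Ed i1) = V i1.+1,
          qend dir (Ed (i1 + d)%N) = V (i1 + d)%N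
        & qend (~~ dir) (Ed (i1 + d)%N) = V (i1.+1 + d)%N]].
  move=> b0 ne; have [dir d1 d2] := joinsP (Jo i1).
  have [b [Gb eb sb nb]] := bisimilar_step sG b0 d1.
  have {}nb := nb ne; rewrite d2 in sb nb.
  have [q _ eq] := Es b; have [dq q1 q2] := joinsP (Jo q).
  have [edq|ndq] := eqVneq dq dir.
    rewrite edq -?eq in q1 q2.
    have qi : q = i1 + d %[mod n.+1] by apply/VE; rewrite -eb q1.
    have eV : V q.+1 = V (i1.+1 + d)%N by apply/VE; rewrite addSn; apply: modS.
    have eb' : b = Ed (i1 + d)%N by rewrite eq; apply/EE.
    rewrite q2 eV in sb nb; rewrite -eb'; split=> //; exists dir; split=> //.
    by rewrite q2.
  have {ndq} edq : dq = ~~ dir by case: (dq) (dir) ndq => [] [].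
  rewrite edq ?negbK -?eq in q1 q2; rewrite q1 in sb nb.
  have qi : q.+1 = i1 + d %[mod n.+1] by apply/VE; rewrite -eb q2.
  case: d IH leN b0 ne sb nb qi eb => [|d'] IH leN b0 ne sb nb qi eb.
    by case: ne; rewrite addn0.
  have {qi} qi : q = i1 + d' %[mod n.+1].
    by apply: (@modn_addn_cancel _ _ _ 1); rewrite !addn1 -addnS.
  have eV : V q = V (i1 + d')%N by apply/VE.
  rewrite eV in sb nb; exfalso; case: d' IH leN b0 ne sb nb qi eb eV => [|[|d']] IH leN b0 ne sb nb qi eb eV.
  - apply: ne; rewrite -eb; have -> : b = Ed i1 by rewrite eq; apply/EE; rewrite addn0 in qi.
    by [].
  - by apply: nb; rewrite addn1.
  - apply: (IH d'.+1 i1.+1); rewrite ?addSnnS //; apply: leq_trans leN.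
    by rewrite !ltnS leqnSn.
move=> b0 ne.
have all t : bisimilar G (V (i + t + d)%N) (V (i + t)%N) /\ V (i + t + d)%N <> V (i + t)%N.
  elim: t => [|t [bt nt]]; first by rewrite addn0.
  by have [b' n' _ _] := step _ bt nt; rewrite addnS.
(* A position beyond i congruent to m modulo n + 1: the facts in [all] are available only from i
   onwards. *)
pose pos m := (i + (m + i * n))%N.
have posE m : pos m = m %[mod n.+1].
  by rewrite /pos addnCA -mulnS addnC modnMDl.
have VP m : V (pos m) = V m by apply/VE.
have VPd m : V (pos m + d)%N = V (m + d)%N by apply/VE; rewrite -modnDml posE modnDml.
have EP m : Ed (pos m) = Ed m by apply/EE.
have EPd m : Ed (pos m + d)%N = Ed (m + d)%N by apply/EE; rewrite -modnDml posE modnDml.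
have facts m : [/\ bisimilar G (V (m + d)%N) (V m), mor1 G (Ed (m + d)%N) = mor1 G (Ed m)
    & exists dir, [/\ qend dir (Ed m) = V m, qend (~~ dir) (Ed m) = V m.+1,
        qend dir (Ed (m + d)%N) = V (m + d)%N
      & qend (~~ dir) (Ed (m + d)%N) = V (m.+1 + d)%N]].
  have [bm nm] := all (m + i * n)%N; have [_ _ Gm [dir [e1 e2 e3 e4]]] := step _ bm nm.
  rewrite -/(pos m) VP VPd ?EP ?EPd in bm Gm e1 e2 e3 e4; split=> //.
  exists dir; split=> //.
    by rewrite e2; apply/VE/modS.
  by rewrite e4; apply/VE; rewrite !addSn; apply: modS; apply/VE.
have [vi viP] : exists vi : Q0 Z -> nat, forall x, x = V (vi x).
  by apply: (fin_all_exists (P := fun x j => x = V j)) => x; have [j _ ->] := Vs x; exists j.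
have [ei eiP] : exists ei : Q1 Z -> nat, forall a, a = Ed (ei a).
  by apply: (fin_all_exists (P := fun a j => a = Ed j)) => x; have [j _ ->] := Es x; exists j.
pose s0 x := V (vi x + d)%N; pose s1 a := Ed (ei a + d)%N.
have s0V m : s0 (V m) = V (m + d)%N.
  apply/VE; rewrite -modnDml -[RHS]modnDml; congr ((_ + d) %% _)%N.
  by apply/VE; rewrite -viP.
have s1E m : s1 (Ed m) = Ed (m + d)%N.
  apply/EE; rewrite -modnDml -[RHS]modnDml; congr ((_ + d) %% _)%N.
  by apply/EE; rewrite -eiP.
have st a : qtail (s1 a) = s0 (qtail a).
  have [m _ ->] := Es a; rewrite s1E; have [_ _ [[] /= [e1 e2 e3 e4]]] := facts m.
    by rewrite e1 e3 s0V.
  by rewrite e2 e4 s0V.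
have sh a : qhead (s1 a) = s0 (qhead a).
  have [m _ ->] := Es a; rewrite s1E; have [_ _ [[] /= [e1 e2 e3 e4]]] := facts m.
    by rewrite e2 e4 s0V.
  by rewrite e1 e3 s0V.
have i0 : injective s0.
  move=> x y; have [p _ ->] := Vs x; have [q _ ->] := Vs y; rewrite !s0V => /VE e.
  by apply/VE/(modn_addn_cancel e).
have i1 : injective s1.
  move=> x y; have [p _ ->] := Es x; have [q _ ->] := Es y; rewrite !s1E => /EE e.
  by apply/EE/(modn_addn_cancel e).
have [|a0 _] := aut (QMor st sh) (injF_bij i0) (injF_bij i1).
  split=> [x|a] /=.
    have [m _ ->] := Vs x; rewrite s0V; have [[/simulatesP[-> _ _] _] _ _] := facts m.
    by [].
  by have [m _ ->] := Es a; rewrite s1E; have [_ -> _] := facts m.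
by have := a0 (V i); rewrite /= s0V.
Qed.

End CyclicQuivers.

(** * Sections along a walk *)

(** The columns annihilated by the left kernel of M form its column space; the rows of 1 - M M^+,
    for the pseudo-inverse M^+, lie in that kernel. *)
Lemma kermx_solve (k : fieldType) m n (M : 'M[k]_(m, n)) (w : 'cV_m) :
  kermx M *m w = 0 -> exists c, w = M *m c.
Proof.
move=> z; exists (pinvmx M *m w); apply/eqP; rewrite -subr_eq0 mulmxA.
rewrite -{1}[w]mul1mx -mulmxBl; have /submxP[D ->] : (1%:M - M *m pinvmx M <= kermx M)%MS.
  by apply/sub_kermxP; rewrite mulmxBl mul1mx mulmxKpV // subrr.
by rewrite -mulmxA z mulmx0.
Qed.

Lemma separate_row (k : fieldType) n p (v : 'rV[k]_n) (T : 'M_(p, n)) : ~~ (v <= T)%MS ->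
  exists2 w : 'cV_n, T *m w = 0 & v *m w != 0.
Proof.
rewrite submxE => nz.
have [j nzj] : exists j, (v *m cokermx T) 0 j != 0.
  apply/existsP; apply: contraR nz; rewrite negb_exists => /forallP z.
  by apply/eqP/rowP => j; rewrite [RHS]mxE; apply/eqP; have := z j; rewrite negbK.
exists (cokermx T *m delta_mx j 0); first by rewrite mulmxA mulmx_coker mul0mx.
apply: contraNneq nzj; rewrite mulmxA -colE => /colP/(_ 0).
by rewrite !mxE => ->.
Qed.

Section Step.
Variable k : fieldType.

(* The image of a row space under [A], or its preimage under [B]. *)
Definition wstep d1 d2 (o : bool) (A : 'M[k]_(d1, d2)) (B : 'M[k]_(d2, d1)) (U : 'M[k]_d1) : 'M[k]_d2 :=
  if o then <<U *m A>>%MS else kermx (B *m cokermx U).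

Lemma wstep_preimage d1 d2 (B : 'M[k]_(d2, d1)) (U : 'M[k]_d1) r (w : 'M_(r, d2)) :
  (w <= kermx (B *m cokermx U))%MS = (w *m B <= U)%MS.
Proof. by rewrite [RHS]submxE -mulmxA; apply/sub_kermxP/eqP. Qed.

Lemma wstepS d1 d2 o (A : 'M[k]_(d1, d2)) B (U W : 'M_d1) :
  (U <= W)%MS -> (wstep o A B U <= wstep o A B W)%MS.
Proof.
rewrite /wstep; case: o => UW; first by rewrite !genmxE submxMr.
by rewrite wstep_preimage; apply: submx_trans UW; rewrite -wstep_preimage.
Qed.

(** Rows v are vectors and columns w functionals. Vectors follow the arrow and functionals are
    pulled back along it, so the pairing v w is the same at both ends. *)
Definition wlink d1 d2 (o : bool) (A : 'M[k]_(d1, d2)) (B : 'M[k]_(d2, d1))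
    (v : 'rV_d1) (w : 'cV_d1) (v' : 'rV_d2) (w' : 'cV_d2) : Prop :=
  if o then v' = v *m A /\ w = A *m w' else v = v' *m B /\ w' = B *m w.

Lemma wlink_pair d1 d2 o (A : 'M[k]_(d1, d2)) B v w v' w' :
  wlink o A B v w v' w' -> v' *m w' = v *m w.
Proof. by rewrite /wlink; case: o => -[-> ->]; rewrite mulmxA. Qed.

(** For an image step, vectors come from S by definition. For a preimage step, a functional
    vanishing on the preimage of T factors through B as a functional that vanishes on T. *)
Lemma wstep_pull d1 d2 o (A : 'M[k]_(d1, d2)) B (S T : 'M_d1) (v' : 'rV_d2) (w' : 'cV_d2) :
  (v' <= wstep o A B S)%MS -> wstep o A B T *m w' = 0 ->
  exists v w, [/\ (v <= S)%MS, T *m w = 0 & wlink o A B v w v' w'].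
Proof.
rewrite /wstep /wlink; case: o => [|].
  rewrite genmxE => /submxP[u ->] z; exists (u *m S), (A *m w'); split.
  - exact: submxMl.
  - have /submxP[D e] : (T *m A <= <<T *m A>>)%MS by rewrite genmxE.
    by rewrite mulmxA e -mulmxA z mulmx0.
  - by rewrite mulmxA.
rewrite wstep_preimage => vS /kermx_solve[c ->].
exists (v' *m B), (cokermx T *m c); split=> //; first by rewrite mulmxA mulmx_coker mul0mx.
by rewrite mulmxA.
Qed.

(** When the step stops separating S from T, a separating pair dies there. For images, a row of S
    outside T can be corrected by an element of T so that A kills it; for preimages, S is not inside
    T + im B, and a functional kills T and im B but not S. *)
Lemma wstep_dichotomy d1 d2 o (A : 'M[k]_(d1, d2)) B (S T : 'M_d1) :
  (T <= S)%MS -> ~~ (S <= T)%MS ->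
  (exists (v : 'rV_d1) (w : 'cV_d1), [/\ (v <= S)%MS, T *m w = 0, v *m w != 0
     & if o then v *m A = 0 else B *m w = 0]) \/
  ~~ (wstep o A B S <= wstep o A B T)%MS.
Proof.
move=> TS nST; have [le|] := boolP (wstep o A B S <= wstep o A B T)%MS; [left | by right].
move: le; rewrite /wstep; case: o => le.
  have /row_subPn[i nv] := nST; rewrite !genmxE in le.
  have /submxP[u e] : (row i S *m A <= T *m A)%MS.
    by apply: submx_trans le; apply: submxMr; apply: row_sub.
  have nv' : ~~ (row i S - u *m T <= T)%MS.
    apply: contra nv => H; rewrite -[row i S](subrK (u *m T)).
    by apply: addmx_sub H _; apply: submxMl.
  have [w Tw vw] := separate_row nv'; exists (row i S - u *m T), w; split=> //.
    apply: addmx_sub; first exact: row_sub.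
    by rewrite eqmx_opp; apply: submx_trans TS; apply: submxMl.
  by rewrite mulmxBl e mulmxA subrr.
have /row_subPn[i nv] : ~~ (S <= T + B)%MS.
  apply: contra nST => /row_subP sub; apply/row_subP => i.
  have /sub_addsmxP[[u1 u2] /= e] := sub i.
  have u2S : (u2 *m B <= S)%MS.
    have -> : u2 *m B = row i S - u1 *m T by rewrite e addrC addKr.
    apply: addmx_sub; first exact: row_sub.
    by rewrite eqmx_opp; apply: submx_trans TS; apply: submxMl.
  rewrite e; apply: addmx_sub; first exact: submxMl.
  by rewrite -wstep_preimage; apply: submx_trans le; rewrite wstep_preimage.
have [w Tw vw] := separate_row nv; exists (row i S), w; split=> //; first exact: row_sub.
  have /submxP[D ->] := addsmxSl T B; by rewrite -mulmxA Tw mulmx0.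
have /submxP[D ->] := addsmxSr T B; by rewrite -mulmxA Tw mulmx0.
Qed.

End Step.

Section Walk.
Variables (k : fieldType) (d : nat -> nat) (o : nat -> bool).
Variables (A : forall i, 'M[k]_(d i, d i.+1)) (B : forall i, 'M[k]_(d i.+1, d i)).

Fixpoint wsub (U : 'M[k]_(d 0)) i : 'M[k]_(d i) :=
  if i is i'.+1 then wstep (o i') (A i') (B i') (wsub U i') else U.

Lemma wsubS U W i : (U <= W)%MS -> (wsub U i <= wsub W i)%MS.
Proof. by move=> UW; elim: i => //= i IH; apply: wstepS. Qed.

Definition wsection b (v : forall i, 'rV[k]_(d i)) (w : forall i, 'cV[k]_(d i)) : Prop :=
  forall i, (i < b)%N -> wlink (o i) (A i) (B i) (v i) (w i) (v i.+1) (w i.+1).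

Lemma wsection_pair b v w i : wsection b v w -> (i <= b)%N -> v i *m w i = v 0 *m w 0.
Proof.
move=> sec; elim: i => [|i IH] lt; first by [].
by rewrite (wlink_pair (sec i lt)) IH // ltnW.
Qed.

Lemma wsection_pull b S T (v' : 'rV_(d b)) (w' : 'cV_(d b)) :
  (v' <= wsub S b)%MS -> wsub T b *m w' = 0 ->
  exists v w, [/\ wsection b v w, (v 0 <= S)%MS, T *m w 0 = 0, v b = v' & w b = w'].
Proof.
elim: b v' w' => [|b IH] v' w' vS Tw.
  exists (@dfwith nat (fun i => 'rV[k]_(d i)) (fun i => 0) 0%N v'),
    (@dfwith nat (fun i => 'cV[k]_(d i)) (fun i => 0) 0%N w').
  by rewrite !dfwith_in; split=> // i.
have [v1 [w1 [v1S Tw1 lk]]] := wstep_pull vS Tw.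
have [v [w [sec vS0 Tw0 vb wb]]] := IH _ _ v1S Tw1.
exists (@dfwith nat (fun i => 'rV[k]_(d i)) v b.+1 v'),
  (@dfwith nat (fun i => 'cV[k]_(d i)) w b.+1 w').
rewrite !dfwith_in !dfwith_out //; split=> // i; rewrite ltnS leq_eqVlt => /orP[/eqP ->|lt].
  by rewrite !dfwith_in !dfwith_out ?vb ?wb // neq_ltn ltnSn orbT.
have h1 : b.+1 != i by rewrite neq_ltn ltnS (ltnW lt) orbT.
have h2 : b.+1 != i.+1 by rewrite neq_ltn !ltnS lt orbT.
by rewrite !(dfwith_out _ _ h1) !(dfwith_out _ _ h2); apply: sec.
Qed.

(** The edge after position b kills the vector, or the functional, so the string may stop at b. *)
Definition wend b (v : forall i, 'rV[k]_(d i)) (w : forall i, 'cV[k]_(d i)) : Prop :=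
  if o b then v b *m A b = 0 else B b *m w b = 0.

(** At the first step that fails to separate, the dying pair is pulled back to the start, which
    preserves its nonzero pairing. *)
Lemma walk_dichotomy S T c : (T <= S)%MS -> ~~ (S <= T)%MS ->
  (exists b v w, [/\ (b < c)%N, wsection b v w, wend b v w, v 0 *m w 0 != 0
      & (v 0 <= S)%MS /\ T *m w 0 = 0]) \/
  ~~ (wsub S c <= wsub T c)%MS.
Proof.
move=> TS nST; elim: c => [|c [[b [v [w [lt H1 H2 H3 H4]]]] | IH]]; first by right.
  by left; exists b, v, w; split=> //; apply: leqW.
have [[v1 [w1 [v1S Tw1 nz e]]] | H] :=
  wstep_dichotomy (o c) (A c) (B c) (wsubS c TS) IH; last by right.
left; have [v [w [sec vS Tw vc wc]]] := wsection_pull v1S Tw1.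
exists c, v, w; split=> //; last by rewrite -(wsection_pair sec (leqnn c)) vc wc.
by rewrite /wend vc wc.
Qed.

Lemma walk_full S T b : ~~ (wsub S b <= wsub T b)%MS ->
  exists v w, [/\ wsection b v w, v 0 *m w 0 != 0, (v 0 <= S)%MS & T *m w 0 = 0].
Proof.
move=> /row_subPn[i nv]; have [w1 Tw1 nz] := separate_row nv.
have [v [w [sec vS Tw vc wc]]] := wsection_pull (row_sub i (wsub S b)) Tw1.
by exists v, w; split=> //; rewrite -(wsection_pair sec (leqnn b)) vc wc.
Qed.

End Walk.

(** * Strings as retracts *)

Section Strings.
Variables (k : fieldType) (P : quiver).
Implicit Types M : qmod k P.

Lemma chi_invertible (L : quiver) : arrows_invertible (chi k L).
Proof. by move=> a; exists 1%:M; rewrite mul1mx. Qed.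

(** f is a section and g a cosection along H. Where H meets a vertex of P repeatedly, the composite
    of the induced morphisms may have nonzero off-diagonal blocks; [rigid_retract] asks only about
    the diagonal ones. *)
Lemma string_retract (L : quiver) (H : qmor L P) M
    (f : forall i, 'M[k]_(mdim M (mor0 H i), 1)) (g : forall i, 'M[k]_(1, mdim M (mor0 H i))) :
  linear_quiver L -> strict_wrapping H ->
  (forall a, f (qhead a) = arr_act M (arr_map H (mkarr a)) *m f (qtail a)) ->
  (forall a, g (qhead a) *m arr_act M (arr_map H (mkarr a)) = g (qtail a)) ->
  (forall x y' (a' : arr (mor0 H x) y'),
    (forall a, mor1 H a = val a' -> qtail a <> x) -> arr_act M a' *m f x = 0) ->
  (forall y x' (a' : arr x' (mor0 H y)),
    (forall a, mor1 H a = val a' -> qhead a <> y) -> g y *m arr_act M a' = 0) ->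
  (forall i, g i *m f i = 1%:M) ->
  retract (pushdown H (chi k L)) M.
Proof.
move=> lin sH f1 g1 f0 g0 gf; apply: (@rigid_retract _ _ _ _ sH (chi k L) M
  (@pd_desc _ _ _ _ (chi k L) M f) (@pd_asc _ _ _ _ (chi k L) M g)).
- exact: chi_invertible.
- exact: linear_rigid.
- by apply: pd_desc_hom => // a; rewrite mulmx1 f1.
- by apply: pd_asc_hom => // a; rewrite mul1mx g1.
by move=> i; rewrite /block mulmxA -mulmxA pd_desc_in pd_out_asc gf.
Qed.

Definition walk_tail (b : nat) (o : nat -> bool) (i : 'I_b) : 'I_b.+1 :=
  if o i then widen_ord (leqnSn b) i else lift ord0 i.
(** Reversing all orientations exchanges tails and heads, so one function serves for both maps. *)
Definition walk_quiver (b : nat) (o : nat -> bool) : quiver :=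
  @Quiver 'I_b.+1 'I_b (walk_tail o) (walk_tail (fun i => ~~ o i)).

Lemma walk_tailE b o (i : 'I_b) : walk_tail o i = (if o i then val i else i.+1) :> nat.
Proof. by rewrite /walk_tail; case: (o i); rewrite //= /bump add1n. Qed.

Lemma walk_quiver_linear b o : linear_quiver (walk_quiver b o).
Proof.
exists b, id, id; split=> [||i]; try by exists id.
rewrite /joins /= /walk_tail; case: (o i); [left | right]; by [].
Qed.

(** The action of an arrow with prescribed endpoints, 0 when it does not have them. This lets walks
    be given by plain functions on nat. *)
Definition xact M (x y : Q0 P) (a : option (Q1 P)) : 'M[k]_(mdim M y, mdim M x) :=
  if obind insub a is Some a' then arr_act M (a' : arr x y) else 0.

Lemma xactE M x y (a : arr x y) : xact M x y (Some (val a)) = arr_act M a.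
Proof. by rewrite /xact /= valK. Qed.

Variables (V : nat -> Q0 P) (E : nat -> option (Q1 P)) (o : nat -> bool).

Definition oriented : Prop := forall i a, E i = Some a ->
  if o i then qtail a = V i /\ qhead a = V i.+1 else qhead a = V i /\ qtail a = V i.+1.

Definition exhausted_at i : Prop :=
  (forall a, qtail a = V i -> (E i = Some a /\ o i) \/
     (exists j, [/\ i = j.+1, E j = Some a & ~~ o j])) /\
  (forall a, qhead a = V i -> (E i = Some a /\ ~~ o i) \/
     (exists j, [/\ i = j.+1, E j = Some a & o j])).

Variable M : qmod k P.

Definition wA i : 'M[k]_(mdim M (V i), mdim M (V i.+1)) := (xact M (V i) (V i.+1) (E i))^T.
Definition wB i : 'M[k]_(mdim M (V i.+1), mdim M (V i)) := (xact M (V i.+1) (V i) (E i))^T.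

(** No edge of the walk precedes its start, so the remaining arrows at [V p] have to be killed there
    through the choice of S and T. *)
Definition start_cond p (S T : 'M[k]_(mdim M (V p))) : Prop :=
  (forall y' (a : arr (V p) y'), ~ (E p = Some (val a) /\ o p) ->
     forall v : 'rV_(mdim M (V p)), (v <= S)%MS -> arr_act M a *m v^T = 0) /\
  (forall x' (a : arr x' (V p)), ~ (E p = Some (val a) /\ ~~ o p) ->
     forall w : 'cV_(mdim M (V p)), T *m w = 0 -> w^T *m arr_act M a = 0).

(** Inner vertices carry only the two neighbouring edges of the walk, the start is covered by
    [start_cond], and the end by [wend] or by the absence of a next edge. Scaling the functionals by
    the inverse of the constant pairing makes the diagonal blocks 1. *)
Lemma walk_string p b S T
    (v : forall i, 'rV[k]_(mdim M (V (i + p)))) (w : forall i, 'cV[k]_(mdim M (V (i + p)))) :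
  oriented ->
  (forall i j a, E i = Some a -> E j = Some a -> o i = o j) ->
  (forall i, (i < b)%N -> E (i + p)%N) ->
  (forall i, (0 < i)%N -> (i <= b)%N -> exhausted_at (i + p)%N) ->
  start_cond S T ->
  @wsection k (fun i => mdim M (V (i + p))) (fun i => o (i + p)%N)
    (fun i => wA (i + p)) (fun i => wB (i + p)) b v w ->
  v 0 *m w 0 != 0 -> (v 0 <= S)%MS -> T *m w 0 = 0 ->
  (E (b + p)%N -> @wend k (fun i => mdim M (V (i + p))) (fun i => o (i + p)%N)
    (fun i => wA (i + p)) (fun i => wB (i + p)) b v w) ->
  exists L (H : qmor L P), [/\ linear_quiver L, strict_wrapping H,
    ((forall i j, (i <= b)%N -> (j <= b)%N -> V (i + p) = V (j + p) -> i = j) -> injective (mor0 H))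
    & retract (pushdown H (chi k L)) M].
Proof.
move=> ori oE Eb exh [st1 st2] sec nz v0S Tw0 en.
have [e eE] : exists e : 'I_b -> Q1 P, forall i : 'I_b, E (i + p)%N = Some (e i).
  apply: (fin_all_exists (P := fun (i : 'I_b) a => E (i + p)%N = Some a)) => i.
  by have := Eb i (ltn_ord i); case: (E _) => // a _; exists a.
pose o' i := o (i + p)%N; pose L := walk_quiver b o'.
have tE (i : 'I_b) : qtail (e i) = V (walk_tail o' i + p)%N.
  by have := ori _ _ (eE i); rewrite walk_tailE /o'; case: (o _) => -[].
have hE (i : 'I_b) : qhead (e i) = V (walk_tail (fun i => ~~ o' i) i + p)%N.
  by have := ori _ _ (eE i); rewrite walk_tailE /o'; case: (o _) => -[].
pose H : qmor L P := @QMor L P (fun i => V (i + p)%N) e tE hE.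
(* A walk that repeats an edge repeats it in the same direction, so the two copies differ in both
   tail and head. *)
have sH : strict_wrapping H.
  apply: strict_wrappingP => i j /= ne eij.
  have oij : o' i = o' j by apply: oE (eE i) _; rewrite eij; apply: eE.
  have ne' : val i <> val j by move=> /val_inj.
  split=> /(congr1 (@nat_of_ord _)); rewrite !walk_tailE oij; case: (o' j) => //=.
    by case.
  by case.
exists L, H; split=> //; first exact: walk_quiver_linear.
  by move=> inj i j /= /inj E'; apply: val_inj; apply: E'; rewrite -ltnS.
have {}en i : i = b -> E (i + p)%N ->
    if o (i + p)%N then v i *m wA (i + p) = 0 else wB (i + p) *m w i = 0.
  by move=> ->; apply: en.
pose c := (v 0 *m w 0) 0 0.
have c0 : c != 0.
  apply: contraNneq nz => z; apply/eqP/matrixP => i j; rewrite !ord1 [RHS]mxE; exact: z.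
have links (i : 'I_b) : wlink (o' i) (wA (i + p)) (wB (i + p)) (v i) (w i) (v i.+1) (w i.+1).
  exact: sec.
have f1 (i : 'I_b) : (v (walk_tail (fun i => ~~ o' i) i))^T =
    arr_act M (arr_map H (mkarr (i : Q1 L))) *m (v (walk_tail o' i))^T.
  rewrite -xactE /= -eE.
  have := links i; move: (nat_of_ord (walk_tail o' i)) (walk_tailE o' i) => tl etl.
  move: (nat_of_ord (walk_tail (fun i => ~~ o' i) i)) (walk_tailE (fun i => ~~ o' i) i) => hd ehd.
  case: (o' i) etl ehd => /= -> ->; rewrite /wlink => -[-> _].
    by rewrite /wA trmx_mul trmxK.
  by rewrite /wB trmx_mul trmxK.
have g1 (i : 'I_b) : (w (walk_tail (fun i => ~~ o' i) i))^T *m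
    arr_act M (arr_map H (mkarr (i : Q1 L))) = (w (walk_tail o' i))^T.
  rewrite -xactE /= -eE.
  have := links i; move: (nat_of_ord (walk_tail o' i)) (walk_tailE o' i) => tl etl.
  move: (nat_of_ord (walk_tail (fun i => ~~ o' i) i)) (walk_tailE (fun i => ~~ o' i) i) => hd ehd.
  case: (o' i) etl ehd => /= -> ->; rewrite /wlink => -[_ ->].
    by rewrite /wA trmx_mul trmxK.
  by rewrite /wB trmx_mul trmxK.
apply: (@string_retract L H M (fun i => (v i)^T) (fun i => c^-1 *: (w i)^T)) => //.
- exact: walk_quiver_linear.
- by move=> i; rewrite -scalemxAl; congr (_ *: _); apply: g1.
- move=> x y' a' no.
  (* An arrow without a lift at x is not the next edge, unless x is the last vertex b. For b = 0 the
     start is also the end, and both criteria are needed. *)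
  have noE : ~ (E (x + p)%N = Some (val a') /\ o' x) \/ x = b :> nat.
    have [lt|] := ltnP x b; [left=> -[Ea ox] | right; apply/eqP; rewrite eqn_leq -ltnS ltn_ord //].
    apply: (no (Ordinal lt)); first by move: (eE (Ordinal lt)); rewrite /= Ea => -[].
    by apply: val_inj; rewrite /= walk_tailE ox.
  have [x0|xpos] := posnP (val x).
    case: x x0 a' no noE => -[] // ltx _ a' no noE.
    case: noE => [noE | b0]; first by apply: (st1 _ a' noE).
    have [[Ea op]|ne] := classic (E p = Some (val a') /\ o p); last by apply: (st1 _ a' ne).
    have := en 0%N b0; rewrite -[(0 + p)%N]/p Ea op => /(_ isT) /(congr1 trmx).
    rewrite trmx_mul trmx0 /wA trmxK Ea.
    move: (ori _ _ Ea); rewrite op => -[_ eh].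
    have := arr_head a'; rewrite eh => ey; case: y' / ey a' Ea {no eh} => a' Ea.
    by rewrite xactE.
  have [ex _] := exh x xpos (ltn_ord x).
  case: (ex (val a') (arr_tail a')) => [[Ea ox] | [j [ej Ea oj]]].
    case: noE => [[]// | xb].
    have := en _ xb; rewrite Ea ox => /(_ isT) /(congr1 trmx).
    rewrite trmx_mul trmx0 /wA trmxK Ea.
    move: (ori _ _ Ea); rewrite ox => -[_ eh].
    have := arr_head a'; rewrite eh => ey; case: y' / ey a' Ea {no ex eh} => a' Ea.
    by rewrite xactE.
  have ltx : (x.-1 < b)%N by rewrite prednK //; rewrite -ltnS.
  exfalso; have ej' : j = (x.-1 + p)%N by apply: succn_inj; rewrite -ej -addSn prednK.
  rewrite ej' in Ea oj.
  apply: (no (Ordinal ltx)); first by move: (eE (Ordinal ltx)); rewrite /= Ea => -[].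
  by apply: val_inj; rewrite /= walk_tailE /o' /= (negPf oj) prednK.
- move=> x y' a' no; rewrite -scalemxAl; apply/eqP; rewrite scaler_eq0; apply/orP; right; apply/eqP.
  have noE : ~ (E (x + p)%N = Some (val a') /\ ~~ o' x) \/ x = b :> nat.
    have [lt|] := ltnP x b; [left=> -[Ea ox] | right; apply/eqP; rewrite eqn_leq -ltnS ltn_ord //].
    apply: (no (Ordinal lt)); first by move: (eE (Ordinal lt)); rewrite /= Ea => -[].
    by apply: val_inj; rewrite /= walk_tailE ox.
  have [x0|xpos] := posnP (val x).
    case: x x0 a' no noE => -[] // ltx _ a' no noE.
    case: noE => [noE | b0]; first by apply: (st2 _ a' noE).
    have [[Ea op]|ne] := classic (E p = Some (val a') /\ ~~ o p); last by apply: (st2 _ a' ne).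
    have := en 0%N b0; rewrite -[(0 + p)%N]/p Ea (negPf op) => /(_ isT) /(congr1 trmx).
    rewrite trmx_mul trmx0 /wB trmxK Ea.
    move: (ori _ _ Ea); rewrite (negPf op) => -[_ eh].
    have := arr_tail a'; rewrite eh => ey; case: y' / ey a' Ea {no eh} => a' Ea.
    by rewrite xactE.
  have [_ ex] := exh x xpos (ltn_ord x).
  case: (ex (val a') (arr_head a')) => [[Ea ox] | [j [ej Ea oj]]].
    case: noE => [[]// | xb].
    have := en _ xb; rewrite Ea (negPf ox) => /(_ isT) /(congr1 trmx).
    rewrite trmx_mul trmx0 /wB trmxK Ea.
    move: (ori _ _ Ea); rewrite (negPf ox) => -[_ eh].
    have := arr_tail a'; rewrite eh => ey; case: y' / ey a' Ea {no ex eh} => a' Ea.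
    by rewrite xactE.
  have ltx : (x.-1 < b)%N by rewrite prednK //; rewrite -ltnS.
  exfalso; have ej' : j = (x.-1 + p)%N by apply: succn_inj; rewrite -ej -addSn prednK.
  rewrite ej' in Ea oj.
  apply: (no (Ordinal ltx)); first by move: (eE (Ordinal ltx)); rewrite /= Ea => -[].
  by apply: val_inj; rewrite /= walk_tailE /o' /= oj prednK.
move=> i; rewrite -scalemxAl -trmx_mul.
have -> : v i *m w i = c%:M.
  rewrite (wsection_pair sec); last by rewrite -ltnS.
  by apply/matrixP => i1 i2; rewrite !ord1 [RHS]mxE eqxx mulr1n.
by rewrite tr_scalar_mx scale_scalar_mx mulVf.
Qed.

End Strings.

(** * Modules over linear and cyclic quivers *)

Definition is_string (k : fieldType) (P : quiver) (c : qmod k P) : Prop :=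
  exists L (H : qmor L P), [/\ linear_quiver L, strict_wrapping H & c = pushdown H (chi k L)].

Definition is_substring (k : fieldType) (P : quiver) (c : qmod k P) : Prop :=
  exists L (H : qmor L P), [/\ linear_quiver L, strict_wrapping H, injective (mor0 H)
    & c = pushdown H (chi k L)].

Lemma chi_nonzero (k : fieldType) (L : quiver) : linear_quiver L -> ~ qzero (chi k L).
Proof. by move=> [n [v _]] z; have := z (v ord0). Qed.

Section LinearQuivers.
Variables (k : fieldType) (L : quiver).

(** [E i] is None from n on, which is how a walk learns that the quiver ends; the vertices [V i]
    beyond n are junk. *)
Lemma linear_walk : linear_quiver L -> exists (n : nat) (V : nat -> Q0 L)
  (E : nat -> option (Q1 L)) (o : nat -> bool),
  [/\ oriented V E o, forall i j a, E i = Some a -> E j = Some a -> i = j,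
      forall i, (E i : bool) = (i < n)%N,
      forall i, (i <= n)%N -> exhausted_at V E o i
    & (forall i j, (i <= n)%N -> (j <= n)%N -> V i = V j -> i = j) /\
      (forall x, exists2 i, (i <= n)%N & x = V i)].
Proof.
move=> [n [v [e [bv be je]]]]; pose V i := v (inord i).
pose E i := omap e (insub i : option 'I_n).
pose o i := if E i is Some a then (qtail a == V i) && (qhead a == V i.+1) else false.
have Ee i a : E i = Some a -> exists2 q : 'I_n, a = e q & i = q.
  by rewrite /E; case: insubP => //= q _ <- [<-]; exists q.
have eE (q : 'I_n) : E q = Some (e q) by rewrite /E valK.
have Vi i j : (i <= n)%N -> (j <= n)%N -> V i = V j -> i = j.
  move=> li lj /(bij_inj bv) /(congr1 val); by rewrite /= !inordK.
have ori : oriented V E o.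
  move=> i a Ea; have [q eq iq] := Ee _ _ Ea; rewrite /o Ea.
  have := je q; rewrite -eq.
  have -> : widen_ord (leqnSn n) q = inord i.
    by apply: val_inj; rewrite /= inordK iq // ltnS ltnW.
  have -> : lift ord0 q = inord i.+1.
    by apply: val_inj; rewrite /= /bump add1n inordK iq // ltnS.
  rewrite -/(V i) -/(V i.+1).
  by case: andP => [[/eqP -> /eqP ->]|no] // [[tx hx]|[tx hx]]; split=> //; case: no; rewrite tx hx !eqxx.
have inc a : exists2 q, E q = Some a & (q < n)%N.
  by have [e' ee' e'e] := be; exists (e' a); rewrite ?eE ?e'e.
exists n, V, E, o; split=> //.
- by move=> i j a /Ee[q -> ->] /Ee[q' /(bij_inj be) -> ->].
- by move=> i; rewrite /E; case: insubP => [q -> _|/negPf ->].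
- move=> i li; split=> a ea; have [q Eq ltq] := inc a.
    have := ori _ _ Eq; case oq: (o q) => -[t h].
      by left; have <- : q = i by [apply: Vi; rewrite ?(ltnW ltq) // -t]; rewrite oq.
    by right; exists q; split=> //; [apply: Vi; rewrite // -h | rewrite oq].
  have := ori _ _ Eq; case oq: (o q) => -[t h].
    by right; exists q; split=> //; apply: Vi; rewrite // -h.
  by left; have <- : q = i by [apply: Vi; rewrite ?(ltnW ltq) // -t]; rewrite oq.
split=> // x; have [w vw wv] := bv; exists (w x); first by rewrite -ltnS.
by rewrite /V inord_val wv.
Qed.

(** Start at the leftmost vertex p of the support, with S everything and T = 0. To the left of p the
    module is zero, so the starting condition holds, and the walk stops either at a kill or at the
    right end of L. *)
Lemma linear_decompose (M : qmod k L) : linear_quiver L -> Add (@is_substring k L) M.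
Proof.
move=> lin; apply: (@Add_decompose _ _ (fun=> True)) => // m _ nz.
suff [L' [H [lin' sH iH r]]] : exists L' (H : qmor L' L),
    [/\ linear_quiver L', strict_wrapping H, injective (mor0 H) & retract (pushdown H (chi k L')) m].
  exists (pushdown H (chi k L')); first by exists L', H.
  by split=> //; apply: pushdown_nonzero; apply: chi_nonzero.
have [n [V [E [o [ori Einj En exh [Vinj Vonto]]]]]] := linear_walk lin.
have ex : exists p, (p <= n)%N && (mdim m (V p) != 0%N).
  apply: NNPP => no; apply: nz => x; have [i le ->] := Vonto x.
  by apply: NNPP => ne; apply: no; exists i; rewrite le; apply/eqP.
case: (ex_minnP ex) => p /andP[lepn nzp] minp.
have zp j : (j < p)%N -> mdim m (V j) = 0%N.
  move=> lt; apply/eqP; apply: contraT => ne.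
  by have := minp j; rewrite ne (leq_trans (ltnW lt) lepn) leqNgt lt => /(_ isT).
pose S : 'M[k]_(mdim m (V p)) := 1%:M; pose T : 'M[k]_(mdim m (V p)) := 0.
have nST : ~~ (S <= T)%MS.
  rewrite submx0; apply: contra nzp => /eqP z.
  by apply/eqP; apply: one_dim0 z.
have st : start_cond E o S T.
  split=> [y' a no v _ | x' a no w _].
    have [H _] := exh p lepn; case: (H _ (arr_tail a)) => // -[j [pj Ej oj]].
    have := ori _ _ Ej; rewrite (negPf oj) arr_head => -[ey _].
    by rewrite (mx_dim0 (arr_act m a) 0) ?mul0mx //; left; rewrite ey zp // pj.
  have [_ H] := exh p lepn; case: (H _ (arr_head a)) => // -[j [pj Ej oj]].
  have := ori _ _ Ej; rewrite oj arr_tail => -[ey _].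
  by rewrite (mx_dim0 (arr_act m a) 0) ?mulmx0 //; right; rewrite ey zp // pj.
have conclude b v w : (b + p <= n)%N ->
    @wsection k (fun i => mdim m (V (i + p))) (fun i => o (i + p)%N)
      (fun i => wA V E m (i + p)) (fun i => wB V E m (i + p)) b v w ->
    v 0 *m w 0 != 0 ->
    (E (b + p)%N -> @wend k (fun i => mdim m (V (i + p))) (fun i => o (i + p)%N)
      (fun i => wA V E m (i + p)) (fun i => wB V E m (i + p)) b v w) ->
    exists L' (H : qmor L' L), [/\ linear_quiver L', strict_wrapping H, injective (mor0 H)
      & retract (pushdown H (chi k L')) m].
  move=> leb sec nz0 en.
  have [|||L' [H [l1 l2 l3 l4]]] :=
    @walk_string k L V E o m p b S T v w ori _ _ _ st sec nz0 (submx1 _) (mul0mx _ _) en.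
  - by move=> i j a Ei Ej; rewrite (Einj _ _ _ Ei Ej).
  - by move=> i lt; rewrite En (leq_trans _ leb) // ltn_add2r.
  - by move=> i _ le; apply: exh; apply: leq_trans leb; rewrite leq_add2r.
  exists L', H; split=> //; apply: l3 => i j li lj /Vinj eij; apply: (@addIn p).
  by apply: eij; apply: leq_trans leb; rewrite leq_add2r.
have := @walk_dichotomy k (fun i => mdim m (V (i + p))) (fun i => o (i + p)%N)
  (fun i => wA V E m (i + p)) (fun i => wB V E m (i + p)) S T (n - p) (sub0mx _ _) nST.
case=> [[b [v [w [lt sec en nz0 _]]]] | /walk_full [v [w [sec nz0 _ _]]]].
  by apply: conclude sec nz0 _ => //; rewrite ltnW // addnC -ltn_subRL.
apply: conclude sec nz0 _; first by rewrite subnK.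
by rewrite En subnK // ltnn.
Qed.

End LinearQuivers.

Section MatrixIso.
Variable k : fieldType.

(** Invertibility for matrices whose two dimensions are not known to be convertible. *)
Definition mx_iso m n (A : 'M[k]_(m, n)) : Prop := exists B, A *m B = 1%:M /\ B *m A = 1%:M.

Lemma mx_isoP m n (A : 'M[k]_(m, n)) : mx_iso A <->
  A *m pinvmx A = 1%:M /\ pinvmx A *m A = 1%:M.
Proof.
split=> [[B [AB BA]] | [AB BA]]; last by exists (pinvmx A).
split; first by apply: mulmxVp; apply/row_freeP; exists B.
by apply: mulVpmx; apply/row_fullP; exists B.
Qed.

Lemma mx_iso_mul m n p (A : 'M[k]_(m, n)) (B : 'M_(n, p)) :
  mx_iso A -> mx_iso B -> mx_iso (A *m B).
Proof.
move=> [A' [e1 e2]] [B' [e3 e4]]; exists (B' *m A'); split.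
  by rewrite mulmxA -(mulmxA A) e3 mulmx1.
by rewrite mulmxA -(mulmxA B') e2 mulmx1.
Qed.

Lemma mx_iso_pinv m n (A : 'M[k]_(m, n)) : mx_iso A -> mx_iso (pinvmx A).
Proof. by move=> /mx_isoP[e1 e2]; exists A. Qed.

Lemma mx_iso1 n : mx_iso (1%:M : 'M[k]_n).
Proof. by exists 1%:M; rewrite mulmx1. Qed.

Lemma mx_iso_rank m n (A : 'M[k]_(m, n)) : row_free A -> row_full A -> mx_iso A.
Proof.
move=> /row_freeP[B AB] /row_fullP[C CA]; exists B; split=> //.
by have -> : B = C by rewrite -[LHS]mul1mx -CA -mulmxA AB mulmx1.
Qed.

Lemma mx_iso_tr m n (A : 'M[k]_(m, n)) : mx_iso A^T -> mx_iso A.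
Proof.
by move=> [B [e1 e2]]; exists B^T; split; apply: trmx_inj; rewrite trmx_mul trmxK trmx1.
Qed.

End MatrixIso.

(** * Modules over cyclic quivers: string summands and monodromy *)

Section CyclicQuivers.
Variables (k : fieldType) (Z : quiver).

(** The module B(V) of the overview; for [laurent_mod mu t] it is convertible with
    [cyc_mod mu t gam], so bands are push-downs of windings. *)
Definition winding (gam : Q1 Z) (W : qmod k laurent_quiver) : qmod k Z :=
  @QMod k Z (fun _ => mdim W tt)
    (fun x y a => if val a == gam then arr_act W (laurent_loop true) else 1%:M).

Definition is_winding (gam : Q1 Z) (c : qmod k Z) : Prop := exists2 W,
  arr_act W (laurent_loop true) *m arr_act W (laurent_loop false) = 1%:M
  & c = winding gam W.

Variables (n : nat) (cw : cyclic_walk Z n).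
Notation V := (cw_vertex cw).
Notation Ed := (cw_edge cw).

(** For a single loop both directions fit, and it counts as forward. *)
Definition cw_orient i : bool := (qtail (Ed i) == V i) && (qhead (Ed i) == V i.+1).
Notation o := cw_orient.
Notation E := (fun i => Some (Ed i)).

Lemma modS N i j : i = j %[mod N] -> i.+1 = j.+1 %[mod N].
Proof. by move=> e; rewrite -[i.+1]addn1 -[j.+1]addn1 -modnDml e modnDml. Qed.

Lemma modS_inj N i j : i.+1 = j.+1 %[mod N] -> i = j %[mod N].
Proof. by move=> e; apply: (@modn_addn_cancel _ _ _ 1); rewrite !addn1. Qed.

Lemma cw_orient_mod i j : i = j %[mod n.+1] -> o i = o j.
Proof.
move=> ij; rewrite /o; have -> : Ed i = Ed j by apply/cw_edgeE.
have -> : V i = V j by apply/cw_vertexE.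
by have -> : V i.+1 = V j.+1 by apply/cw_vertexE/modS.
Qed.

Lemma cw_oriented : oriented V E o.
Proof.
move=> i _ [<-]; rewrite /o; case: andP => [[/eqP -> /eqP ->] //|no].
by case: (cw_joins cw i) => -[t h]; split=> //; case: no; rewrite t h !eqxx.
Qed.

Lemma cw_exhausted i : exhausted_at V E o i.+1.
Proof.
split=> a ea; have [q _ eq] := cw_edge_onto cw a; have := cw_oriented (erefl (E q)).
  rewrite -eq ea; case oq: (o q) => -[t h].
    have iq : i.+1 = q %[mod n.+1] by apply/(cw_vertexE cw); rewrite t.
    left; split; last by rewrite (cw_orient_mod iq) oq.
    by rewrite eq; congr Some; apply/cw_edgeE.
  have iq : i = q %[mod n.+1] by apply: modS_inj; apply/(cw_vertexE cw); rewrite -h.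
  right; exists i; split=> //; last by rewrite (cw_orient_mod iq) oq.
  by rewrite eq; congr Some; apply/cw_edgeE.
rewrite -eq ea; case oq: (o q) => -[t h].
  have iq : i = q %[mod n.+1] by apply: modS_inj; apply/(cw_vertexE cw); rewrite -h.
  right; exists i; split=> //; last by rewrite (cw_orient_mod iq) oq.
  by rewrite eq; congr Some; apply/cw_edgeE.
have iq : i.+1 = q %[mod n.+1] by apply/(cw_vertexE cw); rewrite t.
left; split; last by rewrite (cw_orient_mod iq) oq.
by rewrite eq; congr Some; apply/cw_edgeE.
Qed.

Variable M : qmod k Z.
Notation d i := (mdim M (V i)).
Notation A := (wA V E M).
Notation B := (wB V E M).

Lemma dim_mod i j : i = j %[mod n.+1] -> d i = d j.
Proof. by move=> /(cw_vertexE cw) ->. Qed.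

(* If each step is either surjective or backwards injective, the dimensions do not
   increase along the walk; on a cycle they are all equal. *)
Lemma good_edges_invertible :
  (forall i, if o i then row_full (A i) else row_free (B i)) -> arrows_invertible M.
Proof.
move=> good.
have le1 i : (d i.+1 <= d i)%N.
  have := good i; case: (o i); first by rewrite /row_full => /eqP <-; apply: rank_leq_row.
  by rewrite /row_free => /eqP <-; apply: rank_leq_col.
have le i j : (i <= j)%N -> (d j <= d i)%N.
  by move/subnK <-; elim: (j - i)%N => // t IH; apply: leq_trans (le1 _) IH.
have deq i : d i.+1 = d i.
  apply/eqP; rewrite eqn_leq le1 /= -(@dim_mod (n + i.+1) i); last first.
    by rewrite addnS -addSn modnDl.
  by apply: le; rewrite leq_addl.
move=> a; have [q _ eq] := cw_edge_onto cw a.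
suff : mx_iso (xact M (qtail a) (qhead a) (Some a)) by rewrite (xactE _ (mkarr a)).
have := good q; have := cw_oriented (erefl (E q)); rewrite -eq; case: (o q) => -[-> ->] g.
  apply: mx_iso_tr; rewrite {1}eq -/(A q); apply: mx_iso_rank => //.
  by rewrite -row_leq_rank; move/eqP: g => ->; rewrite deq.
apply: mx_iso_tr; rewrite {1}eq -/(B q); apply: mx_iso_rank => //.
by rewrite -col_leq_rank; move/eqP: g => ->; rewrite deq.
Qed.

(** Inclusion of subspaces at vertices that are only propositionally equal, such as those one full
    turn apart. *)
Definition het x x' (U : 'M[k]_(mdim M x)) (W : 'M[k]_(mdim M x')) : Prop :=
  exists e : x = x', (eq_rect x (fun z => 'M[k]_(mdim M z)) U x' e <= W)%MS.

Lemma het_rank x x' (U : 'M[k]_(mdim M x)) (W : 'M[k]_(mdim M x')) :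
  het U W -> (\rank U <= \rank W)%N.
Proof. by move=> [e]; case: x' / e W => W /=; apply: mxrankS. Qed.

Definition estep x y (a : Q1 Z) (b : bool) : 'M_(mdim M x) -> 'M_(mdim M y) :=
  wstep b (xact M x y (Some a))^T (xact M y x (Some a))^T.

Lemma het_step x x' y y' a a' b b' U W : x = x' -> y = y' -> a = a' -> b = b' ->
  het U W -> het (@estep x y a b U) (@estep x' y' a' b' W).
Proof.
move=> ex ey -> -> [e]; case: x' / ex e W => e W; case: y' / ey.
rewrite (eq_axiomK e) /= => UW; exists erefl; exact: wstepS.
Qed.

Lemma het_kernel x x' y y' a a' b W : x = x' -> y = y' -> a = a' -> b = false ->
  het (kermx (xact M y x (Some a))^T) (@estep x' y' a' b W).
Proof.
move=> ex ey -> ->; case: x' / ex W => W; case: y' / ey; exists erefl => /=.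
by rewrite /estep /wstep wstep_preimage mulmx_ker sub0mx.
Qed.

Lemma het_image x x' y y' a a' b U : x = x' -> y = y' -> a = a' -> b = true ->
  het (@estep x' y' a' b U) <<(xact M x y (Some a))^T>>%MS.
Proof.
move=> ex ey -> ->; case: x' / ex U => U; case: y' / ey; exists erefl => /=.
by rewrite /estep /wstep !genmxE submxMl.
Qed.

(** Start right after edge j. If it points forward and is not surjective, take S everything and T
    its image; if it points backward and is not injective, take S its kernel and T = 0. Permanent
    separation would change the rank of S strictly with every turn, so the walk ends in a string. *)
Lemma bad_edge_string j : ~~ (if o j then row_full (A j) else row_free (B j)) ->
  exists L (H : qmor L Z), [/\ linear_quiver L, strict_wrapping H & retract (pushdown H (chi k L)) M].
Proof.
move=> bad; pose p := j.+1.
pose S : 'M[k]_(d p) := if o j then 1%:M else kermx (B j).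
pose T : 'M[k]_(d p) := if o j then <<A j>>%MS else 0.
have nST : ~~ (S <= T)%MS.
  move: bad; rewrite /S /T; case: (o j); first by rewrite genmxE sub1mx.
  by rewrite submx0 kermx_eq0.
have TS : (T <= S)%MS by rewrite /T /S; case: (o j); rewrite ?submx1 ?sub0mx.
have st : start_cond E o S T.
  split=> [y' a no v vS | x' a no w Tw].
    have [H _] := cw_exhausted j; case: (H _ (arr_tail a)) => // -[i [[<-] Ej oj]].
    move: vS; rewrite /S (negPf oj) => /sub_kermxP vB.
    have := cw_oriented Ej; rewrite (negPf oj) arr_head => -[/esym ey _].
    case: y' / ey a no Ej => a _ Ej.
    by move: vB; rewrite /wB Ej xactE => /(congr1 trmx); rewrite trmx_mul trmxK trmx0.
  have [_ H] := cw_exhausted j; case: (H _ (arr_head a)) => // -[i [[<-] Ej oj]].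
  have {Tw} Aw : A j *m w = 0.
    have /submxP[D ->] : (A j <= T)%MS by rewrite /T oj genmxE.
    by rewrite -mulmxA Tw mulmx0.
  have := cw_oriented Ej; rewrite oj arr_tail => -[/esym ey _].
  case: x' / ey a no Ej => a _ Ej.
  by move: Aw; rewrite /wA Ej xactE => /(congr1 trmx); rewrite trmx_mul trmxK trmx0.
pose tr U c := @wsub k (fun i => d (i + p)) (fun i => o (i + p)%N)
  (fun i => A (i + p)) (fun i => B (i + p)) U c.
have [[c le] | no] := classic (exists c, (tr S c <= tr T c)%MS); last first.
  exfalso; have lt c : (\rank (tr T c) < \rank (tr S c))%N.
    apply: rank_ltmx; rewrite ltmxE wsubS //=; apply/negP => le; apply: no.
    by exists c.
  have modp c : (c + n.+1 + p = c + p %[mod n.+1])%N.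
    by rewrite addnAC modnDr.
  have pj : (n + p = j %[mod n.+1])%N by rewrite /p addnS -addSn modnDl.
  have stepH c U W : het (tr U c) (tr W (c + n.+1)%N) -> het (tr U c.+1) (tr W (c.+1 + n.+1)%N).
    move=> h; apply: (@het_step (V (c + p)) (V (c + n.+1 + p)) (V (c + p).+1)
      (V (c + n.+1 + p).+1) (Ed (c + p)) (Ed (c + n.+1 + p)) (o (c + p)) (o (c + n.+1 + p))
      (tr U c) (tr W (c + n.+1)%N) _ _ _ _ h).
    - by apply/(cw_vertexE cw); rewrite modp.
    - by apply/(cw_vertexE cw)/modS; rewrite modp.
    - by apply/(cw_edgeE cw); rewrite modp.
    - by apply: cw_orient_mod; rewrite modp.
  have stepH' c U W : het (tr U (c + n.+1)%N) (tr W c) -> het (tr U (c.+1 + n.+1)%N) (tr W c.+1).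
    move=> h; apply: (@het_step (V (c + n.+1 + p)) (V (c + p)) (V (c + n.+1 + p).+1)
      (V (c + p).+1) (Ed (c + n.+1 + p)) (Ed (c + p)) (o (c + n.+1 + p)) (o (c + p))
      (tr U (c + n.+1)%N) (tr W c) _ _ _ _ h).
    - by apply/(cw_vertexE cw); rewrite modp.
    - by apply/(cw_vertexE cw)/modS; rewrite modp.
    - by apply/(cw_edgeE cw); rewrite modp.
    - by apply: cw_orient_mod; rewrite modp.
  case oj: (o j).
    (* One turn later edge j has been traversed again, so S has been mapped into its image, which is
       T; hence the ranks of S decrease. *)
    have h c : het (tr S (c + n.+1)%N) (tr T c).
      elim: c => [|c IH]; last exact: stepH'.
      have eT : T = <<A j>>%MS by rewrite /T oj.
      rewrite -[tr T 0%N]/T eT; apply: (@het_image (V j) (V (n + p)) (V j.+1) (V (n + p).+1)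
        (Ed j) (Ed (n + p)) (o (n + p)) (tr S n)).
      - by apply/(cw_vertexE cw); rewrite pj.
      - by apply/(cw_vertexE cw)/modS; rewrite pj.
      - by apply/(cw_edgeE cw); rewrite pj.
      - by rewrite (cw_orient_mod pj).
    have dec t : (\rank (tr S (t * n.+1)%N) + t <= \rank (tr S 0%N))%N.
      elim: t => [|t IH]; first by rewrite addn0.
      apply: leq_trans IH; rewrite addnS -addSn leq_add2r mulSn [(n.+1 + _)%N]addnC.
      exact: leq_ltn_trans (het_rank (h _)) (lt _).
    by have := dec (\rank (tr S 0%N)).+1; rewrite addnS ltnNge leq_addl.
  (* Dually, one turn later T is a preimage under edge j and contains its kernel S; hence the ranks
     of S increase. *)
  have h c : het (tr S c) (tr T (c + n.+1)%N).
    elim: c => [|c IH]; last exact: stepH.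
    have eS : S = kermx (B j) by rewrite /S oj.
    rewrite -[tr S 0%N]/S eS; apply: (@het_kernel (V j) (V (n + p)) (V j.+1) (V (n + p).+1)
      (Ed j) (Ed (n + p)) (o (n + p)) (tr T n)).
    - by apply/(cw_vertexE cw); rewrite pj.
    - by apply/(cw_vertexE cw)/modS; rewrite pj.
    - by apply/(cw_edgeE cw); rewrite pj.
    - by rewrite (cw_orient_mod pj).
  have inc t : (t <= \rank (tr S (t * n.+1)%N))%N.
    elim: t => // t IH; apply: leq_ltn_trans IH _; rewrite mulSn [(n.+1 + _)%N]addnC.
    exact: leq_ltn_trans (het_rank (h _)) (lt _).
  have := leq_trans (inc (d p).+1) (rank_leq_row _).
  rewrite (@dim_mod _ p) ?ltnn //; by rewrite modnMDl.
have [[b [v [w [_ sec en nz0 [vS Tw]]]]] | ] :=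
  walk_dichotomy (fun i => o (i + p)%N) (fun i => A (i + p)) (fun i => B (i + p)) c TS nST;
  last by rewrite le.
have [|||L [H [l1 l2 _ l4]]] :=
  @walk_string k Z V E o M p b S T v w cw_oriented _ _ _ st sec nz0 vS Tw (fun _ => en).
- by move=> i i' a [<-] [] /(cw_edgeE cw) /cw_orient_mod.
- by [].
- by move=> i _ _; rewrite /p addnS; apply: cw_exhausted.
by exists L, H.
Qed.

(* Transport of M around the cycle, starting just after the arrow gam. *)
Lemma invertible_winding gam : arrows_invertible M ->
  exists2 W, arr_act W (laurent_loop true) *m arr_act W (laurent_loop false) = 1%:M
    & qiso (winding gam W) M.
Proof.
move=> inv; have [q _ eq] := cw_edge_onto cw gam; pose p := q.+1.
have iso x y (a : arr x y) : mx_iso (arr_act M a) by elim/arr_ind: y / a => a; apply: inv.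
have isox i : (o i -> mx_iso (xact M (V i) (V i.+1) (E i))) /\
    (~~ o i -> mx_iso (xact M (V i.+1) (V i) (E i))).
  have := cw_oriented (erefl (E i)); case: (o i) => -[<- <-]; split=> // _.
    by rewrite (xactE _ (mkarr (Ed i))).
  by rewrite (xactE _ (mkarr (Ed i))).
pose go := fix go t : 'M[k]_(mdim M (V (t + p)), d p) := if t is t'.+1 then
    (if o (t' + p) then xact M (V (t' + p)) (V (t' + p).+1) (E (t' + p)%N)
     else pinvmx (xact M (V (t' + p).+1) (V (t' + p)) (E (t' + p)%N))) *m go t'
  else 1%:M.
have goI t : mx_iso (go t).
  elim: t => [|t IH]; first exact: mx_iso1.
  apply: mx_iso_mul IH; have [i1 i2] := isox (t + p)%N.
  by case ot: (o (t + p)); [apply: i1 | apply/mx_iso_pinv/i2; rewrite ot].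
have [idx idxP] : exists idx : Q0 Z -> nat, forall x, (idx x < n.+1)%N /\ V (idx x + p)%N = x.
  apply: (fin_all_exists (P := fun x i => (i < n.+1)%N /\ V (i + p)%N = x)) => x.
  (* n p is -p modulo n + 1, so this is the distance from the start p to position i. *)
  have [i _ ->] := cw_vertex_onto cw x; exists ((i + n * p) %% n.+1)%N; split; first exact: ltn_pmod.
  by apply/(cw_vertexE cw); rewrite modnDml -addnA -mulSnr [(n.+1 * _)%N]mulnC addnC modnMDl.
pose f x : 'M[k]_(mdim M x, d p) := transport M (V (idx x + p)) x *m go (idx x).
have fV t : (t < n.+1)%N -> f (V (t + p)%N) = go t.
  move=> lt; rewrite /f; have [lt' e] := idxP (V (t + p)%N).
  suff -> : idx (V (t + p)) = t by rewrite transport_id mul1mx.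
  move/(cw_vertexE cw): e => /modn_addn_cancel.
  by rewrite !modn_small.
have fI x : mx_iso (f x).
  by have [lt <-] := idxP x; rewrite fV.
(* The monodromy of the cycle: in the trivialization f all other arrows become identities, and gam
   carries the whole turn. *)
pose G := pinvmx (f (qhead gam)) *m arr_act M (mkarr gam) *m f (qtail gam).
have GI : mx_iso G.
  by apply: mx_iso_mul (fI _); apply: mx_iso_mul (iso _ _ _); apply: mx_iso_pinv.
pose W := @QMod k laurent_quiver (fun _ => d p) (fun x y a => if val a then G else pinvmx G).
exists W; first by rewrite /=; case/mx_isoP: GI.
have hf : @qhom _ _ (winding gam W) M f.
  apply: qhomP => a /=; case: eqP => [-> | ne].
    rewrite /G; have /mx_isoP[e _] := fI (qhead gam).
    by move: (pinvmx _) e => F e; rewrite !mulmxA e mul1mx.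
  rewrite mulmx1 -(xactE _ (mkarr a)) /=.
  have [i _ ea] := cw_edge_onto cw a.
  have [t lt ti] : exists2 t, (t < n)%N & (t + p = i %[mod n.+1])%N.
    exists ((i + n * p) %% n.+1)%N; last by rewrite modnDml -addnA -mulSnr [(n.+1 * _)%N]mulnC addnC modnMDl.
    have : ((i + n * p) %% n.+1 < n.+1)%N by apply: ltn_pmod.
    rewrite ltnS leq_eqVlt => /orP[/eqP e|//]; case: ne; rewrite ea eq.
    apply/(cw_edgeE cw); have : (n + p = i %[mod n.+1])%N.
      by rewrite -{1}e modnDml -addnA -mulSnr [(n.+1 * _)%N]mulnC addnC modnMDl.
    by move=> <-; rewrite /p addnS -addSn modnDl.
  have {i ti} ea : a = Ed (t + p)%N by rewrite ea; apply/(cw_edgeE cw).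
  have := cw_oriented (erefl (E (t + p)%N)); rewrite -ea.
  have [i1 i2] := isox (t + p)%N.
  have e0 : f (V (t + p)) = go t by apply: fV; apply: leqW.
  have e1 : f (V (t + p).+1) = go t.+1 by apply: (fV t.+1).
  have goS : go t.+1 =
    (if o (t + p) then xact M (V (t + p)) (V (t + p).+1) (E (t + p)%N)
     else pinvmx (xact M (V (t + p).+1) (V (t + p)) (E (t + p)%N))) *m go t by [].
  move: (go t.+1) e1 goS => gS e1 goS.
  case ot: (o (t + p)) i1 i2 goS => i1 i2 goS -[-> ->].
    by rewrite e0 e1 goS ea.
  rewrite e0 e1 goS ea mulmxA.
  by case/mx_isoP: (i2 isT) => -> _; rewrite mul1mx.
exists f, (fun x => pinvmx (f x)); split=> //.
- by apply: (hom_inv hf) => x; case/mx_isoP: (fI x).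
- by move=> x; case/mx_isoP: (fI x).
- by move=> x; case/mx_isoP: (fI x).
Qed.

End CyclicQuivers.

(** Strings are peeled off as long as some edge is bad; once none is, every arrow is invertible and
    the rest is one winding. *)
Lemma cyclic_decompose (k : fieldType) (Z : quiver) (gam : Q1 Z) (M : qmod k Z) : cyclic_quiver Z ->
  Add (fun c => is_string c \/ is_winding gam c) M.
Proof.
move=> /cyclic_quiver_walk[n [cw]]; apply: (@Add_decompose _ _ (fun=> True)) => // m _ nz.
have [good | bad] := classic (forall i, if cw_orient cw i then
    row_full (wA (cw_vertex cw) (fun i => Some (cw_edge cw i)) m i)
    else row_free (wB (cw_vertex cw) (fun i => Some (cw_edge cw i)) m i)).
  have [W WW iso] := invertible_winding cw gam (good_edges_invertible good).
  exists (winding gam W); first by right; exists W.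
  split; first exact: iso_retract.
  by move=> z; apply: nz; apply: iso_qzero z; apply: iso_sym.
have [j nj] := not_all_ex_not _ _ bad.
have [|L [H [l1 l2 r]]] := @bad_edge_string k Z n cw m j; first exact/negP.
exists (pushdown H (chi k L)); first by left; exists L, H.
by split=> //; apply: pushdown_nonzero; apply: chi_nonzero.
Qed.

(** * Modules over the Laurent algebra *)

Section UpperTriangular.
Variable k : fieldType.

Lemma upper_unitmx t (A : 'M[k]_t) c : c != 0 -> (forall i j : 'I_t, (j < i)%N -> A i j = 0) ->
  (forall i, A i i = c) -> A \in unitmx.
Proof.
move=> c0 up diag; rewrite -unitmx_tr unitmxE det_trig.
  rewrite (eq_bigr (fun _ => c)) => [|i _]; last by rewrite mxE diag.
  by rewrite prodr_const unitfE expf_neq0.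
by apply/is_trig_mxP => i j lt; rewrite mxE up.
Qed.

Lemma jordan_unit (lam : k) t : lam != 0 -> jordan lam t \in unitmx.
Proof.
move=> l0; apply: (upper_unitmx l0) => [i j lt|i]; rewrite mxE ?eqxx //.
by rewrite -val_eqE /= gtn_eqF // ltn_eqF // ltnW.
Qed.

Lemma jordan_mulmxE (lam : k) t n (X : 'M[k]_(t, n)) i j : (jordan lam t *m X) i j =
  lam * X i j + \sum_(l < t | l == i.+1 :> nat) X l j.
Proof.
rewrite mxE (bigD1 i) //= mxE eqxx; congr (_ + _).
rewrite [RHS]big_mkcond [in RHS](bigD1 i) //= (ltn_eqF (ltnSn i)) add0r.
apply: eq_bigr => l ne; rewrite mxE eq_sym (negPf ne).
by case: eqP => _; rewrite ?mul1r ?mul0r.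
Qed.

Lemma mulmx_jordanE (lam : k) t n (X : 'M[k]_(n, t)) i j : (X *m jordan lam t) i j =
  lam * X i j + \sum_(l < t | j == l.+1 :> nat) X i l.
Proof.
rewrite mxE (bigD1 j) //= mxE eqxx mulrC; congr (_ + _).
rewrite [RHS]big_mkcond [in RHS](bigD1 j) //= (ltn_eqF (ltnSn j)) add0r.
apply: eq_bigr => l ne; rewrite mxE (negPf ne).
by case: eqP => _; rewrite ?mulr1 ?mulr0.
Qed.

(* An endomorphism of a Jordan block is an upper triangular Toeplitz matrix. *)
Lemma jordan_idempotent_zero (lam : k) t (E : 'M[k]_t.+1) :
  E *m jordan lam t.+1 = jordan lam t.+1 *m E -> E *m E = E -> E 0 0 = 0 -> E = 0.
Proof.
move=> comm EE z.
suff H : forall b (i j : 'I_t.+1), (j < b)%N -> E i j = 0.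
  by apply/matrixP => i j; rewrite mxE (H t.+1).
elim=> // b IH i j; rewrite ltnS => lejb.
have E0 (i1 : 'I_t.+1) : (0 < i1)%N -> E i1 j = 0.
  move=> pos; have lt : (i1.-1 < t.+1)%N by rewrite (leq_ltn_trans (leq_pred _)).
  (* This entry of E J = J E says that E is constant along diagonals: the entry at (i1, j) equals
     its upper left neighbour, read as 0 for j = 0. *)
  have := congr1 (fun X : 'M_t.+1 => X (Ordinal lt) j) comm.
  rewrite mulmx_jordanE jordan_mulmxE => /addrI; rewrite /= prednK // [X in _ = X](big_pred1 i1); last first.
    by move=> l; rewrite /= -val_eqE.
  rewrite big1 => [<- // | l /eqP jl]; by apply: IH; rewrite -ltnS -jl.
have [i0|] := posnP i; last exact: E0.
have -> : i = 0 by apply: val_inj.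
rewrite -EE mxE (bigD1 0) //= z mul0r add0r big1 // => l ne.
by rewrite (E0 l) ?mulr0 // lt0n.
Qed.

(** The first column vanishes below the corner, so the corner entry is an idempotent scalar. It
    decides whether E or 1 - E falls under the preceding lemma. *)
Lemma jordan_idempotent (lam : k) t (E : 'M[k]_t) :
  E *m jordan lam t = jordan lam t *m E -> E *m E = E -> E = 0 \/ E = 1%:M.
Proof.
case: t E => [|t] E comm EE; first by left; apply: mx_dim0; left.
have E0 (i1 : 'I_t.+1) : (0 < i1)%N -> E i1 0 = 0.
  move=> pos; have lt : (i1.-1 < t.+1)%N by rewrite (leq_ltn_trans (leq_pred _)).
  have := congr1 (fun X : 'M_t.+1 => X (Ordinal lt) 0) comm.
  rewrite mulmx_jordanE jordan_mulmxE => /addrI; rewrite /= prednK // [X in _ = X](big_pred1 i1); last first.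
    by move=> l; rewrite /= -val_eqE.
  by rewrite big_pred0.
have : E 0 0 * E 0 0 = E 0 0.
  rewrite -[in RHS]EE mxE (bigD1 0) //= big1 ?addr0 // => l ne.
  by rewrite (E0 l) ?mulr0 // lt0n.
have [z _|nz] := eqVneq (E 0 0) 0; first by left; exact: jordan_idempotent_zero comm EE z.
rewrite -[RHS]mulr1 => /(mulfI nz) E00; right; apply/eqP; rewrite eq_sym -subr_eq0; apply/eqP.
apply: (@jordan_idempotent_zero lam).
- by rewrite mulmxBl mulmxBr mul1mx mulmx1 comm.
- by rewrite mulmxBl mul1mx mulmxBr mulmx1 EE subrr subr0.
- by rewrite !mxE E00 subrr.
Qed.

End UpperTriangular.

Section LaurentModules.
Variable k : fieldType.
Implicit Types V W : qmod k laurent_quiver.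

Definition loop_act V : 'M[k]_(mdim V tt) := arr_act V (laurent_loop true).

Definition laurent_invertible V : Prop :=
  loop_act V *m arr_act V (laurent_loop false) = 1%:M.

Lemma in_mod_laurent V : in_mod (@laurent_ideal k) V <-> laurent_invertible V.
Proof.
have E b c : kact V (loop2 k b c - kpath_of k (@pnil laurent_quiver tt)) =
    arr_act V (laurent_loop c) *m arr_act V (laurent_loop b) - 1%:M.
  rewrite -scaleN1r addrC kact_lin !kact_of /= mul1mx scaleN1r addrC.
  by [].
split=> [inV | inv x y f].
  have : kact V (loop2 k false true - kpath_of k (@pnil laurent_quiver tt)) = 0.
    by apply: inV => J idJ sub; apply: sub; apply: RelBA.
  by rewrite E => /eqP; rewrite subr_eq0 => /eqP.
move=> /(_ _ (annihilator_is_ideal V)); apply=> x1 y1 g [].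
  by rewrite E; apply/eqP; rewrite subr_eq0; apply/eqP/mulmx1C.
by rewrite E; apply/eqP; rewrite subr_eq0; apply/eqP.
Qed.

Definition loop_hom V W (f : 'M[k]_(mdim W tt, mdim V tt)) : fam V W :=
  fun x => match x with tt => f end.

(** Commuting with alpha is enough, since beta acts as its inverse. *)
Lemma loop_homP V W f : laurent_invertible V -> laurent_invertible W ->
  f *m loop_act V = loop_act W *m f -> qhom (@loop_hom V W f).
Proof.
move=> iV iW e [] [] [[] p]; rewrite (bool_irrelevance p isT) //=.
have iV' := mulmx1C iV; have iW' := mulmx1C iW.
rewrite -[LHS]mul1mx -iW' -mulmxA; congr (_ *m _).
rewrite mulmxA -e -mulmxA.
by rewrite iV mulmx1.
Qed.

Lemma laurent_invertible_mod (lam : k) t : lam != 0 -> laurent_invertible (laurent_mod lam t).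
Proof. by move=> l0; rewrite /laurent_invertible /= mulmxV // jordan_unit. Qed.

Lemma laurent_mod_indecomposable (lam : k) t : lam != 0 -> (0 < t)%N ->
  indecomposable (laurent_mod lam t).
Proof.
move=> l0 t0; apply/indecomposableP; split=> [z|E hE EE].
  by have := z tt; rewrite /= => e; rewrite e in t0.
have comm : E tt *m jordan lam t = jordan lam t *m E tt.
  exact: hE tt tt (laurent_loop true).
by have [z|e] := jordan_idempotent comm (EE tt); [left | right] => -[].
Qed.

Lemma in_mod_tensor_laurent V W : in_mod (@laurent_ideal k) V ->
  in_mod (@laurent_ideal k) W -> in_mod (@laurent_ideal k) (qtensor V W).
Proof.
rewrite !in_mod_laurent /laurent_invertible /loop_act /= => e1 e2.
by rewrite -tprodE e1 e2 tprod1.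
Qed.

Lemma in_mod_qsum_laurent V W : in_mod (@laurent_ideal k) V ->
  in_mod (@laurent_ideal k) W -> in_mod (@laurent_ideal k) (qsum V W).
Proof.
rewrite !in_mod_laurent /laurent_invertible /loop_act /= => e1 e2.
rewrite mulmx_block !(mulmx0, mul0mx) !(addr0, add0r).
by rewrite e1 e2 -scalar_mx_block.
Qed.

Lemma tprod11 c m n (B : 'M[k]_(m, n)) : tprod (c%:M : 'M_1) B =
  castmx (esym (mul1n m), esym (mul1n n)) (c *: B).
Proof.
apply/matrixP=> i j; rewrite castmxE /= mxE; case: splitP => [i' ei|[]//].
rewrite mxE; case: splitP => [j' ej| []//]; rewrite !mxE /= mulr1n.
congr (_ * B _ _); apply: val_inj; rewrite /= ?ei ?ej //.
Qed.

Lemma castmx_mulr m m' n n' p (em : m = m') (en : n = n') (A : 'M[k]_(m, n)) (X : 'M_(n, p)) :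
  castmx (em, en) A *m castmx (en, erefl p) X = castmx (em, erefl p) (A *m X).
Proof. by case: m' / em; case: n' / en; rewrite !castmx_id. Qed.

Lemma castmx_mull m m' n p (em : m = m') (A : 'M[k]_(m, n)) (X : 'M_(n, p)) :
  castmx (em, erefl n) A *m X = castmx (em, erefl p) (A *m X).
Proof. by case: m' / em; rewrite !castmx_id. Qed.

Lemma castmx_cancel m m' n p (em : m = m') (A : 'M[k]_(n, m)) (X : 'M_(m, p)) :
  castmx (erefl n, em) A *m castmx (em, erefl p) X = A *m X.
Proof. by case: m' / em; rewrite !castmx_id. Qed.

Lemma castmx_conj m m' n (em : m = m') (A : 'M[k]_(m, n)) (X : 'M_(n, m)) : A *m X = 1%:M ->
  castmx (em, erefl n) A *m castmx (erefl n, em) X = 1%:M.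
Proof. by case: m' / em; rewrite !castmx_id. Qed.

(** Conjugation by a diagonal matrix of powers of nu rescales the superdiagonal of nu J_mu(t) back
    to 1, which gives J_{nu mu}(t). *)
Lemma twist_retract (nu mu : k) t : nu != 0 -> mu != 0 ->
  retract (laurent_mod (nu * mu) t) (qtensor (laurent_mod nu 1) (laurent_mod mu t)).
Proof.
move=> n0 m0.
pose D : 'M[k]_t := diag_mx (\row_(i < t) (nu^-1) ^+ i).
pose D' : 'M[k]_t := diag_mx (\row_(i < t) nu ^+ i).
have DD : D' *m D = 1%:M.
  rewrite mulmx_diag; apply/matrixP => i j; rewrite !mxE.
  by rewrite -exprMn mulfV // expr1n.
have DJ : nu *: jordan mu t *m D = D *m jordan (nu * mu) t.
  apply/matrixP => i j; rewrite mul_mx_diag mul_diag_mx !mxE.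
  case: eqP => [->|_]; first by rewrite mulrC.
  case: eqP => [->|_]; last by rewrite !(mulr0, mul0r).
  by rewrite !mulr1 exprS mulrA mulfV // mul1r.
pose e := esym (mul1n t).
pose X := qtensor (laurent_mod nu 1) (laurent_mod mu t).
pose f : 'M[k]_(mdim X tt, t) := castmx (e, erefl t) D.
pose g : 'M[k]_(t, mdim X tt) := castmx (erefl t, e) D'.
have gf : g *m f = 1%:M by rewrite castmx_cancel.
have fg : f *m g = 1%:M by apply: castmx_conj; apply: mulmx1C.
have hf : qhom (@loop_hom (laurent_mod (nu * mu) t) X f).
  apply: loop_homP.
  - by apply: laurent_invertible_mod; rewrite mulf_neq0.
  - apply/in_mod_laurent/in_mod_tensor_laurent; exact/in_mod_laurent/laurent_invertible_mod.
  change (f *m jordan (nu * mu) t = tprod (jordan nu 1) (jordan mu t) *m f).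
  have -> : jordan nu 1 = nu%:M by apply/matrixP => i j; rewrite !ord1 !mxE eqxx.
  by rewrite tprod11 /f castmx_mull -DJ castmx_mulr.
exists (@loop_hom (laurent_mod (nu * mu) t) X f), (@loop_hom X (laurent_mod (nu * mu) t) g).
by split=> //; [apply: (hom_inv hf) | ]; case.
Qed.

End LaurentModules.

Lemma laurent_mod_retract (k : closedFieldType) (V : qmod k laurent_quiver) :
  laurent_invertible V -> ~ qzero V ->
  exists mu t, [/\ mu != 0, (0 < t)%N & retract (laurent_mod mu t) V].
Proof.
move=> iV nz; pose A := loop_act V; pose n := mdim V tt.
have n0 : (0 < n)%N by rewrite lt0n; apply/eqP => z; apply: nz => -[].
have [mu mu_root] : exists mu, root (char_poly A) mu.
  by apply/closed_rootP; rewrite size_char_poly eqSS -lt0n.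
pose N := A - mu%:M.
have [u0 u0N nzu0] : exists2 u : 'rV_n, u *m N = 0 & u != 0.
  move: mu_root; rewrite -eigenvalue_root_char => /eigenvalueP[u e nzu]; exists u => //.
  by rewrite mulmxBr e mul_mx_scalar subrr.
have mu0 : mu != 0.
  apply: contraNneq nzu0 => z; move: u0N; rewrite /N z raddf0 subr0 => e.
  by rewrite -[u0]mulmx1 -iV mulmxA e mul0mx.
(* If every N^t had ker N in its row space, then the eigenvector u0 would make the rank drop at each
   multiplication by N, forever. *)
have ex : exists t, ~~ (kermx N <= N ^+ t)%MS.
  apply: NNPP => no; have sub t : (kermx N <= N ^+ t)%MS.
    by apply: contraT => H; case: no; exists t.
  have H t : (\rank (N ^+ t) + t <= n)%N.
    elim: t => [|t IH]; first by rewrite addn0 rank_leq_row.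
    apply: leq_trans IH; rewrite addnS -addSn leq_add2r.
    rewrite -[X in (_ <= X)%N](mxrank_mul_ker _ N) exprSr -mulmxE -addn1 leq_add2l lt0n.
    rewrite mxrank_eq0; apply: contraNneq nzu0 => z; rewrite -submx0 -z sub_capmx.
    have uk : (u0 <= kermx N)%MS by apply/sub_kermxP.
    by rewrite uk (submx_trans uk (sub t)).
  by have := leq_trans (leq_addl _ _) (H n.+1); rewrite ltnn.
(* Then ker N lies in im N^(t-1): a row phi N^(t-1) in ker N outside im N^t and a column
   v killing im N^t but not it, split off a Jordan block of size t. *)
case: (ex_minnP ex) => t nt mint.
have t0 : (0 < t)%N by case: t nt {mint} => //; rewrite expr0 submx1.
have kt : (kermx N <= N ^+ t.-1)%MS.
  by apply: contraT => /mint; rewrite leqNgt prednK // leqnn.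
have /row_subPn[i nsub] := nt.
have [v Nv nzv] := separate_row nsub.
have /submxP[phi ephi] : (row i (kermx N) <= N ^+ t.-1)%MS by apply: submx_trans (row_sub _ _) kt.
have phiN e : (t <= e)%N -> phi *m N ^+ e = 0.
  move=> le; rewrite -(subnKC le) exprD -(prednK t0) exprSr -!mulmxE !mulmxA -ephi.
  by rewrite -row_mul mulmx_ker row0 mul0mx.
pose c := (phi *m N ^+ t.-1 *m v) 0 0.
have c0 : c != 0.
  apply: contraNneq nzv => z; apply/eqP/matrixP => i1 j1.
  by rewrite !ord1 ephi [RHS]mxE -z.
(* The columns form the Jordan chain of v and the rows of g that of phi. The (i, j) entry of g f is
   phi N^(i + t - 1 - j) v: zero below the diagonal and c on it. *)
pose f : 'M[k]_(n, t) := \matrix_(i, j) (N ^+ (t.-1 - j) *m v) i 0.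
pose g : 'M[k]_(t, n) := \matrix_(i, j) (phi *m N ^+ i) 0 j.
have NE d (X : 'M_(n, d)) : A *m X = mu *: X + N *m X.
  by rewrite mulmxBl mul_scalar_mx addrC subrK.
have NE' d (X : 'M_(d, n)) : X *m A = mu *: X + X *m N.
  by rewrite mulmxBr mul_mx_scalar addrC subrK.
have fJ : f *m jordan mu t = A *m f.
  rewrite NE; apply/matrixP => i1 j; rewrite mulmx_jordanE [in RHS]mxE; congr (_ + _).
    by rewrite [RHS]mxE.
  have -> : (N *m f) i1 j = (N ^+ (t - j) *m v) i1 0.
    have -> : (t - j)%N = (t.-1 - j).+1 by have := ltn_ord j; lia.
    by rewrite exprS -!mulmxE -mulmxA !mxE; apply: eq_bigr => l _; rewrite [f _ _]mxE.
  have [j0|jpos] := posnP j.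
    rewrite big1 => [|l]; last by rewrite j0.
    by rewrite j0 subn0 Nv mxE.
  have lt : (j.-1 < t)%N by rewrite (leq_ltn_trans (leq_pred _)).
  rewrite (big_pred1 (Ordinal lt)) => [|l]; last first.
    by rewrite /= -val_eqE /=; have := jpos; lia.
  by rewrite mxE /=; congr ((N ^+ _ *m v) i1 0); have := ltn_ord j; lia.
have gJ : jordan mu t *m g = g *m A.
  rewrite NE'; apply/matrixP => i1 j; rewrite jordan_mulmxE [in RHS]mxE; congr (_ + _).
    by rewrite [RHS]mxE.
  have -> : (g *m N) i1 j = (phi *m N ^+ i1.+1) 0 j.
    by rewrite exprSr -!mulmxE mulmxA [LHS]mxE [RHS]mxE; apply: eq_bigr => l _; rewrite mxE.
  have [lt|ge] := ltnP i1.+1 t.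
    by rewrite (big_pred1 (Ordinal lt)) => [|l]; rewrite ?mxE //= -val_eqE.
  rewrite big1 => [|l /eqP e]; first by rewrite phiN // mxE.
  by have := ltn_ord l; rewrite e ltnNge ge.
have gfE i1 j : (g *m f) i1 j = (phi *m N ^+ (i1 + (t.-1 - j)) *m v) 0 0.
  rewrite exprD -!mulmxE mulmxA -[phi *m _ *m _ *m v]mulmxA [LHS]mxE [RHS]mxE.
  by apply: eq_bigr => l _; rewrite [g _ _]mxE [f _ _]mxE.
have gfu : g *m f \in unitmx.
  apply: (upper_unitmx c0) => [i1 j lt | i1]; rewrite gfE.
    by rewrite phiN ?mul0mx ?mxE //; have := ltn_ord i1; lia.
  by rewrite /c; congr ((phi *m N ^+ _ *m v) 0 0); have := ltn_ord i1; lia.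
exists mu, t; split=> //.
have iJ := laurent_invertible_mod t mu0.
have hf : qhom (@loop_hom _ (laurent_mod mu t) V f) by apply: loop_homP.
have hg : qhom (@loop_hom _ V (laurent_mod mu t) g) by apply: loop_homP.
have hh := hom_comp hf hg.
exists (@loop_hom _ (laurent_mod mu t) V f).
exists (fun x => invmx (@loop_hom _ V (laurent_mod mu t) g x *m @loop_hom _ (laurent_mod mu t) V f x) *m @loop_hom _ V (laurent_mod mu t) g x).
split=> //.
  by apply: hom_comp hg (hom_invmx hh _) => -[].
by case; rewrite -mulmxA mulVmx.
Qed.

(** The clause [retract c V] keeps track that the blocks lie in every tensor ideal containing V. *)
Lemma laurent_decompose (k : closedFieldType) (V : qmod k laurent_quiver) :
  laurent_invertible V ->
  Add (fun c => exists mu t, [/\ mu != 0, (0 < t)%N, c = laurent_mod mu t & retract c V]) V.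
Proof.
move=> iV; apply: (@Add_decompose _ _ (fun u => retract u V)) (retract_refl V).
  by move=> m u r r'; apply: retract_trans r' r.
move=> m r nz; have iM : laurent_invertible m.
  by apply/in_mod_laurent; apply: in_mod_retract r _; apply/in_mod_laurent.
have [mu [t [mu0 t0 r']]] := laurent_mod_retract iM nz.
exists (laurent_mod mu t); first by exists mu, t; split=> //; apply: retract_trans r' r.
by split=> // /(_ tt) /= z; rewrite z in t0.
Qed.

(** * Modules B(V) over a cyclic quiver *)

Section Winding.
Variables (k : fieldType) (Z : quiver) (gam : Q1 Z).
Implicit Types V W : qmod k laurent_quiver.

Lemma winding_hom V W (f : fam V W) : qhom f ->
  @qhom _ _ (winding gam V) (winding gam W) (fun _ => f tt).
Proof.
by move=> hf x y a /=; case: eqP => _; [apply: hf | rewrite mulmx1 mul1mx].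
Qed.

Lemma winding_retract V W : retract V W -> retract (winding gam V) (winding gam W).
Proof.
move=> [f [g [hf hg gf]]]; exists (fun _ => f tt), (fun _ => g tt).
by split; [apply: winding_hom | apply: winding_hom | move=> x; apply: gf].
Qed.

Lemma Add_winding (C : qmod k laurent_quiver -> Prop) (D : qmod k Z -> Prop) V :
  (forall c, C c -> Add D (winding gam c)) -> Add C V -> Add D (winding gam V).
Proof.
move=> CD H.
suff: forall h : fam V V, factors_sum C h ->
    @factors_sum _ _ D (winding gam V) (winding gam V) (fun _ => h tt) by move/(_ _ H).
move=> h; elim=> {h H} [h z | c f g h h1 Cc hf hg H1 IH e1]; first by apply: FactorsSum0 => x; apply: z.
have F := factors_sum_comp (winding_hom hf) (winding_hom hg) (CD c Cc).
by apply: factors_sum_ext (factors_sum_add F IH) => x; rewrite mulmx1 e1.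
Qed.

Lemma winding_tensor V W :
  qiso (qtensor (winding gam V) (winding gam W)) (winding gam (qtensor V W)).
Proof.
exists (fun _ => 1%:M), (fun _ => 1%:M); split.
- by move=> x y a /=; rewrite mul1mx mulmx1; case: eqP => // _; rewrite tprod1.
- by move=> x y a /=; rewrite mul1mx mulmx1; case: eqP => // _; rewrite tprod1.
- by move=> x; rewrite mul1mx.
- by move=> x; rewrite mul1mx.
Qed.

Lemma winding_invertible V : laurent_invertible V -> arrows_invertible (winding gam V).
Proof.
move=> iV a /=; case: eqP => _; last by exists 1%:M; rewrite mul1mx.
by exists (arr_act V (laurent_loop false)); split=> //; apply: mulmx1C.
Qed.

(** All arrows but gam are identities, and they connect all vertices, so an endomorphism is one
    matrix; gam makes it commute with the loop of V. *)
Lemma winding_indecomposable V : cyclic_quiver Z -> laurent_invertible V ->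
  indecomposable V -> indecomposable (winding gam V).
Proof.
move=> /cyclic_quiver_walk[n [cw]] iV /indecomposableP[nz HV]; apply/indecomposableP; split.
  by move=> z; apply: nz => -[]; apply: (z (qtail gam)).
move=> E hE EE; have [q _ eq] := cw_edge_onto cw gam; pose p := q.+1.
have const t : (t <= n)%N -> E (cw_vertex cw (t + p)) = E (cw_vertex cw p).
  elim: t => // t IH lt; rewrite -IH; last exact: ltnW.
  have ne : cw_edge cw (t + p) <> gam.
    rewrite eq => /(cw_edgeE cw); rewrite /p addnS => e.
    have := @modn_addn_cancel n.+1 t.+1 0 q; rewrite addSn add0n => /(_ e).
    by rewrite mod0n modn_small.
  have := hE _ _ (mkarr (cw_edge cw (t + p))); rewrite /= (introF eqP ne) mulmx1 mul1mx.
  by case: (cw_joins cw (t + p)) => -[-> ->] // ->.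
have {}const x : E x = E (cw_vertex cw p).
  have [i _ ->] := cw_vertex_onto cw x.
  have <- : cw_vertex cw ((i + n * p) %% n.+1 + p) = cw_vertex cw i.
    by apply/(cw_vertexE cw); rewrite modnDml -addnA -mulSnr [(n.+1 * _)%N]mulnC addnC modnMDl.
  by apply: const; rewrite -ltnS ltn_pmod.
have hV : qhom (@loop_hom _ V V (E (cw_vertex cw p))).
  apply: loop_homP => //; have := hE _ _ (mkarr gam); rewrite /= eqxx.
  by rewrite (const (qhead gam)) (const (qtail gam)).
have [|z|z] := HV _ hV; first by case; apply: EE.
  by left=> x; rewrite const; apply: (z tt).
by right=> x; rewrite const; apply: (z tt).
Qed.

End Winding.

(** * Strings and tensor products *)

(** Kept transparent, so that [is_comp] for a composite holds by conversion. *)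
Definition qmor_comp (P' P Q : quiver) (G : qmor P Q) (H : qmor P' P) : qmor P' Q.
Proof.
exists (fun x => mor0 G (mor0 H x)) (fun a => mor1 G (mor1 H a)).
- by move=> a; rewrite !mor_tail.
- by move=> a; rewrite !mor_head.
Defined.

Lemma strict_comp (P' P Q : quiver) (G : qmor P Q) (H : qmor P' P) :
  strict_wrapping G -> strict_wrapping H -> strict_wrapping (qmor_comp G H).
Proof.
move=> [_ sG] [_ sH]; apply: strict_wrappingP => a b ne /= e.
have [Hab|/eqP nH] := eqVneq (mor1 H a) (mor1 H b); first exact: sH.
have [t h] := sG _ _ nH e; rewrite !mor_tail !mor_head in t h.
by split=> eab; [apply: t | apply: h]; rewrite eab.
Qed.

Lemma injective_mor1 (P' P : quiver) (H : qmor P' P) : strict_wrapping H ->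
  injective (mor0 H) -> injective (mor1 H).
Proof.
move=> sH inj a b e; apply: (strict_tail_inj sH e); apply: inj.
by rewrite -!mor_tail e.
Qed.

Section StringModules.
Variable k : fieldType.

Lemma chi_indecomposable (L : quiver) : linear_quiver L -> indecomposable (chi k L).
Proof.
move=> lin; apply/indecomposableP; split; first exact: chi_nonzero.
move=> E hE EE; have [n [V [Eo [o [ori _ En _ [_ Vs]]]]]] := linear_walk lin.
have const i : (i <= n)%N -> E (V i) = E (V 0%N).
  elim: i => // i IH lt; rewrite -IH; last exact: ltnW.
  have := En i; rewrite lt; case Ei: (Eo i) => [a|] // _.
  have := hE _ _ (mkarr a); rewrite /= mulmx1 mul1mx.
  by have := ori _ _ Ei; case: (o i) => -[-> ->].
have /eqP : E (V 0%N) 0 0 * E (V 0%N) 0 0 = E (V 0%N) 0 0.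
  by rewrite -[in RHS]EE mxE big_ord1.
rewrite -subr_eq0 -{3}[E _ _ _]mulr1 -mulrBr mulf_eq0 subr_eq0 => /orP[] /eqP e.
  left=> x; have [i le ->] := Vs x; rewrite const //.
  by apply/matrixP => i1 j1; rewrite !ord1 e mxE.
right=> x; have [i le ->] := Vs x; rewrite const //.
by apply/matrixP => i1 j1; rewrite !ord1 e mxE.
Qed.

Lemma string_mod_indecomposable (Q : quiver) (F : qshape Q) : linear_shape F ->
  indecomposable (string_mod k F).
Proof.
move=> lin; apply: (rigid_indecomposable (wrap_strict F)).
- exact: chi_invertible.
- exact: linear_rigid (wrap_strict F) lin.
- exact: chi_indecomposable.
Qed.

Lemma chi_tensor (L : quiver) : retract (chi k L) (qtensor (chi k L) (chi k L)).
Proof.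
exists (fun x => 1%:M), (fun x => 1%:M); split.
- move=> x y a; apply: etrans (mul1mx _) (esym (etrans (mulmx1 _) _)); exact: tprod1.
- move=> x y a; apply: etrans (mul1mx _) (esym (etrans (mulmx1 _) (esym _))); exact: (tprod1 _ 1 1).
- by move=> x; rewrite mul1mx.
Qed.

Section Wrap.
Variables (P : quiver) (L : quiver) (H : qmor L P).
Hypotheses (lin : linear_quiver L) (sH : strict_wrapping H).

(** The product is pushed down from L, where every module is a sum of strings of subintervals, and
    these push down to strings. *)
Lemma string_tensorl (w : qmod k P) : Add (@is_string k P) (qtensor w (pushdown H (chi k L))).
Proof.
apply: Add_retract (iso_retract (projection_formula sH w (chi k L))) _.
apply: (Add_pushdown sH _ (linear_decompose _ lin)) => _ [L' [H' [lin' sH' _ ->]]].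
have iso := @pushdown_comp k _ _ _ H' H (qmor_comp H H') sH' sH (strict_comp sH sH')
  (conj (fun=> erefl) (fun=> erefl)) (chi k L').
apply: Add_retract (iso_retract (iso_sym iso)) _; apply: Add_incl.
by exists L', (qmor_comp H H'); split=> //; apply: strict_comp.
Qed.

Lemma string_tensorr (w : qmod k P) : Add (@is_string k P) (qtensor (pushdown H (chi k L)) w).
Proof.
apply: Add_retract (iso_retract (projection_formula_left sH w (chi k L))) _.
apply: (Add_pushdown sH _ (linear_decompose _ lin)) => _ [L' [H' [lin' sH' _ ->]]].
have iso := @pushdown_comp k _ _ _ H' H (qmor_comp H H') sH' sH (strict_comp sH sH')
  (conj (fun=> erefl) (fun=> erefl)) (chi k L').
apply: Add_retract (iso_retract (iso_sym iso)) _; apply: Add_incl.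
by exists L', (qmor_comp H H'); split=> //; apply: strict_comp.
Qed.

Lemma string_retract_tensor (N : qmod k P) : retract (chi k L) (pullback H N) ->
  retract (pushdown H (chi k L)) (qtensor (pushdown H (chi k L)) N).
Proof.
move=> r; apply: retract_trans (iso_retract (iso_sym (projection_formula_left sH N (chi k L)))).
apply: pd_retract => //; apply: retract_trans (chi_tensor L) _.
by apply: retract_tensor r; apply: retract_refl.
Qed.

End Wrap.

(** A line has no monodromy: [go] transports a frame from the first vertex along the invertible
    arrows, which trivializes the pulled-back module, and the first coordinate is a copy of
    [chi]. *)
Lemma chi_retract_cyc_mod (L Z : quiver) (H : qmor L Z) (lam : k) s (gam : Q1 Z) :
  linear_quiver L -> lam != 0 -> (0 < s)%N ->
  retract (chi k L) (pullback H (cyc_mod lam s gam)).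
Proof.
move=> lin l0 s0; have [n [V [E [o [ori _ En exh [Vinj Vs]]]]]] := linear_walk lin.
pose act a : 'M[k]_s := if mor1 H a == gam then jordan lam s else 1%:M.
have actU a : act a \in unitmx.
  by rewrite /act; case: eqP => _; [apply: jordan_unit | apply: unitmx1].
pose go := fix go i : 'M[k]_s := if i is j.+1 then
  (if E j is Some a then (if o j then act a else invmx (act a)) *m go j else go j) else 1%:M.
have goU i : go i \in unitmx.
  elim: i => [|i IH] /=; first exact: unitmx1.
  by case: (E i) => // a; rewrite unitmx_mul IH andbT; case: (o i); rewrite ?unitmx_inv.
have [idx idxP] : exists idx : Q0 L -> nat, forall x, (idx x <= n)%N /\ x = V (idx x).
  apply: (fin_all_exists (P := fun x i => (i <= n)%N /\ x = V i)) => x.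
  by have [i le e] := Vs x; exists i.
have idxV i : (i <= n)%N -> idx (V i) = i.
  by move=> le; have [le' e] := idxP (V i); apply: Vinj.
have step a : go (idx (qhead a)) = act a *m go (idx (qtail a)).
  have [le et] := idxP (qtail a); have [ext _] := exh _ le.
  have ltE i : E i = Some a -> (i < n)%N by move=> Ei; rewrite -En Ei.
  case: (ext a et) => [[Ei oi] | [j [ej Ej oj]]].
    have := ori _ _ Ei; rewrite oi => -[_ ->].
    by rewrite idxV /= ?ltE // Ei oi.
  have := ori _ _ Ej; rewrite (negPf oj) => -[-> _].
  by rewrite idxV ?(ltnW (ltE _ Ej)) // ej /= Ej (negPf oj) mulKVmx.
pose z := Ordinal s0.
exists (fun x => go (idx x) *m delta_mx z 0), (fun x => delta_mx 0 z *m invmx (go (idx x))).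
split.
- by apply: qhomP => a; rewrite /= mulmx1 step mulmxA.
- apply: qhomP => a; rewrite /= mul1mx -/(act a) -mulmxA; congr (_ *m _).
  rewrite -[LHS]mulmx1 -(mulmxV (goU (idx (qtail a)))) mulmxA -(mulmxA _ (act a)) -step.
  by rewrite mulVmx // mul1mx.
by move=> x; rewrite mulmxA mulmxKV // mul_delta_mx; apply/matrixP => i j; rewrite !ord1 !mxE.
Qed.

End StringModules.

(** * Strings and windings inside a given tensor ideal *)

Section TensorIdeals.
Variables (k : fieldType) (Q : quiver) (I : kfamily k Q) (U : qmod k Q -> Prop).
Hypothesis idU : tensor_ideal I U.

(** The string is multiplied by itself: it is a summand of the push-down of (string over [dom F])
    (x) N, hence of the product of the Q-string with the push-down of N. *)
Lemma ideal_string (F : qshape Q) (cF : compatible I F) (N : qmod k (dom F)) (F' : qshape Q)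
    (H : qmor (dom F') (dom F)) :
  linear_shape F' -> strict_wrapping H -> is_comp (wrap F') (wrap F) H ->
  retract (chi k (dom F')) (pullback H N) -> U (pushdown (wrap F) N) -> U (string_mod k F').
Proof.
move=> lin sH cH r UN.
have iso := @pushdown_comp k _ _ _ H (wrap F) (wrap F') sH (wrap_strict F) (wrap_strict F')
  cH (chi k (dom F')).
apply: (tensor_ideal_retract idU (iso_retract iso)).
apply: (tensor_ideal_retract idU (pd_retract (wrap_strict F) (string_retract_tensor sH r))).
apply: (tensor_ideal_retract idU (pushdown_tensor (wrap_strict F) _ _)).
by have [_ _ _ _ Ut] := idU; apply: Ut => //; apply: in_mod_pushdown.
Qed.

(** Allows the minimality that defines [Nlaurent] to be applied to any tensor ideal of modules over
    Q. *)
Lemma winding_ideal (G : qshape Q) (cG : compatible I G) (gam : Q1 (dom G)) :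
  tensor_ideal (@laurent_ideal k) (fun V => in_mod (@laurent_ideal k) V /\
    U (pushdown (wrap G) (winding gam V))).
Proof.
have [Um Ui Us Ud Ut] := idU; have sG := wrap_strict G.
have ret V W : retract V W -> U (pushdown (wrap G) (winding gam W)) ->
    U (pushdown (wrap G) (winding gam V)).
  by move=> r; apply: (tensor_ideal_retract idU); apply: pd_retract => //; apply: winding_retract.
split=> [V [] // | V W [inV UV] iso | V W [inV UV] [inW UW] | V W [inVW UVW] | V W inV [inW UW]].
- have r := iso_retract (iso_sym iso).
  by split; [apply: in_mod_retract r inV | apply: ret r UV].
- split; first exact: in_mod_qsum_laurent.
  have [f [g [f' [g' [[hf hg hf' hg'] _ _ e]]]]] := qsum_split V W.
  apply: (tensor_ideal_retract idU) (Us _ _ UV UW).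
  pose pm V1 V2 (h : fam V1 V2) :=
    @pd_map k _ _ (wrap G) (winding gam V1) (winding gam V2) (fun _ => h tt).
  have hpm V1 V2 (h : fam V1 V2) : qhom h -> qhom (pm _ _ h).
    by move=> hh; apply: pd_map_hom => //; apply: winding_hom.
  apply: (retract_sum2 (hpm _ _ _ hf) (hpm _ _ _ hg) (hpm _ _ _ hf') (hpm _ _ _ hg')) => x.
  by rewrite !pd_map_comp -pd_map_add; apply: pd_map_id => y; apply: (e tt).
- have r1 := retract_qsuml V W; have r2 := retract_qsumr V W.
  by split; split; [apply: in_mod_retract r1 inVW | apply: ret r1 UVW
    | apply: in_mod_retract r2 inVW | apply: ret r2 UVW].
split; first exact: in_mod_tensor_laurent.
have r := pd_retract sG (iso_retract (iso_sym (winding_tensor gam V W))).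
apply: (tensor_ideal_retract idU r).
apply: (tensor_ideal_retract idU (pushdown_tensor sG _ _)).
by apply: Ut => //; apply: in_mod_pushdown.
Qed.

End TensorIdeals.

Lemma laurent_ideal_twist (k : fieldType) (U : qmod k laurent_quiver -> Prop) (nu mu : k) t :
  tensor_ideal (@laurent_ideal k) U -> nu != 0 -> mu != 0 ->
  U (laurent_mod mu t) -> U (laurent_mod (nu * mu) t).
Proof.
move=> idU n0 m0 Um; apply: (tensor_ideal_retract idU (twist_retract t n0 m0)).
have [_ _ _ _ Ut] := idU; apply: Ut => //.
exact/in_mod_laurent/laurent_invertible_mod.
Qed.

Lemma is_string_shape (k : fieldType) (Q : quiver) (G : qshape Q) (L : quiver)
    (H : qmor L (dom G)) (sH : strict_wrapping H) :
  qiso (pushdown (wrap G) (pushdown H (chi k L)))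
    (string_mod k (Shape (strict_comp (wrap_strict G) sH))).
Proof.
apply/iso_sym/(@pushdown_comp k _ _ _ H (wrap G)) => //; first exact: wrap_strict.
exact: strict_comp (wrap_strict G) sH.
Qed.

(** * Indecomposables in the tensor ideal of a string or a band *)

Lemma in_mod_iso (k : fieldType) (Q : quiver) (I : kfamily k Q) m n :
  qiso m n -> in_mod I n -> in_mod I m.
Proof. by move=> iso; apply: in_mod_retract (iso_retract iso). Qed.

(** The upper bound: [Add C] is itself a tensor ideal containing x, and by Krull-Schmidt its
    indecomposables are the members of C. *)
Lemma Nset_Add (k : fieldType) (Q : quiver) (I : kfamily k Q) (C : qmod k Q -> Prop) x m :
  (forall c, C c -> in_mod I c) -> (forall w c, C c -> Add C (qtensor w c)) ->
  (forall c, C c -> indecomposable c) -> Add C x -> Nset I x m -> exists2 c, C c & qiso m c.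
Proof.
move=> Ci Ct Cind Ax [_ ind /(_ _ (tensor_ideal_Add Ci Ct) Ax) Am].
have [c Cc r] := indecomposable_Add ind Am; exists c => //.
by apply/iso_sym/(indecomposable_retract (Cind c Cc) r); case: ind.
Qed.

(** Every push-down from [dom F] lies in [Add C], so closure under products is just the projection
    formula. Conversely [chi] pulls back to [chi], and [ideal_string] applies. *)
Lemma string_Nset (k : fieldType) (Q : quiver) (I : kfamily k Q) (F : qshape Q) m :
  linear_shape F -> compatible I F ->
  Nset I (string_mod k F) m <->
  exists F' : qshape Q,
    [/\ linear_shape F', compatible I F', subshape F' F & qiso m (string_mod k F')].
Proof.
move=> lF cF; split=> [Nm | [F' [lF' cF' [H [sH cH _ _]] iso]]]; last first.
  split.
  - by apply: in_mod_iso iso _; apply: in_mod_pushdown.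
  - by apply: iso_indecomposable (iso_sym iso) _; apply: string_mod_indecomposable.
  move=> U idU UF; have [_ Ui _ _ _] := idU; apply: Ui (iso_sym iso).
  by apply: (ideal_string idU cF lF' sH cH _ UF); apply: retract_refl.
pose C c := exists2 S, is_substring S & c = pushdown (wrap F) (S : qmod k (dom F)).
have AC M : Add C (pushdown (wrap F) M).
  apply: (Add_pushdown (wrap_strict F) _ (linear_decompose M lF)) => S sS.
  by apply: Add_incl; exists S.
have [||||c [_ [L [H [lin sH iH ->]]] ->] iso] := @Nset_Add _ _ I C _ m _ _ _ _ Nm.
- by move=> _ [S _ ->]; apply: in_mod_pushdown.
- move=> w _ [S _ ->].
  by apply: Add_retract (iso_retract (projection_formula (wrap_strict F) w S)) _.
- move=> _ [_ [L [H [lin sH iH ->]]] ->].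
  apply: iso_indecomposable (iso_sym (is_string_shape k sH)) _.
  exact: string_mod_indecomposable.
- exact: AC.
have cH : is_comp (qmor_comp (wrap F) H) (wrap F) H by [].
exists (Shape (strict_comp (wrap_strict F) sH)); split=> //.
- by apply: (@compatible_comp _ _ _ (Shape (strict_comp (wrap_strict F) sH)) F H).
- by exists H; split=> //; apply: injective_mor1.
- by apply: iso_trans iso _; apply: is_string_shape.
Qed.

Lemma band_Nset (k : closedFieldType) (Q : quiver) (I : kfamily k Q) (G : qshape Q)
    (lam : k) (s : nat) (gam : Q1 (dom G)) m :
  cyclic_shape G -> compatible I G -> lam != 0 -> (0 < s)%N ->
  Nset I (band_mod lam s gam) m <->
  (exists F' : qshape Q,
     [/\ linear_shape F', compatible I F', factors_through F' G
       & qiso m (string_mod k F')])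
  \/
  (exists (mu : k) (t : nat),
     [/\ mu != 0, (1 <= t)%N, Nlaurent (1 : k) s (laurent_mod (1 : k) t)
       & qiso m (band_mod mu t gam)]).
Proof.
move=> cyG cG l0 s0; have sG := wrap_strict G.
(* The smallest tensor ideal containing b_{1,s}, decomposable modules included. *)
pose W V := forall U, tensor_ideal (@laurent_ideal k) U -> U (laurent_mod 1 s) -> U V.
have band_ind mu t : mu != 0 -> (0 < t)%N -> indecomposable (band_mod mu t gam).
  move=> mu0 t0; have iJ := laurent_invertible_mod t mu0.
  apply: (rigid_indecomposable sG (M := winding gam (laurent_mod mu t))).
  - exact: winding_invertible.
  - exact: cyclic_rigid.
  - by apply: winding_indecomposable => //; [apply: cyG.1 | apply: laurent_mod_indecomposable].
split=> [Nm | ].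
  pose C c := (exists2 S, is_string S & c = pushdown (wrap G) (S : qmod k (dom G))) \/
    exists mu t, [/\ mu != 0, (0 < t)%N, W (laurent_mod mu t) & c = band_mod mu t gam].
  have AS X : Add (@is_string k (dom G)) X -> Add C (pushdown (wrap G) X).
    by apply: Add_pushdown => // S sS; apply: Add_incl; left; exists S.
  have AW V : in_mod (@laurent_ideal k) V -> W V -> Add C (pushdown (wrap G) (winding gam V)).
    move=> /in_mod_laurent iV WV.
    pose D c := exists mu t, [/\ mu != 0, (0 < t)%N, W (laurent_mod mu t)
      & c = winding gam (laurent_mod mu t)].
    apply: (@Add_pushdown _ _ _ _ sG D) => [_ [mu [t [mu0 t0 Wt ->]]]|].
      by apply: Add_incl; right; exists mu, t.
    apply: Add_winding (laurent_decompose iV) => _ [mu [t [mu0 t0 -> r]]].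
    apply: Add_incl; exists mu, t; split=> // U idU U1.
    exact: (tensor_ideal_retract idU r (WV U idU U1)).
  have [||||c Cc iso] := @Nset_Add _ _ I C _ m _ _ _ _ Nm.
  - by move=> _ [[S _ ->] | [mu [t [_ _ _ ->]]]]; apply: in_mod_pushdown.
  - move=> w _ [[_ [L [H [lin sH ->]]] ->] | [mu [t [mu0 t0 Wt ->]]]].
      apply: Add_retract (iso_retract (projection_formula sG w _)) _; apply: AS.
      exact: string_tensorl.
    apply: Add_retract (iso_retract (projection_formula sG w _)) _.
    pose D c := @is_string k (dom G) c \/ exists V, [/\ in_mod (@laurent_ideal k) V, W V & c = winding gam V].
    apply: (@Add_pushdown _ _ _ _ sG D) => [c [sc | [V [iV WV ->]]]|].
    + by apply: AS; apply: Add_incl.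
    + exact: AW.
    apply: Add_tensorl (cyclic_decompose gam (pullback (wrap G) w) cyG.1) => c [[L [H [lin sH ->]]] | [V iV ->]].
      have toD X : Add (@is_string k (dom G)) X -> Add D X.
        move=> A; rewrite /Add; elim: A => [h z | c' f g h h1 Cc hf hg H1 IH e1].
          exact: FactorsSum0.
        by apply: (FactorsSumS _ hf hg IH e1); left.
      by apply: toD; apply: string_tensorr.
    apply: Add_retract (iso_retract (winding_tensor gam V (laurent_mod mu t))) _.
    apply: Add_incl; right; exists (qtensor V (laurent_mod mu t)); split=> //.
      apply: in_mod_tensor_laurent; first exact/in_mod_laurent.
      exact/in_mod_laurent/laurent_invertible_mod.
    move=> U idU U1; have [_ _ _ _ Ut] := idU; apply: Ut; first exact/in_mod_laurent.
    exact: Wt.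
  - move=> _ [[_ [L [H [lin sH ->]]] ->] | [mu [t [mu0 t0 _ ->]]]]; last exact: band_ind.
    apply: iso_indecomposable (iso_sym (is_string_shape k sH)) _.
    exact: string_mod_indecomposable.
  - apply: Add_incl; right; exists lam, s; split=> // U idU U1.
    by have := laurent_ideal_twist idU l0 (oner_neq0 k) U1; rewrite mulr1.
  case: Cc iso => [[_ [L [H [lin sH ->]]] ->] | [mu [t [mu0 t0 Wt ->]]]] iso; [left | right].
    exists (Shape (strict_comp sG sH)); split=> //.
    - apply: (@compatible_comp _ _ _ (Shape (strict_comp sG sH)) G H) => //.
    - by exists H.
    - by apply: iso_trans iso _; apply: is_string_shape.
  exists mu, t; split=> //; split.
  - exact/in_mod_laurent/laurent_invertible_mod/oner_neq0.
  - by apply: laurent_mod_indecomposable => //; apply: oner_neq0.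
  (* Twisting by the inverse of mu brings the eigenvalue to 1. *)
  move=> U idU U1; have := laurent_ideal_twist idU (invr_neq0 mu0) mu0 (Wt U idU U1).
  by rewrite mulVf.
case=> [[F' [lF' cF' [H [sH cH]] iso]] | [mu [t [mu0 t0 [_ _ Nt] iso]]]]; split.
- by apply: in_mod_iso iso _; apply: in_mod_pushdown.
- by apply: iso_indecomposable (iso_sym iso) _; apply: string_mod_indecomposable.
- move=> U idU UB; have [_ Ui _ _ _] := idU; apply: Ui (iso_sym iso).
  apply: (ideal_string idU cG lF' sH cH _ UB).
  exact: chi_retract_cyc_mod.
- by apply: in_mod_iso iso _; apply: in_mod_pushdown.
- by apply: iso_indecomposable (iso_sym iso) _; apply: band_ind.
move=> U idU UB; have [_ Ui _ _ _] := idU; apply: Ui (iso_sym iso).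
have idW := winding_ideal idU cG gam.
(* Twisting by the inverse of lam passes from the given band to b_{1,s}; twisting by mu afterwards
   reaches b_{mu,t}. *)
have U1 : in_mod (@laurent_ideal k) (laurent_mod 1 s) /\
    U (pushdown (wrap G) (winding gam (laurent_mod 1 s))).
  rewrite -(mulVf l0); apply: (laurent_ideal_twist idW) => //; first exact: invr_neq0.
  by split=> //; apply/in_mod_laurent/laurent_invertible_mod.
have := laurent_ideal_twist idW mu0 (oner_neq0 k) (Nt _ idW U1).
by rewrite mulr1 => -[].
Qed.

Unset Implicit Arguments.

Theorem theorem5 (k : closedFieldType) (Q : quiver) (I : kfamily k Q)
    (hI : string_category I)
    (F : qshape Q) (hF : linear_shape F) (cF : compatible I F)
    (G : qshape Q) (hG : cyclic_shape G) (cG : compatible I G)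
    (lam : k) (hlam : lam != 0) (s : nat) (hs : (0 < s)%N)
    (gam : Q1 (dom G)) :
  (forall m : qmod k Q,
     Nset I (string_mod k F) m <->
     exists F' : qshape Q,
       [/\ linear_shape F', compatible I F', subshape F' F
         & qiso m (string_mod k F')])
  /\
  (forall m : qmod k Q,
     Nset I (band_mod lam s gam) m <->
     (exists F' : qshape Q,
        [/\ linear_shape F', compatible I F', factors_through F' G
          & qiso m (string_mod k F')])
     \/
     (exists (mu : k) (t : nat),
        [/\ mu != 0, (1 <= t)%N, Nlaurent (1 : k) s (laurent_mod (1 : k) t)
          & qiso m (band_mod mu t gam)])).
Proof.
split=> m; first exact: string_Nset.
exact: band_Nset.
Qed.
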